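(* Let $g\colon\mathbb{R}^d\to\mathbb{R}$ be $C^2$-smooth with $\beta$-Lipschitz gradient, let $r\colon\mathbb{R}^d\to\mathbb{R}\cup\{+\infty\}$ be closed, $\rho$-weakly convex and not identically $+\infty$, and suppose that $f:=g+r$ is bounded from below and has the strict saddle property. Choose any constant $\mu\in(0,\rho^{-1})$ and a damping parameter $\alpha\in(0,1)$ satisfying $$\alpha\cdot\left(\mu\beta+(1+\mu\beta)\max\left\{1,\tfrac{\mu\rho}{1-\mu\rho}\right\}\right)<1.$$ Consider the algorithm $$x_{k+1}=(1-\alpha)x_k+\alpha\cdot\mathrm{prox}_{\mu r}\left(x_k-\mu\nabla g(x_k)\right),\qquad k\ge0.$$ Then for (Lebesgue) almost all initializers $x_0\in\mathbb{R}^d$ the following holds: if the limit of $\{x_k\}_{k\ge0}$ exists, it must be a local minimizer of $f$.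
   Context: A function $f\colon\mathbb{R}^d\to\mathbb{R}\cup\{\infty\}$ is closed if its epigraph is closed; it is $\rho$-weakly convex ($\rho>0$) if $x\mapsto f(x)+\frac{\rho}{2}\|x\|^2$ is convex, and weakly convex if it is $\rho$-weakly convex for some $\rho>0$. The proximal map is $\mathrm{prox}_{\mu r}(x)=\mathrm{argmin}_y\{r(y)+\frac1{2\mu}\|y-x\|^2\}$. Subdifferential: if $f(\bar x)$ is finite, $\partial f(\bar x)$ is the set of $v$ with $f(x)\ge f(\bar x)+\langle v,x-\bar x\rangle+o(\|x-\bar x\|)$ as $x\to\bar x$; $\partial f(\bar x)=\emptyset$ if $f(\bar x)=\infty$. A point $\bar x$ is critical for $f$ if $0\in\partial f(\bar x)$. Manifolds: $\mathcal{M}\subset\mathbb{R}^d$ is a $C^p$ manifold of dimension $k$ around $\bar x\in\mathcal{M}$ if there are an open neighborhood $U$ of $\bar x$ and a $C^p$ map $G\colon\mathbb{R}^d\to\mathbb{R}^{d-k}$ with $\nabla G(\bar x)$ of full rank and $\mathcal{M}\cap U=\{x\in U:G(x)=0\}$. The tangent space is $T_{\mathcal{M}}(\bar x)=\ker\nabla G(\bar x)$. Active manifold: for a closed weakly convex $f$ with critical point $\bar x$, a set $\mathcal{M}\ni\bar x$ is an active $C^p$ manifold around (at) $\bar x$ if there is a neighborhood $U$ of $\bar x$ such that (smoothness) $\mathcal{M}\cap U$ is a $C^p$-smooth manifold and the restriction of $f$ to $\mathcal{M}\cap U$ is $C^p$-smooth; (sharpness) $\inf\{\|v\|:v\in\partial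 f(x),\ x\in U\setminus\mathcal{M}\}>0$ (with $\inf\emptyset=+\infty$). Second-order variation: $f_{\mathcal{M}}:=f+\delta_{\mathcal{M}}$, where $\delta_{\mathcal M}$ is $0$ on $\mathcal M$ and $+\infty$ off it. If $\mathcal{M}$ is an active $C^2$ manifold at the critical point $\bar x$ and $u\in T_{\mathcal{M}}(\bar x)$, then $d^2f_{\mathcal{M}}(\bar x)(u)$ denotes the parabolic subderivative $\liminf_{t\searrow0,\,w'\to w}\frac{f_{\mathcal{M}}(\bar x+tu+\frac12t^2w')-f_{\mathcal{M}}(\bar x)}{\frac12t^2}$, whose value is the same for all $w$ for which it is finite. Equivalently, if $F$ is a $C^2$ function agreeing with $f$ on $\mathcal{M}$ near $\bar x$, $G=0$ are local defining equations of $\mathcal{M}$, and $\bar\lambda$ is the unique multiplier with $\nabla F(\bar x)+\sum_i\bar\lambda_i\nabla G_i(\bar x)=0$, then $d^2f_{\mathcal{M}}(\bar x)(u)=\langle(\nabla^2F(\bar x)+\sum_i\bar\lambda_i\nabla^2G_i(\bar x))u,u\rangle$. Strict saddles: a critical point $\bar x$ of a weakly convex $f$ is a strict saddle if there is a $C^2$ active manifold $\mathcal{M}$ of $f$ at $\bar x$ and $d^2f_{\mathcal{M}}(\bar x)(u)<0$ for some $u\in T_{\mathcal{M}}(\bar x)$. The function $f$ has the strict saddle property if each of its critical points is either a local minimizer or a strict saddle. *)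

(* Defs.v *)
From HB Require Import structures.
From mathcomp Require Import all_boot all_order all_algebra.
From mathcomp Require Import all_classical all_reals all_analysis.
Set Implicit Arguments.
Unset Strict Implicit.
Unset Printing Implicit Defensive.
Import Order.TTheory GRing.Theory Num.Theory.
Import numFieldNormedType.Exports.
Local Open Scope classical_set_scope.
Local Open Scope ring_scope.

(* The library norm on 'rV[R]_d is the sup norm: it is only used for its
   topology and differential calculus, where the choice of norm is irrelevant. *)
Definition dotp (R : realType) (d : nat) (u v : 'rV[R]_d) : R :=
  \sum_(i < d) u ord0 i * v ord0 i.

Definition enorm (R : realType) (d : nat) (u : 'rV[R]_d) : R :=
  Num.sqrt (dotp u u).

Definition grad (R : realType) (d : nat) (g : 'rV[R]_d -> R) (x : 'rV[R]_d) :
    'rV[R]_d :=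
  \row_(i < d) 'D_(delta_mx ord0 i) (g : 'rV[R]_d -> R^o) x.

(* C^p on the whole space: the derivative of F is C^p iff each of its
   directional components x |-> 'D_v F x is, the source being
   finite-dimensional. *)
Fixpoint Cp (R : realType) (d : nat) (W : normedModType R) (p : nat)
    (F : 'rV[R]_d -> W) : Prop :=
  if p is q.+1 then
    (forall x, differentiable F x) /\ (forall v, Cp q (fun x => 'D_v F x))
  else continuous F.

Section extended_valued.
Context (R : realType) (d : nat).
Implicit Types (f : 'rV[R]_d -> \bar R) (x u v w : 'rV[R]_d).
Implicit Types (M N : set 'rV[R]_d).

Definition closed_fun f : Prop :=
  closed [set z : 'rV[R]_d * R | (f z.1 <= z.2%:E)%E].

(* Meaningful for functions that avoid -oo; for those, t = 0 and t = 1 add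
   nothing, since 0 * +oo = 0. *)
Definition convex_efun f : Prop :=
  forall x y (t : R), 0 <= t <= 1 ->
    (f (t *: x + (1 - t) *: y)%R <= t%:E * f x + (1 - t)%R%:E * f y)%E.

Definition rho_weakly_convex (rho : R) f : Prop :=
  convex_efun (fun x => f x + (rho / 2 * enorm x ^+ 2)%R%:E)%E.

Definition local_minimizer f x : Prop :=
  f x \is a fin_num /\ \forall y \near x, (f x <= f y)%E.

Definition subdiff f x : set 'rV[R]_d :=
  [set v | f x \is a fin_num /\
    forall e : R, 0 < e -> \forall y \near x,
      (f x + (dotp v (y - x) - e * enorm (y - x))%R%:E <= f y)%E].

Definition critical f x : Prop := subdiff f x 0.

Definition proxset (mu : R) f x : set 'rV[R]_d :=
  [set y | forall z,
    (f y + ((2 * mu)^-1 * enorm (y - x) ^+ 2)%R%:E <=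
     f z + ((2 * mu)^-1 * enorm (z - x) ^+ 2)%R%:E)%E].

(* The minimizer is unique when f is closed, proper and rho-weakly convex with
   0 < mu < rho^-1; [get] selects it. *)
Definition prox (mu : R) f x : 'rV[R]_d := get (proxset mu f x).

Definition local_equations (p k : nat) M x (U : set 'rV[R]_d)
    (G : 'rV[R]_d -> 'rV[R]_(d - k)) : Prop :=
  [/\ open_nbhs x U, Cp p G, \rank ('J G x) = (d - k)%N &
      M `&` U = [set y | U y /\ G y = 0]].

Definition manifold_around (p k : nat) M x : Prop :=
  [/\ M x, (k <= d)%N & exists U G, @local_equations p k M x U G].

(* ker (∇G x), which does not depend on the local equations G chosen. *)
Definition tangent_space (p : nat) M x : set 'rV[R]_d :=
  [set u | exists k U G,
    [/\ (k <= d)%N, @local_equations p k M x U G & 'd G x u = 0]].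

Definition smooth_manifold (p : nat) N : Prop :=
  exists k, forall y, N y -> manifold_around p k N y.

Definition smooth_restriction (p : nat) f N : Prop :=
  forall y, N y -> exists (V : set 'rV[R]_d) (F : 'rV[R]_d -> R),
    [/\ open_nbhs y V, Cp p (F : 'rV[R]_d -> R^o) &
        forall z, N z -> V z -> f z = (F z)%:E].

Definition active_manifold (p : nat) f M x : Prop :=
  M x /\ exists U : set 'rV[R]_d,
    [/\ nbhs x U, smooth_manifold p (M `&` U),
        smooth_restriction p f (M `&` U) &
        (0 < ereal_inf [set (enorm v)%:E |
                v in \bigcup_(y in U `\` M) subdiff f y])%E].

Definition restrict_to f M x : \bar R :=
  if x \in M then f x else +oo%E.

Definition parabolic_subderivative f x u w : \bar R :=
  limf_einf
    (fun z : R * 'rV[R]_d =>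
      (f (x + z.1 *: u + (2^-1 * z.1 ^+ 2) *: z.2)%R - f x) *
      ((2^-1 * z.1 ^+ 2)^-1)%R%:E)%E
    (filter_prod (0 : R)^'+ (nbhs w)).

(* c is the value of d^2 f_M(x)(u): the common finite value of the parabolic
   subderivatives at x for u, over all w. *)
Definition is_d2 f M x u (c : R) : Prop :=
  exists w, parabolic_subderivative (restrict_to f M) x u w = c%:E.

Definition strict_saddle f x : Prop :=
  critical f x /\
  exists M, active_manifold 2 f M x /\
    exists u (c : R), [/\ tangent_space 2 M x u, is_d2 f M x u c & c < 0].

Definition strict_saddle_property f : Prop :=
  forall x, critical f x -> local_minimizer f x \/ strict_saddle f x.

Definition box (a b : 'rV[R]_d) : set 'rV[R]_d :=
  [set x | forall i, a ord0 i <= x ord0 i <= b ord0 i].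

(* Lebesgue outer measure on R^d, by covers with countably many boxes; the
   index predicate P allows finite covers (needed only when d = 0, where every
   box has volume 1). *)
Definition lebesgue_outer (A : set 'rV[R]_d) : \bar R :=
  ereal_inf [set s | exists (P : pred nat) (a b : nat -> 'rV[R]_d),
    [/\ forall n i, a n ord0 i <= b n ord0 i,
        A `<=` \bigcup_(n in [set n | P n]) box (a n) (b n) &
        s = (\sum_(0 <= n <oo | P n)
               (\prod_(i < d) (b n ord0 i - a n ord0 i))%R%:E)%E]].

Definition lebesgue_null (A : set 'rV[R]_d) : Prop := lebesgue_outer A = 0%E.

Definition prox_gradient_step (mu alpha : R) (g : 'rV[R]_d -> R)
    (r : 'rV[R]_d -> \bar R) (x : 'rV[R]_d) : 'rV[R]_d :=
  (1 - alpha) *: x + alpha *: prox mu r (x - mu *: grad g x).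

Definition composite (g : 'rV[R]_d -> R) (r : 'rV[R]_d -> \bar R) :
    'rV[R]_d -> \bar R :=
  fun x => ((g x)%:E + r x)%E.

End extended_valued.

(* Main.v *)
(* The iteration map T satisfies |T x - T y| >= c |x - y| with c > 0, so preimages
   of null sets under its iterates are null, and the limit of an orbit is a fixed
   point, hence a critical point of f.  At a strict saddle, T has a strict
   derivative along the active manifold and contracts the normal directions up to
   the factor 1 - alpha; in place of the center-stable manifold theorem we exhibit
   a quadratic form q, positive in some direction, such that
   q (T x - T y) >= theta q (x - y) near the saddle for some theta > 1.  Two orbits
   staying close to the saddle then satisfy q (x - y) <= 0, so their initial points
   lie on a Lipschitz graph over a hyperplane, which is null.  Countably many
   rational balls and iterates of T cover all orbits converging to a saddle. *)

From HB Require Import structures.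
Require Import Defs.
From mathcomp Require Import all_boot all_order all_algebra.
From mathcomp Require Import all_classical all_reals all_analysis.
From mathcomp Require Import ring lra.
Import Order.TTheory GRing.Theory Num.Theory.
Import numFieldNormedType.Exports.
Local Open Scope classical_set_scope.
Local Open Scope ring_scope.
Set Implicit Arguments.
Unset Strict Implicit.
Unset Printing Implicit Defensive.

(** All local estimates compare two nearby points: a quadratic form in [T x - T y] calls only for a
    strict derivative at the saddle [l], not for smoothness of the prox around it. The link with the
    saddle is that [mu^-1 (z - prox z) + grad g (prox z)] is a subgradient of [f] at [prox z],
    Lipschitz in [z] and zero at [z = l - mu grad g l]. Near that [z], sharpness forces [prox z]
    onto the active manifold, where [f] is C^2. Subgradients there are known only up to normal
    vectors, so their differences are projected by the tangent projector [P]; what the projection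
    loses is recovered from chords of the manifold being almost tangent. With [H] the Hessian of the
    Lagrangian of [f] and [Gm] that of [g], the prox has tangential derivative [B^-1], where
    [B = 1 + mu P (H - Gm) P] is positive definite because the prox is cocoercive. The bound on
    [alpha] acts twice: it gives the lower bound on [|T x - T y|], and it makes [B - alpha mu P H P]
    nonnegative on tangent vectors, which excludes negative eigenvalues of the tangential derivative
    of [T]. A direction of negative curvature of [H] produces one above 1. *)

Ltac nonneg := repeat first [done | exact: ltW | apply: addr_ge0
  | apply: mulr_ge0 | apply: exprn_ge0 | rewrite invr_ge0].

(** * Entries, inner product and norms of row vectors *)

Lemma mx_addE (R : realType) (m n : nat) (A B : 'M[R]_(m, n)) i j :
  (A + B) i j = A i j + B i j.
Proof. by rewrite mxE. Qed.

Lemma mx_oppE (R : realType) (m n : nat) (A : 'M[R]_(m, n)) i j :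
  (- A) i j = - A i j.
Proof. by rewrite mxE. Qed.

Lemma mx_scaleE (R : realType) (m n : nat) (a : R) (A : 'M[R]_(m, n)) i j :
  (a *: A) i j = a * A i j.
Proof. by rewrite mxE. Qed.

Lemma mx_zeroE (R : realType) (m n : nat) i j : (0 : 'M[R]_(m, n)) i j = 0.
Proof. by rewrite mxE. Qed.

Ltac rowring :=
  apply/rowP => ?; rewrite ?(mx_addE, mx_oppE, mx_scaleE, mx_zeroE); ring.

Lemma dotpE (R : realType) (d : nat) (u v : 'rV[R]_d) :
  dotp u v = (u *m v^T) ord0 ord0.
Proof. by rewrite mxE; apply: eq_bigr => i _; rewrite mxE. Qed.

Lemma dotpC (R : realType) (d : nat) (u v : 'rV[R]_d) : dotp u v = dotp v u.
Proof. by apply: eq_bigr => i _; rewrite mulrC. Qed.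

Lemma dotpDl (R : realType) (d : nat) (u v w : 'rV[R]_d) :
  dotp (u + v) w = dotp u w + dotp v w.
Proof. by rewrite !dotpE mulmxDl mxE. Qed.

Lemma dotpZl (R : realType) (d : nat) (a : R) (u v : 'rV[R]_d) :
  dotp (a *: u) v = a * dotp u v.
Proof. by rewrite !dotpE -scalemxAl mxE. Qed.

Lemma dotpNl (R : realType) (d : nat) (u v : 'rV[R]_d) :
  dotp (- u) v = - dotp u v.
Proof. by rewrite -scaleN1r dotpZl mulN1r. Qed.

Lemma dotpBl (R : realType) (d : nat) (u v w : 'rV[R]_d) :
  dotp (u - v) w = dotp u w - dotp v w.
Proof. by rewrite dotpDl dotpNl. Qed.

Lemma dotpDr (R : realType) (d : nat) (u v w : 'rV[R]_d) :
  dotp w (u + v) = dotp w u + dotp w v.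
Proof. by rewrite dotpC dotpDl !(dotpC w). Qed.

Lemma dotpZr (R : realType) (d : nat) (a : R) (u v : 'rV[R]_d) :
  dotp u (a *: v) = a * dotp u v.
Proof. by rewrite dotpC dotpZl dotpC. Qed.

Lemma dotpNr (R : realType) (d : nat) (u v : 'rV[R]_d) :
  dotp u (- v) = - dotp u v.
Proof. by rewrite dotpC dotpNl dotpC. Qed.

Lemma dotpBr (R : realType) (d : nat) (u v w : 'rV[R]_d) :
  dotp w (u - v) = dotp w u - dotp w v.
Proof. by rewrite dotpDr dotpNr. Qed.

Lemma dotp0l (R : realType) (d : nat) (u : 'rV[R]_d) : dotp 0 u = 0.
Proof. by rewrite dotpE mul0mx mxE. Qed.

Lemma dotp0r (R : realType) (d : nat) (u : 'rV[R]_d) : dotp u 0 = 0.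
Proof. by rewrite dotpC dotp0l. Qed.

Lemma dotp_mull (R : realType) (d n : nat) (u : 'rV[R]_d) (v : 'rV[R]_n)
    (X : 'M[R]_(d, n)) : dotp (u *m X) v = dotp u (v *m X^T).
Proof. by rewrite !dotpE trmx_mul trmxK mulmxA. Qed.

Definition dotpE_simp := (dotpDl, dotpDr, dotpBl, dotpBr, dotpNl, dotpNr,
  dotpZl, dotpZr, dotp0l, dotp0r).

Lemma mx_entry_norm (R : realType) (m n : nat) (A : 'M[R]_(m, n)) i j :
  `|A i j| <= `|A|.
Proof.
by rewrite [leRHS]/Num.norm/= mx_normrE; apply/bigmax_geP; right; exists (i, j).
Qed.

Lemma mx_norm_le (R : realType) (m n : nat) (A : 'M[R]_(m, n)) (e : R) :
  0 <= e -> (forall i j, `|A i j| <= e) -> `|A| <= e.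
Proof.
move=> e0 Ae; rewrite [leLHS]/Num.norm/= mx_normrE.
by apply/bigmax_leP; split => // -[i j] _; exact: Ae.
Qed.

Lemma mulmx_norm (R : realType) (m n p : nat) (A : 'M[R]_(m, n))
    (B : 'M[R]_(n, p)) : `|A *m B| <= n%:R * `|A| * `|B|.
Proof.
apply: mx_norm_le => [|i j]; first by rewrite !mulr_ge0.
rewrite mxE (le_trans (ler_norm_sum _ _ _))//.
rewrite (@le_trans _ _ (\sum_(k < n) `|A| * `|B|))//.
  by apply: ler_sum => k _; rewrite normrM ler_pM// mx_entry_norm.
by rewrite sumr_const card_ord -mulrA mulr_natl.
Qed.

Lemma mx_norm_tr (R : realType) (m n : nat) (A : 'M[R]_(m, n)) : `|A^T| = `|A|.
Proof.
apply/eqP; rewrite eq_le; apply/andP; split; apply: mx_norm_le => // i j.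
  by rewrite mxE mx_entry_norm.
by have := mx_entry_norm A^T j i; rewrite mxE.
Qed.

Lemma dotp_norm (R : realType) (d : nat) (u v : 'rV[R]_d) :
  `|dotp u v| <= d%:R * `|u| * `|v|.
Proof.
rewrite dotpE (le_trans (mx_entry_norm _ _ _))// (le_trans (mulmx_norm _ _))//.
by rewrite mx_norm_tr.
Qed.

Lemma dotp_ge0 (R : realType) (d : nat) (u : 'rV[R]_d) : 0 <= dotp u u.
Proof. by apply: sumr_ge0 => i _; rewrite -expr2 sqr_ge0. Qed.

Lemma enorm_ge0 (R : realType) (d : nat) (u : 'rV[R]_d) : 0 <= enorm u.
Proof. exact: sqrtr_ge0. Qed.

Lemma enorm_sqr (R : realType) (d : nat) (u : 'rV[R]_d) :
  enorm u ^+ 2 = dotp u u.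
Proof. by rewrite sqr_sqrtr// dotp_ge0. Qed.

Lemma enorm_le_of_sqr (R : realType) (d : nat) (u : 'rV[R]_d) (e : R) :
  0 <= e -> dotp u u <= e ^+ 2 -> enorm u <= e.
Proof.
by move=> e0 ue; rewrite -(ler_pXn2r (n := 2))// ?nnegrE ?enorm_ge0// enorm_sqr.
Qed.

Lemma norm_le_enorm (R : realType) (d : nat) (u : 'rV[R]_d) : `|u| <= enorm u.
Proof.
apply: mx_norm_le => [|i j]; first exact: enorm_ge0.
rewrite ord1 -sqrtr_sqr ler_wsqrtr// /dotp (bigD1 j)//= -expr2 lerDl.
by apply: sumr_ge0 => k _; rewrite -expr2 sqr_ge0.
Qed.

Lemma norm_sqr_le_dotp (R : realType) (d : nat) (u : 'rV[R]_d) :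
  `|u| ^+ 2 <= dotp u u.
Proof. by rewrite -enorm_sqr lerXn2r ?nnegrE ?enorm_ge0// norm_le_enorm. Qed.

Lemma dotp_le_norm_sqr (R : realType) (d : nat) (u : 'rV[R]_d) :
  dotp u u <= d%:R * `|u| ^+ 2.
Proof.
by rewrite expr2 mulrA (le_trans _ (dotp_norm u u))// ler_norm.
Qed.

Lemma enorm_le_norm (R : realType) (d : nat) (u : 'rV[R]_d) :
  enorm u <= d%:R * `|u|.
Proof.
apply: enorm_le_of_sqr; first by rewrite mulr_ge0.
rewrite (le_trans (dotp_le_norm_sqr u))// exprMn ler_wpM2r ?sqr_ge0//.
by rewrite -natrX ler_nat; case: d u => // d u; rewrite leq_pmull.
Qed.

Lemma enorm0_eq0 (R : realType) (d : nat) (u : 'rV[R]_d) : enorm u <= 0 -> u = 0.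
Proof.
by move=> u0; apply/eqP; rewrite -normr_le0 (le_trans (norm_le_enorm u)).
Qed.

Lemma cauchy_schwarz (R : realType) (d : nat) (u v : 'rV[R]_d) :
  dotp u v <= enorm u * enorm v.
Proof.
have [/enorm0_eq0->|u0] := leP (enorm u) 0.
  by rewrite dotp0l mulr_ge0 ?enorm_ge0.
have := dotp_ge0 (dotp u u *: v - dotp u v *: u).
rewrite !dotpE_simp (dotpC v u) -enorm_sqr.
set a := dotp u v; rewrite -(enorm_sqr v) => h.
have {}h : a ^+ 2 <= (enorm u * enorm v) ^+ 2.
  have : 0 <= enorm u ^+ 2 * ((enorm u * enorm v) ^+ 2 - a ^+ 2).
    by rewrite exprMn; apply: le_trans h _; rewrite le_eqVlt; apply/orP; left;
       apply/eqP; ring.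
  by rewrite pmulr_rge0 ?subr_ge0// exprn_gt0.
have [a0|a0] := leP a 0; first by rewrite (le_trans a0)// mulr_ge0 ?enorm_ge0.
by move: h; rewrite ler_pXn2r// ?nnegrE ?mulr_ge0 ?enorm_ge0// ltW.
Qed.

Lemma enormD (R : realType) (d : nat) (u v : 'rV[R]_d) :
  enorm (u + v) <= enorm u + enorm v.
Proof.
apply: enorm_le_of_sqr; first by rewrite addr_ge0 ?enorm_ge0.
rewrite !dotpE_simp (dotpC v u) sqrrD !enorm_sqr.
have := cauchy_schwarz u v; lra.
Qed.

Lemma enormZ (R : realType) (d : nat) (a : R) (u : 'rV[R]_d) :
  enorm (a *: u) = `|a| * enorm u.
Proof.
by rewrite /enorm !dotpE_simp mulrA -expr2 sqrtrM ?sqr_ge0// sqrtr_sqr.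
Qed.

Lemma enormN (R : realType) (d : nat) (u : 'rV[R]_d) : enorm (- u) = enorm u.
Proof. by rewrite -scaleN1r enormZ normrN1 mul1r. Qed.

Lemma nbhs_normE (R : realType) (d : nat) (x : 'rV[R]_d) (U : set 'rV[R]_d) :
  nbhs x U <-> exists2 e : R, 0 < e & forall y, `|y - x| < e -> U y.
Proof.
split=> [/nbhs_ballP[e e0 eU]|[e e0 eU]].
  by exists e => // y yx; apply: eU; rewrite -ball_normE /ball_/= distrC.
by apply/nbhs_ballP; exists e => // y; rewrite -ball_normE /ball_/= distrC; exact: eU.
Qed.

(** Supplies most of the later radii: with [1 + c] in place of [c] the quotient makes sense for
    [c = 0], so constants built from norms need not be positive. *)
Lemma small_mul (R : realType) (c eta del : R) :
  0 <= c -> 0 < eta -> del <= eta / (1 + c) -> c * del <= eta.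
Proof.
move=> c0 eta0; rewrite ler_pdivlMr ?ltr_pwDl// mulrDr mulr1 [del * c]mulrC.
have [del0|del0] := leP 0 del; first by lra.
by move=> _; apply: le_trans (ltW eta0); rewrite mulr_ge0_le0// ltW.
Qed.

Lemma norm_closed_le (R : realType) (m : nat) (r : R) :
  closed [set w : 'rV[R]_m | `|w| <= r].
Proof.
rewrite (_ : [set _ | _] = (fun w : 'rV[R]_m => `|w|) @^-1` [set x | x <= r])//.
apply: closed_comp; last exact: closed_le.
by move=> w _; exact: norm_continuous.
Qed.

(** * Null sets *)

(* Outer Lebesgue nullity with cubes [|x - c| <= s] for the sup norm.  The index
   predicate [b] allows finite covers, as in [lebesgue_outer]. *)
Definition cnull (R : realType) (d : nat) (A : set 'rV[R]_d) : Prop :=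
  forall e : R, 0 < e -> exists (b : pred nat) (c : nat -> 'rV[R]_d) (s : nat -> R),
    [/\ forall n, 0 <= s n,
        forall x, A x -> exists2 n, b n & `|x - c n| <= s n &
        forall N, \sum_(n < N | b n) s n ^+ d <= e].

Lemma sumr_subseq_le (R : realType) (I : eqType) (J J' : seq I) (F : I -> R) :
  uniq J -> {subset J <= J'} -> (forall i, 0 <= F i) ->
  \sum_(i <- J) F i <= \sum_(i <- J') F i.
Proof.
move=> uJ; elim: J uJ J' => [|a J IH] /= uJ J' JJ' F0.
  by rewrite big_nil sumr_ge0.
move/andP: uJ => [aJ uJ].
have aJ' : a \in J' by apply: JJ'; rewrite inE eqxx.
rewrite big_cons (perm_big _ (perm_to_rem aJ')) big_cons lerD2l IH// => i iJ.
have : i \in a :: rem a J'.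
  by rewrite -(perm_mem (perm_to_rem aJ')) JJ'// inE iJ orbT.
by rewrite inE => /orP[/eqP ia|//]; move: aJ; rewrite -ia iJ.
Qed.

(** Bounding the sum over every duplicate-free list expresses a total over a countable index without
    an enumeration. The cubes are then listed through [pickle_inv], and integers that encode no
    index are masked by the predicate. *)
Lemma cnull_countable (R : realType) (d : nat) (A : set 'rV[R]_d) :
  (forall e : R, 0 < e -> exists (I : countType) (c : I -> 'rV[R]_d) (s : I -> R),
    [/\ forall i, 0 <= s i,
        forall x, A x -> exists i, `|x - c i| <= s i &
        forall J : seq I, uniq J -> \sum_(i <- J) s i ^+ d <= e]) ->
  cnull A.
Proof.
move=> H e e0; have [I [c [s [s0 cov sm]]]] := H e e0.
exists (fun n => @pickle_inv I n), (fun n => odflt 0 (omap c (pickle_inv n))),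
  (fun n => odflt 0 (omap s (pickle_inv n))); split.
- by move=> n; case: pickle_inv.
- by move=> x /cov[i xi]; exists (pickle i); rewrite pickleK_inv.
- move=> N; rewrite -(big_mkord (fun n => @pickle_inv I n)
    (fun n => odflt 0 (omap s (pickle_inv n)) ^+ d)).
  have -> : \sum_(0 <= n < N | @pickle_inv I n)
       odflt 0 (omap s (pickle_inv n)) ^+ d =
     \sum_(i <- pmap (@pickle_inv I) (index_iota 0 N)) s i ^+ d.
    elim: (index_iota 0 N) => [|a l IH]; first by rewrite !big_nil.
    by rewrite big_cons/= IH; case: (pickle_inv a) => [i|]//=; rewrite big_cons.
  apply: sm; apply: (pmap_uniq (g := pickle)); last exact: iota_uniq.
  exact: pickle_invK.
Qed.

Lemma cnull_sub (R : realType) (d : nat) (A B : set 'rV[R]_d) :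
  A `<=` B -> cnull B -> cnull A.
Proof.
move=> AB nB e /nB[b [c [s [s0 cov sm]]]]; exists b, c, s; split => // x /AB.
exact: cov.
Qed.

Lemma cnull_set0 (R : realType) (d : nat) : cnull (set0 : set 'rV[R]_d).
Proof.
move=> e e0; exists pred0, (fun=> 0), (fun=> 0); split => // N.
by rewrite big_pred0_eq ltW.
Qed.

Lemma sum_halves_le (R : realType) (e : R) N :
  0 <= e -> \sum_(n < N) e / 2 ^+ n.+1 <= e.
Proof.
move=> e0; rewrite (_ : \sum_(n < N) _ = e - e / 2 ^+ N).
  by rewrite gerBl divr_ge0// exprn_ge0.
elim: N => [|N IH]; first by rewrite big_ord0 expr0 divr1 subrr.
by rewrite big_ord_recr/= IH exprS; field; rewrite expf_neq0.
Qed.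

Lemma cnull_bigcup_nat (R : realType) (d : nat) (A : nat -> set 'rV[R]_d) :
  (forall n, cnull (A n)) -> cnull (\bigcup_n A n).
Proof.
move=> nA; apply: cnull_countable => e e0.
have ek k : 0 < e / 2 ^+ k.+1 by rewrite divr_gt0// exprn_gt0.
have /choice[f fP] : forall k, exists t : (pred nat) * (nat -> 'rV[R]_d) * (nat -> R),
    [/\ forall n, 0 <= t.2 n,
        forall x, A k x -> exists2 n, t.1.1 n & `|x - t.1.2 n| <= t.2 n &
        forall N, \sum_(n < N | t.1.1 n) t.2 n ^+ d <= e / 2 ^+ k.+1].
  move=> k; have [b [c [s h]]] := nA k _ (ek k).
  by exists (b, c, s).
exists ({p : nat * nat | (f p.1).1.1 p.2} : countType).
exists (fun p => (f (val p).1).1.2 (val p).2).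
exists (fun p => (f (val p).1).2 (val p).2); split.
- by move=> [[k n] /= kn]; case: (fP k) => h _ _; exact: h.
- move=> x [k _ Akx]; have [_ h _] := fP k; have [n bn xn] := h _ Akx.
  by exists (exist _ (k, n) bn).
move=> J uJ.
pose F (p : nat * nat) : R := if (f p.1).1.1 p.2 then (f p.1).2 p.2 ^+ d else 0.
have F0 p : 0 <= F p.
  rewrite /F; case: ifP => // _; apply: exprn_ge0.
  by have [h _ _] := fP p.1; exact: h.
rewrite (_ : \sum_(i <- J) _ = \sum_(p <- map val J) F p); last first.
  rewrite big_map; apply: eq_bigr => -[p pb] _ /=.
  by rewrite /F pb.
(* Both coordinates of every pair in [J] are below [N], so the sum is at most that over an [N] by
   [N] square, taken row by row. *)
have [N NE] : exists N, N = (\max_(p <- map val J) (maxn p.1 p.2)).+1 by eexists.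
have JN : {subset map val J <= [seq (k, n) | k <- index_iota 0 N, n <- index_iota 0 N]}.
  move=> [k n] pJ; have := @leq_bigmax_seq _ _ xpredT (fun p : nat * nat => maxn p.1 p.2) _ pJ isT.
  rewrite geq_max => /andP[kN nN].
  by apply/allpairsP; exists (k, n); split; rewrite // mem_index_iota NE/= ltnS.
apply: le_trans (sumr_subseq_le _ JN F0) _; first by rewrite map_inj_uniq//; exact: val_inj.
rewrite big_allpairs_dep/= big_mkord.
apply: le_trans (sum_halves_le N (ltW e0)); apply: ler_sum => k _.
have [_ _ h] := fP k; apply: le_trans (h N).
by rewrite big_mkord /F/= -big_mkcond.
Qed.

Lemma cnull_bigcup (R : realType) (d : nat) (I : countType)
    (A : I -> set 'rV[R]_d) :
  (forall i, cnull (A i)) -> cnull [set x | exists i, A i x].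
Proof.
move=> nA; pose B n := if unpickle n is Some i then A i else set0.
apply: (@cnull_sub _ _ _ (\bigcup_n B n)).
  by move=> x [i Aix]; exists (pickle i) => //; rewrite /B pickleK.
apply: cnull_bigcup_nat => n; rewrite /B.
by case: unpickle => [i|]; [exact: nA|exact: cnull_set0].
Qed.

(** Each cube that meets the image of [A] is traded for one centred at a point of [A] whose image
    lies in it. Two images in a cube of radius [s] are within [2 s] of each other, so radius [2 C s]
    suffices and sizes grow by the factor [(2 C)^d]. *)
Lemma cnull_preimage (R : realType) (d : nat) (A B : set 'rV[R]_d)
    (phi : 'rV[R]_d -> 'rV[R]_d) (C : R) :
  cnull B -> (forall x, A x -> B (phi x)) ->
  (forall x y, A x -> A y -> `|x - y| <= C * `|phi x - phi y|) -> cnull A.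
Proof.
move=> nB AB phiC e e0.
wlog C0 : C phiC / 0 < C.
  move=> /(_ (Num.max C 1)); apply; last by rewrite lt_max ltr01 orbT.
  move=> x y Ax Ay; rewrite (le_trans (phiC _ _ Ax Ay))// ler_wpM2r//.
  by rewrite le_max lexx.
have e'0 : 0 < e / (2 * C) ^+ d by rewrite divr_gt0// exprn_gt0// mulr_gt0.
have [b [c [s [s0 cov sm]]]] := nB _ e'0.
have /choice[a aP] : forall n, exists a, forall x, A x ->
    `|phi x - c n| <= s n -> `|x - a| <= 2 * C * s n.
  move=> n; have [[a [Aa an]]|na] := pselect (exists a, A a /\ `|phi a - c n| <= s n).
    exists a => x Ax xn; rewrite (le_trans (phiC _ _ Ax Aa))//.
    rewrite (mulrC 2) -mulrA ler_pM2l// mulr2n mulrDl mul1r.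
    by rewrite (le_trans (ler_distD (c n) _ _))// lerD// distrC.
  by exists 0 => x Ax xn; exfalso; apply: na; exists x.
exists b, a, (fun n => 2 * C * s n); split.
- by move=> n; rewrite mulr_ge0// mulr_ge0// ltW.
- by move=> x Ax; have [n bn xn] := cov _ (AB _ Ax); exists n => //; exact: aP.
- move=> N; under eq_bigr do rewrite exprMn.
  rewrite -mulr_sumr mulrC -ler_pdivlMr ?exprn_gt0 ?mulr_gt0//.
Qed.

(** Inside the cube of radius [M], in ambient dimension [d + 1], a grid of mesh [1 / K] in the other
    coordinates has [(2 M K + 1)^d] points. Cubes of radius [1 / K] around them have total size at
    most [(3 M K)^d / K^(d+1) = (3 M)^d / K]. *)
Lemma cnull_hyperplane (R : realType) (d : nat) (i : 'I_d) :
  cnull [set x : 'rV[R]_d | x ord0 i = 0].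
Proof.
case: d i => [[]//|d] i.
pose A (N : nat) := [set x : 'rV[R]_d.+1 | x ord0 i = 0 /\ `|x| <= N.+1%:R].
apply: (@cnull_sub _ _ _ (\bigcup_N A N)).
  move=> x xi; have := archi_boundP (normr_ge0 x); set N := Num.bound _ => xN.
  exists N => //; split => //; apply: ltW; apply: lt_le_trans xN _.
  by rewrite ler_nat.
apply: cnull_bigcup_nat => N; apply: cnull_countable => e e0.
set M : R := N.+1%:R.
have M0 : 0 < M by rewrite /M ltr0n.
pose K := (Num.bound ((3 * M) ^+ d / e)).+1.
have K0 : (0 : R) < K%:R by rewrite ltr0n.
have Ke : (3 * M) ^+ d / K%:R <= e.
  rewrite ler_pdivrMr// [leRHS]mulrC -ler_pdivrMr//.
  have h : 0 <= (3 * M) ^+ d / e by rewrite divr_ge0 ?exprn_ge0 ?mulr_ge0// ltW.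
  apply: ltW; apply: lt_le_trans (archi_boundP h) _; by rewrite ler_nat /K.
pose L := (2 * N.+1 * K)%N.
exists {ffun 'I_d -> 'I_L.+1}.
exists (fun f : {ffun 'I_d -> 'I_L.+1} =>
    \row_j (if unlift i j is Some j' then (f j')%:R / K%:R - M else 0)).
exists (fun=> K%:R^-1); split.
- by move=> _; rewrite invr_ge0 ltW.
- move=> x [xi xM].
  have xb (j : 'I_d) : 0 <= (x ord0 (lift i j) + M) * K%:R <= L%:R.
    have := le_trans (mx_entry_norm x ord0 (lift i j)) xM.
    rewrite -/M ler_norml => /andP[h1 h2]; apply/andP; split.
      by rewrite mulr_ge0 ?(ltW K0)//; lra.
    by rewrite /L !natrM ler_pM2r// -/M; lra.
  have xt (j : 'I_d) : (Num.truncn ((x ord0 (lift i j) + M) * K%:R) < L.+1)%N.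
    have /andP[h1 h2] := xb j.
    rewrite ltnS -(ler_nat R) (le_trans _ h2)//.
    by have /andP[] := truncn_itv h1.
  exists [ffun j => Ordinal (xt j)].
  apply: mx_norm_le => [|a j]; first by rewrite invr_ge0 ltW.
  rewrite (ord1 a) !mxE; case: unliftP => [j' ->|->]; last first.
    by rewrite xi subrr normr0 invr_ge0 ltW.
  rewrite ffunE/=; have /andP[h1 _] := xb j'; have /andP[h2 h3] := truncn_itv h1.
  set t := Num.truncn _ in h2 h3 *.
  have -> : x ord0 (lift i j') - (t%:R / K%:R - M) =
    ((x ord0 (lift i j') + M) * K%:R - t%:R) / K%:R by field; rewrite gt_eqF.
  rewrite normrM normfV (gtr0_norm K0) -[leRHS]mul1r ler_pM2r ?invr_gt0//.
  by rewrite ger0_norm ?subr_ge0// lerBlDr nat1r ltW.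
- move=> J uJ; apply: le_trans (sumr_subseq_le uJ
    (J' := index_enum {ffun 'I_d -> 'I_L.+1}) _ _) _.
  + by move=> f _; rewrite mem_index_enum.
  + by move=> _; rewrite exprn_ge0// invr_ge0 ltW.
  rewrite sumr_const card_ffun !card_ord -[_ *+ _]mulr_natl.
  apply: le_trans Ke; rewrite exprVn exprS invfM mulrCA [leRHS]mulrC.
  rewrite ler_pM2l ?invr_gt0// natrX -ler_pdivlMr ?invr_gt0 ?exprn_gt0//.
  rewrite invrK -exprMn lerXn2r ?nnegrE// ?mulr_ge0 ?(ltW M0) ?(ltW K0)//.
  rewrite -natr1 /L !natrM -/M.
  have : 1 <= M * K%:R by rewrite /M -natrM ler1n.
  lra.
Qed.

(** Differences of points of [W] avoid a cone around [e], so the projection along [e] onto a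
    coordinate hyperplane is injective on [W], with an inverse of Lipschitz constant
    [1 + |e| / eta]. *)
Lemma cnull_cone (R : realType) (d : nat) (W : set 'rV[R]_d) (e : 'rV[R]_d)
    (eta : R) : e != 0 -> 0 < eta ->
  (forall x y (t : R), W x -> W y -> eta * `|t| <= `|x - y - t *: e|) -> cnull W.
Proof.
move=> e0 eta0 We.
have [i ei] : exists i, e ord0 i != 0.
  by move/rV0Pn: e0.
pose phi (x : 'rV[R]_d) : 'rV[R]_d := x - (x ord0 i / e ord0 i) *: e.
apply: (@cnull_preimage _ _ _ _ phi (1 + `|e| / eta) (cnull_hyperplane i)).
  by move=> x _ /=; rewrite /phi !mxE mulfVK// subrr.
move=> x y Wx Wy.
set t := (x ord0 i - y ord0 i) / e ord0 i.
have phiE : phi x - phi y = x - y - t *: e.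
  by apply/rowP => j; rewrite /phi /t !mxE; field.
have h := We x y t Wx Wy; rewrite -phiE in h.
have -> : x - y = (phi x - phi y) + t *: e by rewrite phiE subrK.
rewrite (le_trans (ler_normD _ _))// mulrDl mul1r lerD2l normrZ.
rewrite mulrC -mulrA ler_wpM2l// -ler_pdivrMl ?invr_gt0// invrK.
exact: h.
Qed.

Lemma cnull_lebesgue_null (R : realType) (d : nat) (A : set 'rV[R]_d) :
  cnull A -> lebesgue_null A.
Proof.
move=> nA; rewrite /lebesgue_null; apply/eqP; rewrite eq_le; apply/andP; split; last first.
  apply: le_ereal_inf_tmp => _ [P [a [b [ab _ ->]]]].
  apply: nneseries_ge0 => n _ _; rewrite lee_fin; apply: prodr_ge0 => i _.
  by rewrite subr_ge0.
apply/lee_addgt0Pr => e e0; rewrite add0e.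
(* A cube of radius [s n] is a box with sides [2 s n], hence the factor [2 ^+ d]. *)
have e'0 : 0 < e / 2 ^+ d by rewrite divr_gt0// exprn_gt0.
have [b [c [s [s0 cov sm]]]] := nA _ e'0.
apply: (@le_trans _ _ (\sum_(0 <= n <oo | b n)
   (\prod_(i < d) ((c n + const_mx (s n)) ord0 i - (c n - const_mx (s n)) ord0 i))%R%:E)%E).
  apply: ereal_inf_lbound.
  exists b, (fun n => c n - const_mx (s n)), (fun n => c n + const_mx (s n)).
  split => // [n i|x /cov[n bn xn]].
    by rewrite !mxE; have := s0 n; lra.
  exists n => // i; have := le_trans (mx_entry_norm _ _ _) xn.
  by move=> /(_ ord0 i); rewrite !mxE ler_norml; lra.
under eq_eseriesr => n _.
  under eq_bigr do rewrite !mxE opprB addrC addrA subrK -mulr2n -mulr_natl.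
  rewrite prodr_const card_ord exprMn; over.
apply: lime_le.
  apply: is_cvg_nneseries => n _ _.
  by rewrite lee_fin mulr_ge0// ?exprn_ge0.
apply: nearW => N; rewrite sumEFin lee_fin -mulr_sumr mulrC -ler_pdivlMr ?exprn_gt0//.
by rewrite big_mkord; exact: sm.
Qed.

(** * The proximal map of a weakly convex function *)

Lemma continuous_dotp_sqr (R : realType) (d : nat) (z : 'rV[R]_d) :
  continuous (fun y : 'rV[R]_d => dotp (y - z) (y - z) : R^o).
Proof.
pose N (y : 'rV[R]_d) : R := enorm (y - z).
have lip x y : N x - N y <= d.+1%:R * `|x - y|.
  rewrite lerBlDl /N (_ : x - z = (y - z) + (x - y)); last by rowring.
  rewrite (le_trans (enormD _ _))// lerD2l (le_trans (enorm_le_norm _))//.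
  by rewrite ler_wpM2r// ler_nat.
have cN : continuous (N : 'rV[R]_d -> R^o).
  move=> y A /nbhs_ballP[e e0 eA]; apply/nbhs_normE.
  exists (e / d.+1%:R) => [|x xe]; first exact: divr_gt0.
  rewrite ltr_pdivlMr// mulrC in xe.
  apply: eA; rewrite /ball/= ltr_norml; have := lip x y; have := lip y x.
  by rewrite (distrC y x); lra.
move=> y; rewrite (_ : (fun _ => _) = (fun t : R => t ^+ 2 : R^o) \o N).
  by apply: (@continuous_comp _ _ _ N); [exact: cN|exact: exprn_continuous].
by apply/funext => x; rewrite /= /N enorm_sqr.
Qed.

Section prox_map.
Context (R : realType) (d : nat) (r : 'rV[R]_d -> \bar R) (rho mu : R).
Hypothesis r_gtNy : forall x, r x <> -oo%E.
Hypothesis r_proper : exists x, r x <> +oo%E.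
Hypothesis r_closed : closed_fun r.
Hypothesis rho_gt0 : 0 < rho.
Hypothesis r_wconvex : rho_weakly_convex rho r.
Hypothesis mu_range : 0 < mu < rho^-1.
Hypothesis r_bounded : forall x0 : 'rV[R]_d, exists B : R,
  forall y, `|y - x0| <= 1 -> (B%:E <= r y)%E.

Let kappa : R := (2 * mu)^-1.

Lemma mu_gt0 : 0 < mu. Proof. by case/andP: mu_range. Qed.

Lemma murho_lt1 : mu * rho < 1.
Proof. by case/andP: mu_range => _; rewrite -ltr_pdivlMr// mul1r. Qed.

Lemma kappa_rho : rho / 2 < kappa.
Proof.
rewrite /kappa invfM mulrC ltr_pM2l ?invr_gt0// -[rho]invrK ltf_pV2 ?posrE ?invr_gt0 ?mu_gt0//.
by case/andP: mu_range.
Qed.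

Lemma r_fin x : r x <> +oo%E -> exists c : R, r x = c%:E.
Proof. by have := @r_gtNy x; case: (r x) => [c _ _|//|//]; exists c. Qed.

Lemma wconvex_fin x y (a b t : R) : r x = a%:E -> r y = b%:E -> 0 <= t <= 1 ->
  exists2 c : R, r (t *: x + (1 - t) *: y) = c%:E &
    c <= t * a + (1 - t) * b + rho / 2 * (t * (1 - t)) * dotp (x - y) (x - y).
Proof.
move=> xa yb t01; have := r_wconvex x y t01; rewrite xa yb.
have := @r_gtNy (t *: x + (1 - t) *: y).
case: (r _) => [c _|_|//]; last first.
  by rewrite -!EFinD addye.
rewrite -!EFinD lee_fin !enorm_sqr => h; exists c => //.
move: h; rewrite !dotpE_simp (dotpC y x); lra.
Qed.

(** Weak convexity on the segment from [x0] to a far point [y] carries the lower bound [B] from the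
    unit ball around [x0] to [y]: with [s = |y - x0|], [r y] is at least
    [- s (|B| + |c0|) - rho / 2 s^2]. The proximal term [kappa |y - z|^2] wins because
    [kappa > rho / 2]. *)
Lemma coercive_bound (x0 z : 'rV[R]_d) (c0 v0 : R) : r x0 = c0%:E ->
  exists A : R, forall y t, (r y <= t%:E)%E ->
    t + kappa * dotp (y - z) (y - z) <= v0 -> `|y - x0| <= A /\ `|t| <= A.
Proof.
move=> x0c; have [B rB] := r_bounded x0.
have kr := kappa_rho.
pose D := enorm (z - x0); pose s0 := kappa - rho / 2.
have s00 : 0 < s0 by rewrite /s0 subr_gt0.
(* [Q] gathers the coefficients linear in [s], with [|v0|] added, against the curvature margin [s0];
   beyond [S = 1 + Q / s0] the quadratic part exceeds them and the objective passes [v0]. *)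
pose Q := `|B| + `|c0| + 2 * kappa * D + `|v0|.
have k0 : 0 <= kappa by have m0 := ltW mu_gt0; rewrite /kappa; nonneg.
have D0 : 0 <= D by exact: enorm_ge0.
have Q0 : 0 <= Q by rewrite /Q; nonneg.
pose S := 1 + Q / s0.
have QS : 0 <= Q / s0 by rewrite divr_ge0// ltW.
have S1 : 1 <= S by rewrite /S lerDl.
pose A := S + `|v0| + Q * S + rho / 2 * S ^+ 2.
have hr : 0 <= rho / 2 by rewrite divr_ge0// ltW.
have A1 : S <= A.
  have : 0 <= Q * S by nonneg.
  have : 0 <= rho / 2 * S ^+ 2 by nonneg.
  by have := normr_ge0 v0; rewrite /A; lra.
exists A => y t yt tv.
have [c yc ct] : exists2 c : R, r y = c%:E & c <= t.
  have := @r_gtNy y; case: (r y) yt => [c|//|//] ct _; exists c => //.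
set s := enorm (y - x0).
have s_ge0 : 0 <= s by exact: enorm_ge0.
have dge0 := dotp_ge0 (y - z).
have tv0 : t <= v0 by have := mulr_ge0 k0 dge0; lra.
suff [sS cl] : s <= S /\ - (`|v0| + Q * S + rho / 2 * S ^+ 2) <= c.
  split; first by rewrite (le_trans (norm_le_enorm _))// (le_trans sS).
  have := ler_norm v0; rewrite ler_norml /A.
  have : 0 <= Q * S by nonneg.
  have : 0 <= rho / 2 * S ^+ 2 by nonneg.
  lra.
have [s1|s1] := leP s 1.
  split; first exact: le_trans s1 S1.
  have := rB y (le_trans (norm_le_enorm _) s1); rewrite yc lee_fin => Bc.
  have : Q * 1 <= Q * S by rewrite ler_wpM2l.
  have : 0 <= rho / 2 * S ^+ 2 by nonneg.
  have : - `|B| <= B by rewrite lerNl ler_normr lexx orbT.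
  have : 0 <= kappa * D by nonneg.
  have := normr_ge0 c0; have := normr_ge0 v0; rewrite /Q; lra.
have sp : 0 < s by exact: lt_trans s1.
have t01 : 0 <= s^-1 <= 1 by rewrite invr_ge0 s_ge0 invf_le1// ltW.
have [c' pc cc'] := wconvex_fin yc x0c t01.
have : `|s^-1 *: y + (1 - s^-1) *: x0 - x0| <= 1.
  rewrite (_ : _ - x0 = s^-1 *: (y - x0)); last by rowring.
  rewrite normrZ ger0_norm ?invr_ge0// ler_pdivrMl// mulr1; exact: norm_le_enorm.
move=> /rB; rewrite pc lee_fin => Bc.
have low : - s * (`|B| + `|c0|) - rho / 2 * s ^+ 2 <= c.
  have h1 : s * B <= c + (s - 1) * c0 + rho / 2 * (s - 1) * s.
    rewrite -(ler_pM2l (_ : 0 < s^-1)) ?invr_gt0// mulKf ?gt_eqF//.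
    apply: le_trans Bc _; apply: le_trans cc' _; rewrite -enorm_sqr -/s.
    by rewrite le_eqVlt; apply/orP; left; apply/eqP; field; rewrite gt_eqF.
  have h2 : - `|B| <= B by rewrite lerNl ler_normr lexx orbT.
  have h3 : c0 <= `|c0| by exact: ler_norm.
  have h4 : s * - `|B| <= s * B by rewrite ler_wpM2l.
  have h5 : (s - 1) * c0 <= s * `|c0|.
    apply: (@le_trans _ _ ((s - 1) * `|c0|)).
      by rewrite ler_wpM2l// subr_ge0 ltW.
    by rewrite ler_wpM2r// gerBl.
  have h6 : 0 <= rho / 2 * s by nonneg.
  lra.
have zD : s ^+ 2 - 2 * D * s <= dotp (y - z) (y - z).
  have -> : y - z = (y - x0) - (z - x0) by rowring.
  rewrite /s /D; move: (y - x0) (z - x0) => u w.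
  have := cauchy_schwarz u w; have := dotp_ge0 w.
  by rewrite enorm_sqr !(dotpBl, dotpBr) (dotpC w u); lra.
have sS : s <= S.
  rewrite leNgt; apply/negP => Ss.
  have h1 : Q < s0 * s.
    rewrite mulrC -ltr_pdivrMr//; apply: le_lt_trans Ss; rewrite /S; lra.
  have h2 : Q * s < s0 * s * s by rewrite ltr_pM2r.
  have h3 : kappa * (s ^+ 2 - 2 * D * s) <= kappa * dotp (y - z) (y - z) by rewrite ler_wpM2l.
  have h4 : `|v0| * 1 <= `|v0| * s by rewrite ler_wpM2l// ltW.
  have := ler_norm v0; move: h2; rewrite /Q /s0; lra.
split => //.
have h1 : s ^+ 2 <= S ^+ 2 by rewrite lerXn2r ?nnegrE// (le_trans s_ge0).
have h2 : rho / 2 * s ^+ 2 <= rho / 2 * S ^+ 2 by rewrite ler_wpM2l.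
have h3 : s * (`|B| + `|c0|) <= S * Q.
  rewrite ler_pM//.
  by rewrite /Q -addrA lerDl; nonneg.
have := normr_ge0 v0; lra.
Qed.

(** The minimization runs over the epigraph: there the objective [t + kappa |y - z|^2] is continuous
    and the domain is closed by hypothesis, so the extreme value theorem on a compact sublevel set
    applies without semicontinuity arguments. *)
Lemma proxset_nonempty z : proxset mu r z !=set0.
Proof.
have [x0 /r_fin[c0 x0c]] := r_proper.
pose v (p : 'rV[R]_d * R) : R := p.2 + kappa * dotp (p.1 - z) (p.1 - z).
pose v0 := v (x0, c0).
have cv : continuous (v : 'rV[R]_d * R -> R^o).
  move=> p; apply: cvgD; first exact: cvg_snd.
  apply: cvgM; first exact: cvg_cst.
  apply: (@continuous_comp _ _ _ (fst : 'rV[R]_d * R -> 'rV[R]_d)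
    (fun y : 'rV[R]_d => dotp (y - z) (y - z) : R^o)); first exact: cvg_fst.
  exact: continuous_dotp_sqr.
pose K := [set p : 'rV[R]_d * R | (r p.1 <= p.2%:E)%E] `&` v @^-1` [set s | s <= v0].
have K0 : K !=set0 by exists (x0, c0); split => //=; rewrite x0c.
have clK : closed K.
  apply: closedI; first exact: r_closed.
  by apply: closed_comp; [move=> p _; exact: cv|exact: closed_le].
have [A AP] := coercive_bound z v0 x0c.
have cK : compact K.
  pose K1 := [set y : 'rV[R]_d | `|y| <= `|x0| + A] `*` `[- A, A]%classic.
  have cK1 : compact K1.
    apply: compact_setX; last exact: segment_compact.
    apply: bounded_closed_compact; last exact: norm_closed_le.
    exists (`|x0| + A); split; first exact: num_real.
    by move=> M AM y /le_trans; apply; exact: ltW.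
  apply: (subclosed_compact clK cK1) => -[y t] [/= yt vt].
  have [h1 h2] := AP _ _ yt vt; split => /=.
    by rewrite -[y](subrKC x0) (le_trans (ler_normD _ _))// lerD2l.
  by rewrite in_itv/= -ler_norml.
have [[y t]] := compact_EVT_min K0 cK (continuous_subspaceT cv).
rewrite inE => -[/= yt vt] ymin; exists y => x.
have [->|/r_fin[c xc]] := pselect (r x = +oo%E); first by rewrite addye// leey.
rewrite xc !enorm_sqr -/kappa.
apply: (@le_trans _ _ (v (y, t))%:E).
  by rewrite /v/= EFinD leeD2r.
rewrite -EFinD lee_fin -[leRHS]/(v (x, c)).
have [xv|xv] := leP (v (x, c)) v0; last exact: le_trans vt (ltW xv).
by apply: ymin; rewrite inE; split => //=; rewrite xc.
Qed.

Lemma proxP z : proxset mu r z (prox mu r z).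
Proof. by have [y yP] := proxset_nonempty z; exact: (getI yP). Qed.

Lemma prox_fin z : exists c : R, r (prox mu r z) = c%:E.
Proof.
apply: r_fin => E; have [x0 /r_fin[c0 x0c]] := r_proper.
by have := proxP z x0; rewrite E x0c addye// -EFinD leye_eq.
Qed.

(** The prox objective is strongly convex with margin [s0 = kappa - rho / 2], so it grows by at
    least [s0 |x - y|^2] away from its minimizer [y]; expanding the squares gives the stated
    inequality. The growth comes from comparing [y] with points of the segment towards [x]. *)
Lemma prox_subgradient z x (c a : R) : r (prox mu r z) = c%:E -> r x = a%:E ->
  c + mu^-1 * dotp (z - prox mu r z) (x - prox mu r z) -
    rho / 2 * dotp (x - prox mu r z) (x - prox mu r z) <= a.
Proof.
set y := prox mu r z => yc xa.
set N := dotp (x - y) (x - y).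
have N0 : 0 <= N by exact: dotp_ge0.
pose s0 := kappa - rho / 2.
have s00 : 0 < s0 by rewrite subr_gt0; exact: kappa_rho.
suff main : s0 * N <= (a + kappa * dotp (x - z) (x - z)) - (c + kappa * dotp (y - z) (y - z)).
  have kE : mu^-1 = 2 * kappa.
    by rewrite /kappa; field; rewrite gt_eqF// mu_gt0.
  move: main; rewrite kE /s0 /N.
  have -> : x - z = (x - y) + (y - z) by rowring.
  have -> : z - y = - (y - z) by rowring.
  move: (x - y) (y - z) => u w.
  rewrite dotpNl !(dotpDl, dotpDr) (dotpC w u); lra.
apply/ler_addgt0Pr => e e0.
(* Divided by [t], the comparison leaves the second-order remainder [t * (s0 * N)]; this choice
   brings it below [e]. *)
pose t := Num.min 2^-1 (e / (1 + s0 * N)).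
have h0 : 0 < 1 + s0 * N by rewrite ltr_pwDl// mulr_ge0// ltW.
have t0 : 0 < t by rewrite lt_min invr_gt0 ltr0n divr_gt0.
have t1 : t <= 2^-1 by rewrite ge_min lexx.
have te : t * (s0 * N) <= e.
  rewrite mulrC; apply: small_mul => //; first by rewrite mulr_ge0// ltW.
  by rewrite ge_min lexx orbT.
have t01 : 0 <= t <= 1 by rewrite ltW//=; lra.
have [c' pc cc'] := wconvex_fin xa yc t01.
have := proxP z (t *: x + (1 - t) *: y); rewrite -/y pc yc !enorm_sqr -!EFinD lee_fin -/kappa.
have -> : dotp (t *: x + (1 - t) *: y - z) (t *: x + (1 - t) *: y - z) =
   t * dotp (x - z) (x - z) + (1 - t) * dotp (y - z) (y - z) - t * (1 - t) * N.
  have -> : t *: x + (1 - t) *: y - z = t *: (x - z) + (1 - t) *: (y - z) by rowring.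
  rewrite /N (_ : x - y = (x - z) - (y - z)); last by rowring.
  by rewrite !dotpE_simp (dotpC y x) (dotpC z x) (dotpC z y); ring.
set X := dotp (x - z) _; set Y := dotp (y - z) _; rewrite -/N in cc' => h.
have h' : 0 <= t * (a + kappa * X - (c + kappa * Y) - s0 * N + t * (s0 * N)).
  move: h cc'; rewrite /s0; lra.
by move: h'; rewrite pmulr_rge0//; lra.
Qed.

Lemma prox_monotone z1 z2 :
  (1 - mu * rho) * dotp (prox mu r z1 - prox mu r z2) (prox mu r z1 - prox mu r z2)
    <= dotp (z1 - z2) (prox mu r z1 - prox mu r z2).
Proof.
have [c1 y1c] := prox_fin z1; have [c2 y2c] := prox_fin z2.
have := prox_subgradient y1c y2c; have := prox_subgradient y2c y1c.
move: (prox mu r z1) (prox mu r z2) => y1 y2.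
have -> : y2 - y1 = - (y1 - y2) by rowring.
have -> : z1 - z2 = (z1 - y1) - (z2 - y2) + (y1 - y2) by rowring.
move: (y1 - y2) (z1 - y1) (z2 - y2) => w u1 u2.
rewrite !(dotpNr, dotpNl) opprK dotpDl dotpBl.
set N := dotp w w; set P1 := dotp u1 _; set P2 := dotp u2 _.
move=> h1 h2; have h : mu^-1 * (P2 - P1) <= rho * N by lra.
have : P2 - P1 <= mu * (rho * N) by rewrite -ler_pdivrMl ?mu_gt0.
lra.
Qed.

Lemma prox_lipschitz z1 z2 :
  (1 - mu * rho) * enorm (prox mu r z1 - prox mu r z2) <= enorm (z1 - z2).
Proof.
have := prox_monotone z1 z2; set dy := _ - prox mu r z2; set dz := z1 - z2.
have [/enorm0_eq0-> _|dy0] := leP (enorm dy) 0.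
  by rewrite /enorm dotp0l sqrtr0 mulr0 sqrtr_ge0.
move=> /le_trans/(_ (cauchy_schwarz _ _)).
by rewrite -enorm_sqr expr2 mulrA ler_pM2r.
Qed.

(** With [s = mu rho], [prox_monotone] gives [|dz - dy|^2 <= |dz|^2 + (2 s - 1) |dy|^2]. For
    [s <= 1/2] the last term is nonpositive and the factor is 1; otherwise [|dy| <= |dz| / (1 - s)]
    yields [(s / (1 - s))^2]. This is the origin of the maximum in the condition on [alpha]. *)
Lemma sub_prox_lipschitz z1 z2 :
  enorm ((z1 - prox mu r z1) - (z2 - prox mu r z2)) <=
    Num.max 1 (mu * rho / (1 - mu * rho)) * enorm (z1 - z2).
Proof.
have -> : (z1 - prox mu r z1) - (z2 - prox mu r z2) =
  (z1 - z2) - (prox mu r z1 - prox mu r z2).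
  by move: (prox _ _ _) (prox _ _ _) => p q; rowring.
have := prox_monotone z1 z2; have := prox_lipschitz z1 z2.
set dy := _ - prox mu r z2; set dz := z1 - z2.
set s := mu * rho; have s1 : s < 1 by exact: murho_lt1.
have s0 : 0 < s by rewrite mulr_gt0// mu_gt0.
clearbody dy dz => lip mono; set M := Num.max _ _.
have M1 : 1 <= M by rewrite le_max lexx.
have MM : s / (1 - s) <= M by rewrite le_max lexx orbT.
apply: enorm_le_of_sqr; first by rewrite mulr_ge0 ?enorm_ge0// (le_trans ler01).
rewrite dotpBl !dotpBr (dotpC dy dz) exprMn enorm_sqr.
have dz0 := dotp_ge0 dz; have dy0 := dotp_ge0 dy.
have [s2|s2] := leP s 2^-1.
  have : 1 * dotp dz dz <= M ^+ 2 * dotp dz dz.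
    by rewrite ler_wpM2r// -(expr1n _ 2) lerXn2r ?nnegrE// (le_trans ler01).
  have : 2^-1 * dotp dy dy <= (1 - s) * dotp dy dy by rewrite ler_wpM2r//; lra.
  lra.
have sp : 0 < 1 - s by lra.
have lip2 : (1 - s) ^+ 2 * dotp dy dy <= dotp dz dz.
  rewrite -!enorm_sqr -exprMn lerXn2r ?nnegrE ?enorm_ge0// mulr_ge0 ?enorm_ge0// ltW//.
apply: (@le_trans _ _ ((s / (1 - s)) ^+ 2 * dotp dz dz)); last first.
  rewrite ler_wpM2r// lerXn2r ?nnegrE// ?divr_ge0// ?(ltW s0) ?(ltW sp)//.
  exact: le_trans ler01 M1.
have -> : (s / (1 - s)) ^+ 2 * dotp dz dz =
  dotp dz dz + (2 * s - 1) * ((1 - s) ^- 2 * dotp dz dz) by field; rewrite gt_eqF.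
have : dotp dy dy <= (1 - s) ^- 2 * dotp dz dz by rewrite ler_pdivlMl ?exprn_gt0.
move=> /(ler_wpM2l (_ : 0 <= 2 * s - 1)) h; have {}h := h ltac:(lra).
lra.
Qed.

End prox_map.

(** * Two-point differential calculus *)

Lemma derive_dotp_grad (R : realType) (d : nat) (phi : 'rV[R]_d -> R)
    (x v : 'rV[R]_d) : differentiable (phi : 'rV[R]_d -> R^o) x ->
  'D_v (phi : 'rV[R]_d -> R^o) x = dotp v (grad phi x).
Proof.
move=> dx; rewrite deriveE// {1}[v]row_sum_delta linear_sum/=.
by apply: eq_bigr => i _; rewrite linearZ/= /grad mxE deriveE.
Qed.

Lemma is_derive_line (R : realType) (d : nat) (phi : 'rV[R]_d -> R)
    (x v : 'rV[R]_d) (t : R) :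
  differentiable (phi : 'rV[R]_d -> R^o) (x + t *: v) ->
  is_derive t (1 : R) (fun s : R => phi (x + s *: v) : R^o)
    (dotp v (grad phi (x + t *: v))).
Proof.
move=> dx; have E : (fun h : R => h^-1 *:
    (((fun s : R => phi (x + s *: v) : R^o) \o shift t) (h *: (1 : R)) - phi (x + t *: v))) =
  (fun h => h^-1 *: (((phi : 'rV[R]_d -> R^o) \o shift (x + t *: v)) (h *: v) - phi (x + t *: v))).
  apply/funext => h /=; congr (_ *: (phi _ - _)).
  by rewrite [h%:A]mulr1 scalerDl addrA addrAC addrC addrA.
apply: DeriveDef; first by rewrite /derivable E; exact: diff_derivable.
by rewrite /derive E; exact: derive_dotp_grad.
Qed.

Lemma MVT01 (R : realType) (f df : R -> R) :
  (forall t, is_derive t (1 : R) (f : R -> R^o) (df t)) ->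
  exists2 t, 0 <= t <= 1 & f 1 - f 0 = df t.
Proof.
move=> fdf; have [|t] := @MVT_segment R f df 0 1 ler01 (fun t _ => fdf t).
  have : {in `[(0 : R), 1]%R, forall x, derivable (f : R -> R^o) x 1}.
    by move=> x _; case: (fdf x).
  exact: derivable_within_continuous.
by rewrite in_itv/= => t01 ->; exists t => //; rewrite subr0 mulr1.
Qed.

Lemma mean_value (R : realType) (d : nat) (phi : 'rV[R]_d -> R)
    (x v : 'rV[R]_d) :
  (forall y, differentiable (phi : 'rV[R]_d -> R^o) y) ->
  exists2 t : R, 0 <= t <= 1 &
    phi (x + v) - phi x = dotp v (grad phi (x + t *: v)).
Proof.
move=> dphi; have [t t01] := MVT01 (fun t => is_derive_line (dphi (x + t *: v))).
by rewrite scale1r scale0r addr0; exists t.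
Qed.

Lemma grad_norm_near (R : realType) (d : nat) (phi : 'rV[R]_d -> R)
    (x0 : 'rV[R]_d) (e : R) : Cp 1 (phi : 'rV[R]_d -> R^o) -> 0 < e ->
  exists2 del : R, 0 < del &
    forall x, `|x - x0| < del -> `|grad phi x - grad phi x0| <= e.
Proof.
move=> [_ cphi] e0; suff /nbhs_normE[del del0 h] :
    \forall x \near x0, `|grad phi x - grad phi x0| <= e by exists del.
have hi (i : 'I_d) : \forall x \near x0,
    `|'D_(delta_mx ord0 i) (phi : 'rV[R]_d -> R^o) x0 -
      'D_(delta_mx ord0 i) (phi : 'rV[R]_d -> R^o) x| <= e.
  by have /cvgrPdist_le/(_ e e0) := cphi (delta_mx ord0 i) x0.
have := filter_forall (nbhs_filter x0) hi.
apply: filterS => x h; apply: mx_norm_le => [|a i]; first exact: ltW.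
by rewrite !mxE distrC.
Qed.

(** Both points move while [x0] stays fixed: this is the quantification of strict differentiability,
    which plain differentiability at [x0] does not give and which differences of two orbits
    require. *)
Definition near2 (R : realType) (d : nat) (x0 : 'rV[R]_d)
    (P : 'rV[R]_d -> 'rV[R]_d -> Prop) : Prop :=
  exists2 del : R, 0 < del &
    forall x y, `|x - x0| < del -> `|y - x0| < del -> P x y.

Lemma near2_forall (R : realType) (d m : nat) (x0 : 'rV[R]_d)
    (P : 'I_m -> 'rV[R]_d -> 'rV[R]_d -> Prop) :
  (forall j, near2 x0 (P j)) -> near2 x0 (fun x y => forall j, P j x y).
Proof.
move=> h; have /choice[dj djP] : forall j, exists del : R, 0 < del /\
    forall x y, `|x - x0| < del -> `|y - x0| < del -> P j x y.
  by move=> j; have [del] := h j; exists del.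
exists (\big[Num.min/1]_j dj j); first by apply: lt_bigmin => // j _; have [] := djP j.
move=> x y xd yd j; have [_] := djP j; apply.
  by rewrite (lt_le_trans xd)// bigmin_le_cond.
by rewrite (lt_le_trans yd)// bigmin_le_cond.
Qed.

Lemma norm_segment_lt (R : realType) (d : nat) (x0 x y : 'rV[R]_d) (t del : R) :
  0 <= t <= 1 -> `|x - x0| < del -> `|y - x0| < del ->
  `|y + t *: (x - y) - x0| < del.
Proof.
move=> /andP[t0 t1] xd yd.
have -> : y + t *: (x - y) - x0 = t *: (x - x0) + (1 - t) *: (y - x0).
  by apply/rowP => j; rewrite !mxE; ring.
apply: le_lt_trans (ler_normD _ _) _; rewrite !normrZ (ger0_norm t0).
rewrite (@ger0_norm _ (1 - t)) ?subr_ge0//.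
have [->|t0'] := eqVneq t 0; first by rewrite mul0r subr0 mul1r add0r.
have tp : 0 < t by rewrite lt_neqAle eq_sym t0'.
have : t * `|x - x0| < t * del by rewrite ltr_pM2l.
have : (1 - t) * `|y - x0| <= (1 - t) * del by rewrite ler_wpM2l ?subr_ge0// ltW.
lra.
Qed.

Lemma strict_diff (R : realType) (d : nat) (phi : 'rV[R]_d -> R)
    (x0 : 'rV[R]_d) (e : R) : Cp 1 (phi : 'rV[R]_d -> R^o) -> 0 < e ->
  near2 x0 (fun x y =>
    `|phi x - phi y - dotp (x - y) (grad phi x0)| <= e * `|x - y|).
Proof.
(* [dotp_norm] costs a factor [d] in the sup norm; [d.+1] keeps the quotient meaningful for
   [d = 0]. *)
move=> cphi e0; have e'0 : 0 < e / d.+1%:R by rewrite divr_gt0.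
have [del del0 h] := grad_norm_near x0 cphi e'0; exists del => // x y xd yd.
have [t t01] := mean_value y (x - y) cphi.1; rewrite subrKC => ->.
rewrite -dotpBr (le_trans (dotp_norm _ _))// -mulrA mulrCA mulrC ler_wpM2r//.
apply: (@le_trans _ _ (d%:R * (e / d.+1%:R))).
  by rewrite ler_wpM2l// h// norm_segment_lt.
rewrite mulrCA -[leRHS]mulr1 ler_wpM2l ?ltW// ltr_pdivrMr// mul1r.
by rewrite ltr_nat.
Qed.

Definition strict_hessian (R : realType) (d : nat) (phi : 'rV[R]_d -> R)
    (x0 : 'rV[R]_d) (H : 'M[R]_d) : Prop :=
  forall e : R, 0 < e -> near2 x0 (fun x y =>
    `|grad phi x - grad phi y - (x - y) *m H| <= e * `|x - y|).

(* Both orders of differentiation are read off the second difference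
   phi(x0+su+sv) - phi(x0+su) - phi(x0+sv) + phi(x0). *)
Lemma strict_hessian_sym (R : realType) (d : nat) (phi : 'rV[R]_d -> R)
    (x0 : 'rV[R]_d) (H : 'M[R]_d) :
  (forall y, differentiable (phi : 'rV[R]_d -> R^o) y) ->
  strict_hessian phi x0 H -> H^T = H.
Proof.
move=> dphi sH.
pose D (s : R) (u v : 'rV[R]_d) : R := phi (x0 + s *: u + s *: v) - phi (x0 + s *: u) -
  phi (x0 + s *: v) + phi x0.
have DC s u v : D s u v = D s v u by rewrite /D (addrAC x0); ring.
have key u v : exists2 C : R, 0 <= C & forall e, 0 < e -> exists2 s0 : R, 0 < s0 &
    forall s, 0 < s < s0 -> `|D s u v - s ^+ 2 * dotp (v *m H) u| <= e * C * s ^+ 2.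
  exists (d%:R * `|u| * `|v|) => [|e e0]; first by rewrite !mulr_ge0.
  have [del del0 h] := sH e e0; set K := 1 + `|u| + `|v|.
  have K0 : 0 < K by rewrite /K ltr_wpDr// ltr_wpDr.
  exists (del / K) => [|s /andP[s0 sdel]]; first by rewrite divr_gt0.
  have sK : s * K < del by rewrite -ltr_pdivlMr.
  have su (t : R) : 0 <= t <= 1 -> `|x0 + s *: v + t *: (s *: u) - x0| < del /\
      `|x0 + t *: (s *: u) - x0| < del.
    move=> /andP[t0 t1]; rewrite addrAC ![x0 + _]addrC !addrK.
    have h1 : `|t *: (s *: u)| <= s * `|u|.
      by rewrite !normrZ (ger0_norm t0) (gtr0_norm s0) ler_piMl// mulr_ge0// ltW.
    have h2 : `|s *: v| = s * `|v| by rewrite normrZ (gtr0_norm s0).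
    move: sK; rewrite /K !mulrDr mulr1 => sK.
    have := normr_ge0 v; have := ler_normD (s *: v) (t *: (s *: u)).
    have : 0 <= s * `|v| by rewrite mulr_ge0// ltW.
    by split; lra.
  have dl (t : R) : is_derive t (1 : R)
      ((fun t => phi (x0 + s *: v + t *: (s *: u)) : R^o) -
       (fun t => phi (x0 + t *: (s *: u)) : R^o))
      (dotp (s *: u) (grad phi (x0 + s *: v + t *: (s *: u))) -
       dotp (s *: u) (grad phi (x0 + t *: (s *: u)))).
    by apply: is_deriveB; exact: is_derive_line.
  (* The mean value theorem acts in the direction [u]; whatever the intermediate [t], the two points
     where the gradients are compared differ by exactly [s *: v]. *)
  have [t t01] := MVT01 dl.
  rewrite !fctE/= !scale1r !scale0r !addr0 => hD.
  have -> : D s u v = phi (x0 + s *: v + s *: u) - phi (x0 + s *: u) -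
      (phi (x0 + s *: v) - phi x0) by rewrite /D (addrAC x0); ring.
  rewrite hD -dotpBr dotpZl.
  have [h1 h2] := su t t01; have := h _ _ h1 h2.
  have -> : x0 + s *: v + t *: (s *: u) - (x0 + t *: (s *: u)) = s *: v.
    by rewrite opprD addrACA subrr addr0 addrC addKr.
  rewrite -scalemxAl normrZ (gtr0_norm s0) => hh.
  rewrite expr2 -mulrA -mulrBr normrM (gtr0_norm s0) -dotpZl (dotpC u) -dotpBl.
  rewrite [leRHS](_ : _ = s * (d%:R * (e * (s * `|v|)) * `|u|)); last by ring.
  rewrite ler_pM2l// (le_trans (dotp_norm _ _))// ler_wpM2r// ler_wpM2l//.
suff sym u v : dotp (v *m H) u = dotp (u *m H) v.
  apply/matrixP => i j; rewrite mxE.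
  have := sym (delta_mx 0 i) (delta_mx 0 j); rewrite -!rowE.
  have dd (w : 'rV[R]_d) k : dotp w (delta_mx 0 k) = w ord0 k.
    by rewrite dotpE trmx_delta -colE mxE.
  by rewrite !dd !mxE.
apply/eqP; rewrite -subr_eq0 -normr_le0.
have [C1 C10 k1] := key u v; have [C2 C20 k2] := key v u.
apply/ler_addgt0Pr => e e0; rewrite add0r.
have e'0 : 0 < e / (1 + C1 + C2) by rewrite divr_gt0// ltr_wpDr// ltr_wpDr.
have [s1 s10 h1] := k1 _ e'0; have [s2 s20 h2] := k2 _ e'0.
pose s := Num.min s1 s2 / 2.
have m0 : 0 < Num.min s1 s2 by rewrite lt_min s10.
have s0 : 0 < s by rewrite /s divr_gt0.
have sm : s < Num.min s1 s2 by rewrite /s ltr_pdivrMr// ltr_pMr// ltr1n.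
have /andP[ss1 ss2] : (s < s1) && (s < s2) by rewrite -lt_min.
have {}h1 := h1 s; have {}h2 := h2 s.
rewrite s0 ss1 in h1; rewrite s0 ss2 in h2.
have {}h1 := h1 isT; have {}h2 := h2 isT; rewrite DC in h1.
rewrite -(ler_pM2l (exprn_gt0 2 s0)) -{1}(ger0_norm (ltW (exprn_gt0 2 s0))) -normrM.
have -> : s ^+ 2 * (dotp (v *m H) u - dotp (u *m H) v) =
  (D s v u - s ^+ 2 * dotp (u *m H) v) - (D s v u - s ^+ 2 * dotp (v *m H) u) by ring.
apply: le_trans (ler_normB _ _) _; apply: le_trans (lerD h2 h1) _.
rewrite -mulrDl -mulrDr mulrC ler_pM2l ?exprn_gt0//.
rewrite mulrAC ler_pdivrMr ?ltr_wpDr ?ltr_wpDr// ler_pM2l//; lra.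
Qed.

Lemma C2_strict_hessian (R : realType) (d : nat) (phi : 'rV[R]_d -> R)
    (x0 : 'rV[R]_d) : Cp 2 (phi : 'rV[R]_d -> R^o) ->
  exists2 H : 'M[R]_d, strict_hessian phi x0 H & H^T = H.
Proof.
move=> cphi.
pose psi (j : 'I_d) (x : 'rV[R]_d) : R := 'D_(delta_mx ord0 j) (phi : 'rV[R]_d -> R^o) x.
pose H := \matrix_(i, j) grad (psi j) x0 ord0 i.
have sH : strict_hessian phi x0 H.
  move=> e e0.
  have [del del0 h] := near2_forall (fun j =>
    strict_diff x0 (cphi.2 (delta_mx ord0 j)) e0).
  exists del => // x y xd yd.
  apply: mx_norm_le => [|a j]; first by rewrite mulr_ge0// ltW.
  rewrite (ord1 a); have := h x y xd yd j; rewrite !mxE.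
  suff -> : \sum_j0 (x - y) ord0 j0 * H j0 j = dotp (x - y) (grad (psi j) x0) by [].
  by apply: eq_bigr => k _; rewrite !mxE.
exists H => //; apply: strict_hessian_sym sH; exact: cphi.1.
Qed.

(** A single use of the mean value theorem, on [phi (x0 + t h)] minus its expected quadratic
    polynomial in [t]: the derivative is [h] paired with the error of the strict Hessian for the
    pair [x0 + t h], [x0]. *)
Lemma taylor2 (R : realType) (d : nat) (phi : 'rV[R]_d -> R)
    (x0 : 'rV[R]_d) (H : 'M[R]_d) (e : R) :
  (forall y, differentiable (phi : 'rV[R]_d -> R^o) y) ->
  strict_hessian phi x0 H -> 0 < e ->
  exists2 del : R, 0 < del & forall h, `|h| < del ->
    `|phi (x0 + h) - phi x0 - dotp h (grad phi x0) - 2^-1 * dotp (h *m H) h|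
      <= e * `|h| ^+ 2.
Proof.
move=> dphi sH e0; have e'0 : 0 < e / d.+1%:R by rewrite divr_gt0.
have [del del0 sHe] := sH _ e'0; exists del => // h hdel.
set a := dotp h (grad phi x0); set b := dotp (h *m H) h.
have dl (t : R) : is_derive t (1 : R)
    ((fun t => phi (x0 + t *: h) : R^o) - (a \*: (id : R -> R^o)) -
       ((2^-1 * b) \*: ((id : R -> R^o) ^+ 2)))
    (dotp h (grad phi (x0 + t *: h)) - a - t * b).
  apply: is_derive_eq.
    apply: is_deriveB.
    by apply: is_deriveB; exact: is_derive_line.
  rewrite expr1/=; congr (_ - _ - _); first by rewrite /GRing.scale/= mulr1.
  by rewrite /GRing.scale/=; field.
have [t /andP[t0 t1]] := MVT01 dl; rewrite !fctE/= !scale1r !scale0r !addr0.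
move=> hE.
have -> : phi (x0 + h) - phi x0 - a - 2^-1 * b =
   dotp h (grad phi (x0 + t *: h)) - a - t * b by rewrite -hE /GRing.scale/=; ring.
rewrite /a /b -dotpBr dotpC -dotpZl -dotpBl.
have h1 : `|x0 + t *: h - x0| < del.
  rewrite addrAC subrr add0r normrZ (ger0_norm t0).
  by rewrite (le_lt_trans _ hdel)// ler_piMl.
have h2 : `|x0 - x0| < del by rewrite subrr normr0.
have := sHe _ _ h1 h2; rewrite [x0 + _]addrC addrK.
rewrite -scalemxAl normrZ (ger0_norm t0) => hh.
rewrite (le_trans (dotp_norm _ _))// expr2 mulrA ler_wpM2r//.
apply: (@le_trans _ _ (d%:R * (e / d.+1%:R * (t * `|h|)))); first by rewrite ler_wpM2l.
rewrite mulrA; apply: ler_pM => //; first by rewrite mulr_ge0// ltW.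
- by rewrite mulr_ge0.
- by rewrite mulrCA -[leRHS]mulr1 ler_wpM2l ?ltW// ltr_pdivrMr// mul1r ltr_nat.
- by rewrite ler_piMl.
Qed.

(** * C^p maps, coordinates and Jacobians *)

Lemma Cp_cst (R : realType) (d : nat) (W : normedModType R) (p : nat) (a : W) :
  Cp p (fun _ : 'rV[R]_d => a).
Proof.
elim: p a => [|p IH] a /=; first exact: cst_continuous.
split=> [x|v]; first exact: differentiable_cst.
have -> : (fun x : 'rV[R]_d => 'D_v (fun=> a) x) = fun=> 0.
  by apply/funext => x; exact: derive_cst.
exact: IH.
Qed.

Lemma Cp_add (R : realType) (d : nat) (W : normedModType R) (p : nat)
    (F G : 'rV[R]_d -> W) : Cp p F -> Cp p G -> Cp p (F + G).
Proof.
elim: p F G => [|p IH] F G /=.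
  by move=> cF cG x; apply: continuousD; [exact: cF|exact: cG].
move=> [dF cF] [dG cG]; split=> [x|v]; first exact: differentiableD.
have -> : (fun x => 'D_v (F + G) x) = (fun x => 'D_v F x) + (fun x => 'D_v G x).
  by apply/funext => x; rewrite deriveD//; exact: diff_derivable.
exact: IH.
Qed.

Lemma Cp_scale (R : realType) (d : nat) (W : normedModType R) (p : nat)
    (a : R) (F : 'rV[R]_d -> W) : Cp p F -> Cp p (a \*: F).
Proof.
elim: p F => [|p IH] F /=.
  by move=> cF x; exact: (@cvgZl_tmp _ _ _ _ _ a _ _ (cF x)).
move=> [dF cF]; split=> [x|v]; first exact: differentiableZ.
have -> : (fun x => 'D_v (a \*: F) x) = a \*: (fun x => 'D_v F x).
  by apply/funext => x; rewrite deriveZ//; exact: diff_derivable.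
exact: IH.
Qed.

Lemma Cp_sum (R : realType) (d m : nat) (W : normedModType R) (p : nat)
    (F : 'I_m -> 'rV[R]_d -> W) :
  (forall j, Cp p (F j)) -> Cp p (\sum_j F j).
Proof.
move=> cF; elim/big_ind : _ => [|G H|//]; first exact: Cp_cst.
exact: Cp_add.
Qed.

Lemma Cp_coord (R : realType) (d m : nat) (p : nat) (G : 'rV[R]_d -> 'rV[R]_m)
    (j : 'I_m) : Cp p G -> Cp p (fun x => G x ord0 j : R^o).
Proof.
elim: p G => [|p IH] G /=.
  move=> cG x; apply: (@continuous_comp _ _ _ G (fun y : 'rV[R]_m => y ord0 j : R^o)).
    exact: cG.
  exact: coord_continuous.
move=> [dG cG]; split=> [x|v].
  apply: (@differentiable_comp _ _ _ _ G (fun y : 'rV[R]_m => y ord0 j : R^o)) => //.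
  exact: differentiable_coord.
have -> : (fun x => 'D_v (fun x => G x ord0 j : R^o) x) = (fun x => 'D_v G x ord0 j).
  by apply/funext => x; rewrite derive_mx ?mxE//; exact: diff_derivable.
exact: IH.
Qed.

Lemma CpW (R : realType) (d : nat) (W : normedModType R) (p : nat)
    (F : 'rV[R]_d -> W) : Cp p.+1 F -> Cp p F.
Proof.
elim: p F => [|p IH] F [dF cF].
  by move=> x; apply: differentiable_continuous; exact: dF.
by split => // v; apply: IH; exact: cF.
Qed.

Lemma jacobianE (R : realType) (d m : nat) (G : 'rV[R]_d -> 'rV[R]_m) x i j :
  differentiable G x -> 'J G x i j = grad (fun y => G y ord0 j) x ord0 i.
Proof.
move=> dG; rewrite /jacobian /lin1_mx !mxE -deriveE// derive_mx ?mxE//.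
exact: diff_derivable.
Qed.

Lemma mulmx_jacobianE (R : realType) (d m : nat) (G : 'rV[R]_d -> 'rV[R]_m)
    x (u : 'rV[R]_d) j : differentiable G x ->
  (u *m 'J G x) ord0 j = dotp u (grad (fun y => G y ord0 j) x).
Proof.
by move=> dG; rewrite mxE; apply: eq_bigr => i _; rewrite jacobianE.
Qed.

Lemma strict_diff_mx (R : realType) (d m : nat) (G : 'rV[R]_d -> 'rV[R]_m)
    (x0 : 'rV[R]_d) (e : R) : Cp 1 G -> 0 < e ->
  near2 x0 (fun x y => `|G x - G y - (x - y) *m 'J G x0| <= e * `|x - y|).
Proof.
move=> cG e0; have [del del0 h] := near2_forall (fun j =>
  strict_diff x0 (Cp_coord j cG) e0).
exists del => // x y xd yd; apply: mx_norm_le => [|a j]; first by rewrite mulr_ge0// ltW.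
have := h x y xd yd j; rewrite (ord1 a) -mulmx_jacobianE ?mxE//.
exact: cG.1.
Qed.

Lemma strict_hessian_lip (R : realType) (d : nat) (phi : 'rV[R]_d -> R)
    (x0 : 'rV[R]_d) (H : 'M[R]_d) : strict_hessian phi x0 H ->
  near2 x0 (fun x y => `|grad phi x - grad phi y| <= (1 + d%:R * `|H|) * `|x - y|).
Proof.
move=> /(_ 1 ltr01)[del del0 h]; exists del => // x y xd yd.
have := h x y xd yd; rewrite mul1r => {}h.
rewrite -[grad phi x - grad phi y](subrK ((x - y) *m H)).
rewrite (le_trans (ler_normD _ _))// mulrDl mul1r lerD// mulrAC.
exact: mulmx_norm.
Qed.

Lemma mx_subE (R : realType) (m n : nat) (A B : 'M[R]_(m, n)) i j :
  (A - B) i j = A i j - B i j.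
Proof. by rewrite !mxE. Qed.

Lemma jacobian_lip (R : realType) (d m : nat) (G : 'rV[R]_d -> 'rV[R]_m)
    (x0 : 'rV[R]_d) : Cp 2 G ->
  exists2 C : R, 0 < C & near2 x0 (fun x y => `|'J G x - 'J G y| <= C * `|x - y|).
Proof.
move=> cG.
have /choice[H HP] : forall j, exists H : 'M[R]_d,
    strict_hessian (fun y => G y ord0 j) x0 H.
  by move=> j; have [H sH _] := C2_strict_hessian x0 (Cp_coord j cG); exists H.
have [del del0 h] := near2_forall (fun j => strict_hessian_lip (HP j)).
have S0 : 0 <= \sum_j d%:R * `|H j| by apply: sumr_ge0 => j _; rewrite mulr_ge0.
exists (1 + \sum_j d%:R * `|H j|); first by rewrite ltr_wpDr.
exists del => // x y xd yd; apply: mx_norm_le => [|i j].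
  by rewrite mulr_ge0// addr_ge0.
have dG z : differentiable G z := cG.1 z.
have -> : ('J G x - 'J G y) i j =
    (grad (fun z => G z ord0 j) x - grad (fun z => G z ord0 j) y) ord0 i.
  apply: etrans (mx_subE _ _ _ _) _; apply: etrans _ (esym (mx_subE _ _ _ _)).
  by congr (_ - _); exact: jacobianE.
apply: le_trans (mx_entry_norm _ _ _) _; apply: le_trans (h x y xd yd j) _.
rewrite ler_wpM2r// lerD2l.
by rewrite (bigD1 j)//= lerDl sumr_ge0// => k _; rewrite mulr_ge0.
Qed.

(** * Normals and the level set of a submersion *)

(** Completeness of the row vectors as a normed module, the setting of the Banach fixed point
    theorem used below. *)
HB.instance Definition _ (R : realType) (m : nat) :=
  Uniform_isComplete.Build 'rV[R]_m (@cauchy_cvg _).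

(* Newton-type fixed point of w |-> w - G (p + w *m Kt), where Kt is a left
   inverse of the derivative J0. *)
Lemma solve_equations (R : realType) (d m : nat) (G : 'rV[R]_d -> 'rV[R]_m)
    (x0 : 'rV[R]_d) (J0 : 'M[R]_(d, m)) (Kt : 'M[R]_(m, d)) :
  (forall e : R, 0 < e ->
    near2 x0 (fun x y => `|G x - G y - (x - y) *m J0| <= e * `|x - y|)) ->
  Kt *m J0 = 1%:M ->
  exists del C : R, [/\ 0 < del, 0 < C & forall p, `|p - x0| < del ->
    `|G p| < del -> exists2 x, G x = 0 & `|x - p| <= C * `|G p|].
Proof.
move=> sG KJ; pose C : R := 1 + m%:R * `|Kt|.
have C0 : 0 < C by rewrite /C ltr_wpDr// mulr_ge0.
have wK (w : 'rV[R]_m) : `|w *m Kt| <= C * `|w|.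
  rewrite (le_trans (mulmx_norm _ _))// /C mulrDl mul1r mulrAC.
  by rewrite -subr_ge0 addrK.
(* Since [|w *m Kt| <= C |w|], this error makes [Phi] contract by 1/2; as [Phi 0 = - G p], the ball
   of radius [2 |G p|] is then mapped into itself. *)
have e0 : 0 < (2 * C)^-1 by rewrite invr_gt0 mulr_gt0.
have [del0 del00 h] := sG _ e0.
have C1 : 0 < 1 + 2 * C by rewrite ltr_wpDr// mulr_ge0// ltW.
exists (del0 / (1 + 2 * C)), (2 * C); split; [exact: divr_gt0|exact: mulr_gt0|].
move=> p px Gp.
pose U := [set w : 'rV[R]_m | `|w| <= 2 * `|G p|].
pose Phi (w : 'rV[R]_m) := w - G (p + w *m Kt).
have near_x0 w : U w -> `|p + w *m Kt - x0| < del0.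
  move=> Uw; rewrite addrAC (le_lt_trans (ler_normD _ _))//.
  have -> : del0 = del0 / (1 + 2 * C) + C * (2 * (del0 / (1 + 2 * C))).
    by field; rewrite gt_eqF.
  rewrite ltr_leD// (le_trans (wK w))// ler_pM2l// (le_trans Uw)// ler_pM2l//.
  exact: ltW.
have PhiL w1 w2 : U w1 -> U w2 -> `|Phi w1 - Phi w2| <= 2^-1 * `|w1 - w2|.
  move=> U1 U2; have := h _ _ (near_x0 _ U1) (near_x0 _ U2).
  have dE : p + w1 *m Kt - (p + w2 *m Kt) = (w1 - w2) *m Kt.
    by rewrite mulmxBl opprD addrACA subrr add0r.
  rewrite dE -mulmxA KJ mulmx1 => hh.
  have -> : Phi w1 - Phi w2 = - (G (p + w1 *m Kt) - G (p + w2 *m Kt) - (w1 - w2)).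
    by apply/rowP => i; rewrite /Phi !mxE; ring.
  rewrite normrN (le_trans hh)//.
  apply: (@le_trans _ _ ((2 * C)^-1 * (C * `|w1 - w2|))).
    by rewrite ler_pM2l// wK.
  by rewrite le_eqVlt; apply/orP; left; apply/eqP; field; rewrite gt_eqF.
have U0 : U 0 by rewrite /U /= normr0 mulr_ge0.
have PhiU : set_fun U U Phi.
  move=> w Uw; rewrite /U /= -[Phi w](subrK (Phi 0)) (le_trans (ler_normD _ _))//.
  have := PhiL _ _ Uw U0; rewrite subr0 => h1.
  have -> : Phi 0 = - G p by rewrite /Phi mul0mx addr0 sub0r.
  rewrite normrN; have : 2^-1 * `|w| <= `|G p|.
    by rewrite ler_pdivrMl//.
  have -> : - G p = Phi 0 by rewrite /Phi mul0mx addr0 sub0r.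
  lra.
have ctr : is_contraction (mkfun_fun PhiU).
  have h2 : 0 <= (2^-1 : R) by rewrite invr_ge0.
  exists (NngNum h2); split => /=; first by rewrite invf_lt1// ltr1n.
  by move=> [w1 w2] [/= U1 U2]; exact: PhiL.
have [w Uw wE] := banach_fixed_point (X := 'rV[R]_m) ctr (@norm_closed_le _ _ _) (ex_intro _ _ U0).
exists (p + w *m Kt).
  move: wE; rewrite /= /mkfun /Phi => wE.
  by rewrite -[G _](subKr w) -wE subrr.
by rewrite addrC addKr (le_trans (wK w))// (mulrC 2) -mulrA ler_pM2l.
Qed.

(** A multiplier rule, with one radius for all base points [y]. For a tangent [u], the point
    [y + t u] is pushed back onto the level set by a correction that is small relative to [t], so
    the first-order condition gives [0 <= dotp u a]. Applied to [u] and [- u], it makes [a]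
    orthogonal to the kernel of [J y]. *)
Lemma normal_vector (R : realType) (d m : nat) (G : 'rV[R]_d -> 'rV[R]_m)
    (J : 'rV[R]_d -> 'M[R]_(d, m)) (x0 : 'rV[R]_d) (Kt : 'M[R]_(m, d)) :
  (forall z (e : R), 0 < e ->
    near2 z (fun x y => `|G x - G y - (x - y) *m J z| <= e * `|x - y|)) ->
  Kt *m J x0 = 1%:M ->
  exists2 del : R, 0 < del & forall y (a : 'rV[R]_d), `|y - x0| < del -> G y = 0 ->
    (forall e : R, 0 < e -> exists2 del' : R, 0 < del' &
      forall x, `|x - y| < del' -> G x = 0 -> 0 <= dotp (x - y) a + e * `|x - y|) ->
    exists lam : 'rV[R]_m, a = lam *m (J y)^T.
Proof.
move=> sG KJ; have [del [C [del0 C0 solve]]] := solve_equations (sG x0) KJ.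
exists (del / 2); first by rewrite divr_gt0.
move=> y a yx Gy na.
suff tang (u : 'rV[R]_d) : u *m J y = 0 -> 0 <= dotp u a.
  (* Membership in the row space is tested on the columns of the cokernel, each of which is a
     tangent vector [c]. *)
  apply/submxP; rewrite submxE; apply/eqP/rowP => j; rewrite [RHS]mxE.
  pose c : 'rV[R]_d := (cokermx (J y)^T *m delta_mx j ord0)^T.
  have cJ : c *m J y = 0.
    by apply: trmx_inj; rewrite trmx_mul trmxK mulmxA mulmx_coker mul0mx trmx0.
  have ca : dotp c a = (a *m cokermx (J y)^T) ord0 j.
    by rewrite dotpC dotpE trmxK mulmxA -colE mxE.
  have := tang _ cJ; have := tang (- c); rewrite mulNmx cJ oppr0 dotpNl.
  move=> /(_ erefl); rewrite ca oppr_ge0 => h1 h2.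
  by apply/eqP; rewrite eq_le h1 h2.
move=> uJ; apply/ler_addgt0Pr => eta eta0.
pose U := 1 + `|u|; have U0 : 0 < U by rewrite /U ltr_wpDr.
(* After division by [t], [Z] is the coefficient of [e] in the two errors: the correction [x - p]
   paired with [a], and the slack [e |x - y|] along the level set. *)
pose Z := U * (d%:R * C * `|a| + 1 + C).
have Z0 : 0 < Z.
  have : 0 <= d%:R * C * `|a| by rewrite mulr_ge0// mulr_ge0// ltW.
  by move=> h; rewrite /Z mulr_gt0//; lra.
pose e := Num.min 1 (eta / Z).
have e0 : 0 < e by rewrite /e lt_min ltr01 divr_gt0.
have e1 : e <= 1 by rewrite /e ge_min lexx.
have eZ : e * Z <= eta by rewrite -ler_pdivlMr// /e ge_min lexx orbT.
have [d1 d10 sGy] := sG y e e0.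
have [d2 d20 nae] := na e e0.
have CU0 : 0 < 2 * (U * (1 + C)) by rewrite mulr_gt0// mulr_gt0// ltr_wpDr// ltW.
pose t := Num.min d1 (Num.min d2 del) / (2 * (U * (1 + C))).
have m0 : 0 < Num.min d1 (Num.min d2 del) by rewrite !lt_min d10 d20.
have t0 : 0 < t by rewrite /t divr_gt0.
have tm : t * (U * (1 + C)) * 2 <= Num.min d1 (Num.min d2 del).
  by rewrite -mulrA (mulrC _ 2) /t divfK// gt_eqF.
have [t1 [t2 t3]] : t * (U * (1 + C)) < d1 /\ t * (U * (1 + C)) < d2 /\
    t * (U * (1 + C)) <= del / 2.
  have tp : 0 < t * (U * (1 + C)) by rewrite mulr_gt0// mulr_gt0// ltr_wpDr// ltW.
  have : Num.min d1 (Num.min d2 del) <= d1 by rewrite ge_min lexx.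
  have : Num.min d1 (Num.min d2 del) <= d2 by rewrite !ge_min lexx orbT.
  have : Num.min d1 (Num.min d2 del) <= del by rewrite !ge_min lexx !orbT.
  by split; [lra|split; lra].
have tU : t * U <= t * (U * (1 + C)) by rewrite ler_pM2l// ler_peMr ?(ltW U0)// lerDl ltW.
have tCU : t * U * C <= t * (U * (1 + C)).
  have : 0 < t * U by rewrite mulr_gt0.
  lra.
have ntu : `|t *: u| <= t * U.
  by rewrite normrZ (gtr0_norm t0) ler_pM2l// /U lerDr.
pose p := y + t *: u.
have Gp : `|G p| <= e * (t * U).
  have h1 : `|p - y| < d1 by rewrite /p addrC addKr; lra.
  have h2 : `|y - y| < d1 by rewrite subrr normr0.
  have := sGy _ _ h1 h2; have -> : p - y = t *: u by rewrite /p addrC addKr.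
  rewrite Gy subr0 -scalemxAl uJ scaler0 subr0.
  by move=> /le_trans; apply; rewrite ler_pM2l.
have px : `|p - x0| < del.
  rewrite /p addrAC (le_lt_trans (ler_normD _ _))//; lra.
have etU : e * (t * U) <= t * U by rewrite ler_piMl// mulr_ge0 ?ltW.
have Gpdel : `|G p| < del by lra.
have [x Gx xp] := solve _ px Gpdel.
have xp' : `|x - p| <= C * (e * (t * U)) by rewrite (le_trans xp)// ler_pM2l.
have Ce : C * (e * (t * U)) <= t * U * C by rewrite mulrC ler_pM2r.
have xyE : x - y = (x - p) + t *: u by rewrite /p opprD addrA subrK.
have xy : `|x - y| <= t * (U * (1 + C)).
  rewrite xyE (le_trans (ler_normD _ _))// mulrDr mulr1 mulrDr addrC lerD//.
  by rewrite mulrA; lra.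
have := nae x (le_lt_trans xy t2) Gx.
rewrite {1}xyE dotpDl dotpZl => h.
have h1 : dotp (x - p) a <= d%:R * (C * (e * (t * U))) * `|a|.
  rewrite (le_trans (ler_norm _))// (le_trans (dotp_norm _ _))// ler_wpM2r// ler_wpM2l//.
have h2 : e * `|x - y| <= e * (t * (U * (1 + C))) by rewrite ler_pM2l.
have : 0 <= t * (dotp u a + e * Z).
  rewrite /Z; apply: le_trans h _; rewrite mulrDr.
  have -> : t * (e * (U * (d%:R * C * `|a| + 1 + C))) =
     d%:R * (C * (e * (t * U))) * `|a| + e * (t * (U * (1 + C))) by ring.
  lra.
rewrite pmulr_rge0//; lra.
Qed.

(* The graph of (y, lam) |-> gF y + lam *m (J y)^T is, modulo the normal space,
   strictly tangent at (x0, lam0) to the graph of H. *)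
Lemma normal_two_point (R : realType) (d m : nat) (gF : 'rV[R]_d -> 'rV[R]_d)
    (J : 'rV[R]_d -> 'M[R]_(d, m)) (x0 : 'rV[R]_d) (Kt : 'M[R]_(m, d))
    (lam0 : 'rV[R]_m) (H P : 'M[R]_d) (C : R) :
  0 < C ->
  near2 x0 (fun x y => `|J x - J y| <= C * `|x - y|) ->
  near2 x0 (fun x y => `|gF x - gF y| <= C * `|x - y|) ->
  (forall e : R, 0 < e -> near2 x0 (fun x y =>
    `|(gF x + lam0 *m (J x)^T) - (gF y + lam0 *m (J y)^T) - (x - y) *m H|
      <= e * `|x - y|)) ->
  Kt *m J x0 = 1%:M -> gF x0 + lam0 *m (J x0)^T = 0 -> (J x0)^T *m P = 0 ->
  forall e : R, 0 < e -> exists2 del : R, 0 < del &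
    forall y1 y2 lam1 lam2 v1 v2,
      `|y1 - x0| < del -> `|y2 - x0| < del -> `|v1| < del -> `|v2| < del ->
      v1 = gF y1 + lam1 *m (J y1)^T -> v2 = gF y2 + lam2 *m (J y2)^T ->
      `|((v1 - v2) - (y1 - y2) *m H) *m P| <= e * (`|y1 - y2| + `|v1 - v2|).
Proof.
move=> C0 [dJ dJ0 lipJ] [dF dF0 lipF] sL KJ crit JP e e0.
have Cge := ltW C0.
pose cK : R := d%:R * `|Kt|; pose M : R := m%:R; pose cP : R := d%:R * `|P|.
have cK0 : 0 <= cK by rewrite mulr_ge0.
have M0 : 0 <= M by rewrite /M.
have cP0 : 0 <= cP by rewrite mulr_ge0.
have kK (w : 'rV[R]_d) : `|w *m Kt^T| <= cK * `|w|.
  by rewrite (le_trans (mulmx_norm _ _))// mx_norm_tr /cK mulrAC.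
have kJ (l : 'rV[R]_m) (X : 'M[R]_(d, m)) : `|l *m X^T| <= M * `|l| * `|X|.
  by rewrite (le_trans (mulmx_norm _ _))// mx_norm_tr.
have JK : (J x0)^T *m Kt^T = 1%:M by rewrite -trmx_mul KJ trmx1.
(* [A1] will bound [lam - lam0] in units of [del], and [A2] the increment [lam1 - lam2]. The factor
   2 comes from absorbing half of the left-hand side, which [cK * M * C * del <= 2^-1] permits. *)
pose A1 : R := 2 * cK * (1 + C + M * C * `|lam0|).
have A10 : 0 <= A1.
  by rewrite /A1; nonneg.
pose A2 : R := 2 * cK * (1 + C + M * (`|lam0| + 1) * C).
have A20 : 0 <= A2.
  by rewrite /A2; nonneg.
have e'0 : 0 < e / (2 * (1 + cP)) by rewrite divr_gt0// mulr_gt0// ltr_pwDl.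
have [dL dL0 strL] := sL _ e'0.
pose B := M * A2 * C + M * A1 * C.
have B0 : 0 <= B by rewrite /B; nonneg.
have ex_del : exists del : R, [/\ 0 < del, del <= dJ, del <= dF, del <= dL &
    [/\ cK * M * C * del <= 2^-1, A1 * del <= 1 & (1 + cP) * B * del <= e / 2]].
  have c1 : 0 <= cK * M * C by nonneg.
  have c2 : 0 <= (1 + cP) * B by nonneg.
  exists (Num.min (Num.min dJ (Num.min dF dL))
    (Num.min (2^-1 / (1 + cK * M * C)) (Num.min (1 / (1 + A1)) (e / 2 / (1 + (1 + cP) * B))))).
  split; rewrite ?lt_min ?dJ0 ?dF0 ?dL0 ?divr_gt0 ?ltr_pwDl// ?ge_min ?lexx ?orbT//.
  by split; apply: small_mul => //; rewrite ?divr_gt0// ?ge_min ?lexx ?orbT.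
case: ex_del => del [del0 ddJ ddF ddL [h1 h2 h3]].
exists del => // y1 y2 lam1 lam2 v1 v2 y1x y2x v1d v2d v1E v2E.
have lamK y (lam : 'rV[R]_m) : lam *m (J y)^T *m Kt^T = lam + lam *m (J y - J x0)^T *m Kt^T.
  by rewrite [(_ - _)^T]linearB/= mulmxBr mulmxBl -!mulmxA JK mulmx1 addrC subrK.
have xx0 del' : 0 < del' -> `|x0 - x0| < del' by rewrite subrr normr0.
have Jx y : `|y - x0| < del -> `|J y - J x0| <= C * del.
  move=> yd; apply: le_trans (lipJ _ _ (lt_le_trans yd ddJ) (xx0 _ dJ0)) _.
  by rewrite ler_pM2l// ltW.
have lamE y lam (v : 'rV[R]_d) : `|y - x0| < del -> `|v| < del ->
    v = gF y + lam *m (J y)^T -> `|lam - lam0| <= A1 * del.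
  move=> yd vd vE.
  have Fx : `|gF y - gF x0| <= C * del.
    apply: le_trans (lipF _ _ (lt_le_trans yd ddF) (xx0 _ dF0)) _.
    by rewrite ler_pM2l// ltW.
  have l0E : lam0 = - (gF x0 *m Kt^T).
    move/(congr1 (fun w => w *m Kt^T)): crit; rewrite mulmxDl mul0mx -mulmxA JK mulmx1.
    by move/eqP; rewrite addrC addr_eq0 => /eqP.
  have dE : lam - lam0 = (v - (gF y - gF x0)) *m Kt^T - lam *m (J y - J x0)^T *m Kt^T.
    have := lamK y lam; rewrite vE [lam0]l0E opprK => lE.
    rewrite (_ : gF y + lam *m (J y)^T - (gF y - gF x0) = lam *m (J y)^T + gF x0); last first.
      by rowring.
    by rewrite mulmxDl lE addrAC addrK.
  have lamb : `|lam| <= `|lam - lam0| + `|lam0| by rewrite -{1}[lam](subrK lam0) ler_normD.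
  have b1 : `|(v - (gF y - gF x0)) *m Kt^T| <= cK * (del + C * del).
    apply: le_trans (kK _) _; rewrite ler_wpM2l//.
    by apply: le_trans (ler_normB _ _) _; rewrite lerD// ltW.
  have b2 : `|lam *m (J y - J x0)^T *m Kt^T| <= cK * M * C * del * (`|lam - lam0| + `|lam0|).
    apply: le_trans (kK _) _.
    rewrite (_ : cK * M * C * del * _ =
      cK * (M * (`|lam - lam0| + `|lam0|) * (C * del))); last by ring.
    rewrite ler_wpM2l//; apply: le_trans (kJ _ _) _.
    by rewrite ler_pM ?mulr_ge0// ?ler_wpM2l// Jx.
  have b3 : `|lam - lam0| <= cK * (del + C * del) + cK * M * C * del * (`|lam - lam0| + `|lam0|).
    by apply: le_trans (lerD b1 b2); rewrite {1}dE; exact: ler_normB.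
  have b4 : cK * M * C * del * `|lam - lam0| <= 2^-1 * `|lam - lam0| by rewrite ler_wpM2r.
  move: b3 b4; rewrite /A1 !mulrDr !mulrDl; lra.
have l1 := lamE _ _ _ y1x v1d v1E; have l2 := lamE _ _ _ y2x v2d v2E.
have dJ12 : `|J y1 - J y2| <= C * `|y1 - y2|.
  by apply: lipJ; [exact: lt_le_trans y1x ddJ|exact: lt_le_trans y2x ddJ].
have dF12 : `|gF y1 - gF y2| <= C * `|y1 - y2|.
  by apply: lipF; [exact: lt_le_trans y1x ddF|exact: lt_le_trans y2x ddF].
have dL12 := strL _ _ (lt_le_trans y1x ddL) (lt_le_trans y2x ddL).
set dy := `|y1 - y2| in dJ12 dF12 dL12 *; set dv := `|v1 - v2|.
have dlam : `|lam1 - lam2| <= A2 * (dy + dv).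
  have dE : lam1 - lam2 = (v1 - v2 - (gF y1 - gF y2) - lam2 *m (J y1 - J y2)^T) *m Kt^T
      - (lam1 - lam2) *m (J y1 - J x0)^T *m Kt^T.
    have -> : v1 - v2 - (gF y1 - gF y2) - lam2 *m (J y1 - J y2)^T =
        (lam1 - lam2) *m (J y1)^T.
      rewrite v1E v2E [(_ - _)^T]linearB/= mulmxBr mulmxBl.
      by rowring.
    by rewrite lamK addrK.
  have lamb : `|lam2| <= `|lam0| + 1.
    rewrite -{1}[lam2](subrK lam0) (le_trans (ler_normD _ _))// addrC lerD2l.
    exact: le_trans l2 h2.
  have b1 : `|(v1 - v2 - (gF y1 - gF y2) - lam2 *m (J y1 - J y2)^T) *m Kt^T| <=
      cK * (dv + C * dy + M * (`|lam0| + 1) * (C * dy)).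
    rewrite (le_trans (kK _))// ler_wpM2l// (le_trans (ler_normB _ _))// lerD//.
      by rewrite (le_trans (ler_normB _ _))// lerD.
    rewrite (le_trans (kJ _ _))// ler_pM ?mulr_ge0// ler_wpM2l//.
  have b2 : `|(lam1 - lam2) *m (J y1 - J x0)^T *m Kt^T| <= 2^-1 * `|lam1 - lam2|.
    rewrite (le_trans (kK _))//.
    apply: (@le_trans _ _ (cK * (M * `|lam1 - lam2| * (C * del)))).
      by rewrite ler_wpM2l// (le_trans (kJ _ _))// ler_wpM2l ?mulr_ge0// Jx.
    rewrite (_ : cK * _ = cK * M * C * del * `|lam1 - lam2|); last by ring.
    by rewrite ler_wpM2r.
  have b3 : `|lam1 - lam2| <= cK * (dv + C * dy + M * (`|lam0| + 1) * (C * dy)) +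
      2^-1 * `|lam1 - lam2|.
    by apply: le_trans (lerD b1 b2); rewrite {1}dE; exact: ler_normB.
  have dy0 : 0 <= cK * dy by rewrite /dy; nonneg.
  have dv0 : 0 <= cK * C * dv + cK * M * (`|lam0| + 1) * C * dv.
    by rewrite /dv; nonneg.
  move: b3; rewrite /A2; lra.
(* Modulo the rows of [(J x0)^T], which [P] kills, each multiplier increment is paired with a
   difference of Jacobians; beside the Lagrangian with [lam0] frozen only products of two small
   factors remain. *)
have -> : (v1 - v2 - (y1 - y2) *m H) *m P =
    (((gF y1 + lam0 *m (J y1)^T) - (gF y2 + lam0 *m (J y2)^T) - (y1 - y2) *m H)
     + (lam1 - lam2) *m (J y1 - J x0)^T + (lam2 - lam0) *m (J y1 - J y2)^T) *m P.
  rewrite v1E v2E; apply/eqP; rewrite -subr_eq0 -mulmxBl.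
  rewrite (_ : _ - _ = (lam1 - lam2) *m (J x0)^T); first by rewrite -mulmxA JP mulmx0.
  rewrite ![(_ - _)^T]linearB/= !mulmxBr !mulmxBl.
  by rowring.
apply: (@le_trans _ _ (cP * (e / (2 * (1 + cP)) * dy + M * (A2 * (dy + dv)) * (C * del)
    + M * (A1 * del) * (C * dy)))).
  rewrite (le_trans (mulmx_norm _ _))// /cP mulrAC ler_wpM2l ?mulr_ge0//.
  rewrite (le_trans (ler_normD _ _))// lerD//.
    rewrite (le_trans (ler_normD _ _))// lerD//.
    by rewrite (le_trans (kJ _ _))// ler_pM ?mulr_ge0// ?ler_wpM2l// Jx.
  by rewrite (le_trans (kJ _ _))// ler_pM ?mulr_ge0// ?ler_wpM2l.
have dy0 : 0 <= dy by rewrite /dy.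
have dv0 : 0 <= dv by rewrite /dv.
have p1 : cP * (e / (2 * (1 + cP)) * dy) <= e / 2 * dy.
  rewrite mulrA ler_wpM2r// mulrA ler_pdivrMr ?mulr_gt0 ?ltr_pwDl//.
  have : 0 < e * 1 by rewrite mulr1.
  lra.
have p2 : cP * (M * (A2 * (dy + dv)) * (C * del) + M * (A1 * del) * (C * dy)) <= e / 2 * (dy + dv).
  apply: (@le_trans _ _ ((1 + cP) * B * del * (dy + dv))); last first.
    by rewrite ler_wpM2r// addr_ge0.
  rewrite /B -subr_ge0.
  have -> : (1 + cP) * (M * A2 * C + M * A1 * C) * del * (dy + dv) -
    cP * (M * (A2 * (dy + dv)) * (C * del) + M * (A1 * del) * (C * dy)) =
    (M * A2 * C + M * A1 * C) * del * (dy + dv) + cP * (M * A1 * C * del * dv) by ring.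
  have dge : 0 <= del by exact: ltW.
  by nonneg.
have : 0 <= e / 2 * dv by rewrite mulr_ge0// divr_ge0// ltW.
lra.
Qed.

(** * Expanding quadratic forms *)

(* Two orbits staying near l cannot separate along the expanding cone q > 0, so
   their difference stays in q <= 0 and W is a Lipschitz graph over a hyperplane. *)
Lemma trapped_null (R : realType) (d : nat) (T : 'rV[R]_d -> 'rV[R]_d)
    (l u : 'rV[R]_d) (Q : 'M[R]_d) (theta del : R) :
  1 < theta -> 0 < dotp (u *m Q) u ->
  (forall x y, `|x - l| < del -> `|y - l| < del ->
    theta * dotp ((x - y) *m Q) (x - y) <= dotp ((T x - T y) *m Q) (T x - T y)) ->
  cnull [set x | forall k, `|iter k T x - l| < del].
Proof.
move=> th1 qu exp; set W := [set x | _].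
pose K : R := d%:R * (d%:R * `|Q|).
have K0 : 0 <= K by rewrite /K; nonneg.
have qK a b : `|dotp (a *m Q) b| <= K * `|a| * `|b|.
  rewrite (le_trans (dotp_norm _ _))// ler_wpM2r// /K -mulrA ler_wpM2l//.
  by rewrite (le_trans (mulmx_norm _ _))// mulrAC.
have Wq x y : W x -> W y -> dotp ((x - y) *m Q) (x - y) <= 0.
  move=> Wx Wy; rewrite leNgt; apply/negP => q0.
  set q := dotp _ _ in q0.
  have grow k : theta ^+ k * q <=
      dotp ((iter k T x - iter k T y) *m Q) (iter k T x - iter k T y).
    elim: k => [|k IH]; first by rewrite expr0 mul1r.
    rewrite exprS -mulrA; apply: le_trans (exp _ _ (Wx k) (Wy k)).
    by rewrite ler_pM2l// (lt_trans ltr01).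
  have bound k : theta ^+ k * q <= K * (2 * del) ^+ 2.
    apply: le_trans (grow k) _; apply: le_trans (ler_norm _) _.
    apply: le_trans (qK _ _) _; rewrite -mulrA ler_wpM2l// expr2.
    have h : `|iter k T x - iter k T y| <= 2 * del.
      have -> : iter k T x - iter k T y = (iter k T x - l) - (iter k T y - l) by rowring.
      have := Wx k; have := Wy k => h1 h2.
      by rewrite (le_trans (ler_normB _ _))// mulr2n mulrDl mul1r lerD// ltW.
    by rewrite ler_pM.
  (* Bernoulli's inequality, which makes [theta ^+ k] exceed the bound on trapped orbits. *)
  have grow2 k : 1 + k%:R * (theta - 1) <= theta ^+ k.
    elim: k => [|k IH]; first by rewrite mul0r addr0 expr0.
    rewrite exprS -natr1.
    have : theta * (1 + k%:R * (theta - 1)) <= theta * theta ^+ k.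
      by rewrite ler_pM2l// (lt_trans ltr01).
    have : 0 <= k%:R * ((theta - 1) * (theta - 1)).
      by rewrite mulr_ge0// mulr_ge0// subr_ge0 ltW.
    lra.
  pose Z := K * (2 * del) ^+ 2 / q / (theta - 1).
  have [k kZ] : exists k : nat, Z < k%:R.
    exists (Num.bound `|Z|); apply: le_lt_trans (ler_norm _) _.
    by apply: archi_boundP.
  have t1 : 0 < theta - 1 by rewrite subr_gt0.
  move: kZ; rewrite /Z ltr_pdivrMr// ltr_pdivrMr// => kZ.
  have : (1 + k%:R * (theta - 1)) * q <= theta ^+ k * q by rewrite ler_pM2r.
  have := bound k; lra.
set q0 := dotp _ _ in qu.
have e0 : u != 0.
  by apply/eqP => u0; move: qu; rewrite /q0 u0 mul0mx dotp0l ltxx.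
(* For [|p| <= eta |t|] with [eta <= 1], the form at [t u + p] is at least
   [t^2 (q0 - eta (2 K |u| + K))]; [eta <= q0 / (2 D)] keeps it positive on the whole cone around
   [u]. *)
pose D : R := 1 + 2 * K * `|u| + K.
have D0 : 0 < D.
  have : 0 <= 2 * K * `|u| by nonneg.
  by rewrite /D; lra.
pose eta := Num.min 1 (q0 / (2 * D)).
have eta0 : 0 < eta by rewrite lt_min ltr01 divr_gt0// mulr_gt0.
have eta1 : eta <= 1 by rewrite ge_min lexx.
have etaD : eta * (2 * D) <= q0 by rewrite -ler_pdivlMr ?mulr_gt0// ge_min lexx orbT.
apply: (cnull_cone e0 eta0) => x y t Wx Wy; rewrite leNgt; apply/negP => small.
have t0 : 0 < `|t|.
  rewrite lt_neqAle normr_ge0 andbT eq_sym; apply/eqP => tz.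
  by move: small; rewrite tz mulr0 ltNge normr_ge0.
have := Wq x y Wx Wy.
set p := x - y - t *: u in small *.
have -> : x - y = t *: u + p by rewrite /p subrKC.
clearbody p.
rewrite mulmxDl -scalemxAl !dotpE_simp -/q0.
have := qK u p; have := qK p u; have := qK p p.
have hp : `|p| <= eta * `|t| by exact: ltW.
have h1 : K * `|u| * `|p| <= K * `|u| * (eta * `|t|) by rewrite ler_wpM2l// mulr_ge0.
have h2 : K * `|p| * `|p| <= K * (eta * `|t|) * (1 * `|t|).
  have hp1 : `|p| <= 1 * `|t| by rewrite (le_trans hp)// ler_wpM2r.
  by apply: ler_pM; rewrite ?mulr_ge0// ler_wpM2l.
rewrite [K * `|p| * `|u|]mulrAC => q3 q2 q1.
have {}q1 := le_trans q1 h1; have {}q2 := le_trans q2 h1; have {}q3 := le_trans q3 h2.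
have s1 : - (`|t| * (K * `|u| * (eta * `|t|))) <= t * dotp (u *m Q) p.
  by rewrite lerNl -mulrN (le_trans (ler_norm _))// normrM normrN ler_wpM2l.
have s2 : - (`|t| * (K * `|u| * (eta * `|t|))) <= t * dotp (p *m Q) u.
  by rewrite lerNl -mulrN (le_trans (ler_norm _))// normrM normrN ler_wpM2l.
have s3 : - (K * (eta * `|t|) * (1 * `|t|)) <= dotp (p *m Q) p.
  by move: q3; rewrite ler_norml => /andP[].
have tt : t * t = `|t| * `|t| by rewrite -normrM ger0_norm// -expr2 sqr_ge0.
have pos : 0 < `|t| * `|t| * (q0 - eta * (2 * K * `|u| + K)).
  rewrite mulr_gt0 ?mulr_gt0// subr_gt0.
  have : 0 < eta * 1 by rewrite mulr1.
  move: etaD; rewrite /D; lra.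
have : t * t * q0 = `|t| * `|t| * q0 by rewrite tt.
lra.
Qed.

Lemma unit_mx_lower_bound (R : realType) (d : nat) (A : 'M[R]_d) :
  A \in unitmx -> exists2 C : R, 0 < C & forall v : 'rV[R]_d, `|v| <= C * `|v *m A|.
Proof.
move=> uA; exists (1 + d%:R * `|invmx A|) => [|v].
  by rewrite ltr_pwDl// mulr_ge0.
rewrite -{1}[v](mulmxK uA) (le_trans (mulmx_norm _ _))// mulrDl mul1r mulrAC.
by rewrite -[leLHS]add0r lerD2r.
Qed.

Lemma posdef_unitmx (R : realType) (d : nat) (B : 'M[R]_d) (s : R) : 0 < s ->
  (forall v, s * dotp v v <= dotp (v *m B) v) -> B \in unitmx.
Proof.
move=> s0 sB; rewrite -row_free_unit -kermx_eq0; apply/rowV0P => v /sub_kermxP vB.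
have := sB v; rewrite vB dotp0l => h; apply/eqP; rewrite -normr_le0.
have : `|v| ^+ 2 <= 0 by rewrite (le_trans (norm_sqr_le_dotp v))// -(pmulr_rle0 _ s0).
by rewrite exprn_even_le0//= => /eqP->.
Qed.

(** Among [d + 1] distinct points of the interval, one is not a root of the characteristic
    polynomial, whose degree is [d]. *)
Lemma exists_non_eigenvalue (R : realType) (d : nat) (A : 'M[R]_d) (a b : R) :
  a < b -> exists2 c : R, a < c < b & A - c%:M \in unitmx.
Proof.
move=> ab; pose p := char_poly A.
pose pt (i : 'I_d.+1) : R := a + (i.+1%:R / d.+2%:R) * (b - a).
have pt_in i : a < pt i < b.
  have ba : 0 < b - a by rewrite subr_gt0.
  rewrite /pt ltrDl mulr_gt0 ?divr_gt0//= -ltrBrDl -[ltRHS]mul1r ltr_pM2r//.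
  by rewrite ltr_pdivrMr// mul1r ltr_nat ltnS ltn_ord.
have pt_inj : injective pt.
  move=> i j /addrI/mulIf; rewrite subr_eq0 gt_eqF// => /(_ isT)/divIf.
  rewrite pnatr_eq0 => /(_ isT)/eqP; rewrite eqr_nat eqSS => /eqP ij.
  exact: val_inj.
have [i ri] : exists i, ~~ root p (pt i).
  apply/existsP; rewrite -negb_forall; apply/negP => /forallP h.
  have : (size [seq pt i | i : 'I_d.+1] < size p)%N.
    apply: max_poly_roots; first by rewrite monic_neq0// char_poly_monic.
      by apply/allP => _ /mapP[i _ ->]; exact: h.
    by rewrite map_inj_uniq// enum_uniq.
  by rewrite size_map -cardE card_ord size_char_poly ltnn.
exists (pt i) => //.
rewrite -row_free_unit -kermx_eq0 -[_ == 0]negbK -/(eigenvalue A (pt i)).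
by rewrite eigenvalue_root_char.
Qed.

(** Scalar core of the expansion, with [tau] and [N] the tangential and normal sizes. The coupling
    [C2 tau N] is not small; Young's inequality moves it into [c1 / 2 tau^2] and a multiple of
    [N^2], which fixes the normal weight [K]. Only afterwards is [e] chosen: [C3] is the total
    coefficient of [e (tau + N)^2]. *)
Lemma quadratic_margin (R : realType) (c1 C2 alpha D : R) :
  0 < c1 -> 0 <= C2 -> 0 < alpha -> 0 <= D ->
  exists K e : R, [/\ 0 < K, 0 < e, e <= 1 & forall tau N, 0 <= tau -> 0 <= N ->
    0 <= c1 * tau ^+ 2 -
      C2 * (tau * (e * (tau + N) + N) + (e * (tau + N) + N) ^+ 2) +
      K * alpha * N ^+ 2 - K * alpha * D * e ^+ 2 * (tau + N) ^+ 2].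
Proof.
move=> c10 C20 a0 D0.
pose K := (C2 ^+ 2 / (2 * c1) + 2 * C2 + c1 / 2) / alpha.
have c1n : c1 != 0 by rewrite gt_eqF.
have Ka : K * alpha = C2 ^+ 2 / (2 * c1) + 2 * C2 + c1 / 2.
  by rewrite /K divfK// gt_eqF.
have h0 : 0 <= C2 ^+ 2 / (2 * c1) by nonneg.
have K0 : 0 < K by rewrite /K divr_gt0//; lra.
pose C3 := 3 * C2 + K * alpha * D.
have C30 : 0 <= C3 by rewrite /C3; nonneg.
pose e := Num.min 1 (c1 / 4 / (1 + C3)).
have e1 : e <= 1 by rewrite ge_min lexx.
have e0 : 0 < e by rewrite lt_min ltr01 !divr_gt0// ltr_pwDl.
have eC : C3 * e <= c1 / 4.
  by apply: small_mul => //; rewrite ?divr_gt0// ge_min lexx orbT.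
exists K, e; split => // tau N t0 N0.
pose s := (tau + N) ^+ 2; pose F := e * (tau + N).
have F0 : 0 <= F by rewrite /F; nonneg.
have s0 : 0 <= s by rewrite /s; nonneg.
have s2 : s <= 2 * tau ^+ 2 + 2 * N ^+ 2.
  have := sqr_ge0 (tau - N); rewrite /s !expr2; lra.
have tF : tau * F <= e * s.
  have : 0 <= e * (N * (tau + N)) by nonneg.
  by rewrite /F /s expr2; lra.
have ee : e ^+ 2 <= e by rewrite expr2 ler_piMl// ltW.
have FF : F ^+ 2 <= e * s by rewrite /F exprMn ler_wpM2r.
have FN : (F + N) ^+ 2 <= 2 * F ^+ 2 + 2 * N ^+ 2.
  have := sqr_ge0 (F - N); rewrite !expr2; lra.
have tN : C2 * (tau * N) <= c1 / 2 * tau ^+ 2 + C2 ^+ 2 / (2 * c1) * N ^+ 2.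
  have h : 0 <= (c1 * tau - C2 * N) ^+ 2 / (2 * c1) by rewrite mulr_ge0 ?sqr_ge0//; nonneg.
  have : (c1 * tau - C2 * N) ^+ 2 / (2 * c1) =
    c1 / 2 * tau ^+ 2 + C2 ^+ 2 / (2 * c1) * N ^+ 2 - C2 * (tau * N) by field.
  lra.
have main : C2 * (tau * (F + N) + (F + N) ^+ 2) <=
    C2 * (tau * N) + 2 * C2 * N ^+ 2 + 3 * C2 * (e * s).
  have : C2 * (tau * (F + N) + (F + N) ^+ 2) <=
      C2 * (tau * N + 2 * N ^+ 2 + 3 * (e * s)) by rewrite ler_wpM2l//; lra.
  lra.
have last1 : K * alpha * D * e ^+ 2 * s <= K * alpha * D * (e * s).
  rewrite -mulrA ler_wpM2l//; first by nonneg.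
  by rewrite ler_wpM2r.
have last2 : C3 * (e * s) <= c1 / 4 * s by rewrite mulrA ler_wpM2r.
have KaN : K * alpha * N ^+ 2 =
  C2 ^+ 2 / (2 * c1) * N ^+ 2 + 2 * C2 * N ^+ 2 + c1 / 2 * N ^+ 2.
  by rewrite Ka; ring.
have last3 : c1 / 4 * s <= c1 / 4 * (2 * tau ^+ 2 + 2 * N ^+ 2) by rewrite ler_wpM2l//; lra.
move: main last1 last2; rewrite /C3 -/F -/s KaN; lra.
Qed.

(* On the range of P the linearization is self-adjoint for the B-inner product,
   with operator A0 = S B^-1 >= 0, where S = B - alpha mu P H P.  The form
   <(A0 - a) t, t>_B - K |n|^2, with a > 1 not an eigenvalue of A0, grows by a
   factor a^2 since (A0 - a) A0^2 - a^2 (A0 - a) = (A0 + a) (A0 - a)^2. *)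
Lemma quadratic_expansion (R : realType) (d : nat) (P B H Gm N : 'M[R]_d)
    (alpha mu s : R) (u : 'rV[R]_d) :
  P^T = P -> P *m P = P -> B^T = B -> B *m P = P *m B -> H^T = H ->
  0 < s -> (forall v, s * dotp v v <= dotp (v *m B) v) ->
  N = P + mu *: ((H - Gm) *m P) ->
  (forall t : 'rV[R]_d, t *m P = t -> t *m B = t *m N) ->
  (forall t : 'rV[R]_d, t *m P = t ->
    0 <= dotp (t *m B) t - alpha * mu * dotp (t *m H) t) ->
  0 < alpha < 1 -> 0 < mu -> u *m P = u -> dotp (u *m H) u < 0 ->
  exists Q theta e, [/\ 1 < theta, 0 < e, 0 < dotp (u *m Q) u &
    forall v w : 'rV[R]_d,
      `|w *m N - (v *m P - mu *: (v *m Gm *m P))| <= e * `|v| ->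
      `|w - w *m P| <= e * `|v| ->
      theta * dotp (v *m Q) v <=
        dotp (((1 - alpha) *: v + alpha *: w) *m Q) ((1 - alpha) *: v + alpha *: w)].
Proof.
move=> PT PP BT BP HT s0 sB NE tB hS /andP[a0 a1] m0 uP uH.
have uB := posdef_unitmx s0 sB; pose Bi := invmx B.
pose S := B - (alpha * mu) *: (P *m H *m P).
have ST : S^T = S.
  by rewrite /S linearB linearZ/= !trmx_mul PT HT BT mulmxA.
have tS (t : 'rV[R]_d) : t *m P = t -> t *m S = t *m B - (alpha * mu) *: (t *m H *m P).
  by move=> tP; rewrite /S mulmxBr -scalemxAr !mulmxA tP.
have dotP (v w : 'rV[R]_d) : w *m P = w -> dotp (v *m P) w = dotp v w.
  by move=> wP; rewrite dotp_mull PT wP.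
have qS (t : 'rV[R]_d) : t *m P = t ->
    dotp (t *m S) t = dotp (t *m B) t - alpha * mu * dotp (t *m H) t.
  by move=> tP; rewrite tS// !dotpE_simp dotP.
clearbody S.
have symB (v w : 'rV[R]_d) : dotp (v *m B) w = dotp (w *m B) v.
  by rewrite dotp_mull BT dotpC.
have symS (v w : 'rV[R]_d) : dotp (v *m S) w = dotp (w *m S) v.
  by rewrite dotp_mull ST dotpC.
have ub : 0 < dotp (u *m B) u.
  rewrite lt_neqAle eq_sym andbC (le_trans _ (sB u)) ?mulr_ge0 ?dotp_ge0 ?ltW//=.
  apply/eqP => ub; have := sB u; rewrite ub => h.
  have : `|u| ^+ 2 <= 0 by rewrite (le_trans (norm_sqr_le_dotp u))// -(pmulr_rle0 _ s0).
  rewrite exprn_even_le0//= => /eqP/normr0_eq0 u0.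
  by move: uH; rewrite u0 dotp0r ltxx.
(* The right-hand side is the Rayleigh quotient of [S] relative to [B] at [u], above 1 by negative
   curvature. Taking [a] strictly between leaves the form positive at [u]. *)
have c0 : 1 < 1 + alpha * mu * - dotp (u *m H) u / dotp (u *m B) u.
  by rewrite ltrDl divr_gt0// !mulr_gt0// oppr_gt0.
have [a /andP[a_gt1 a_lt] aU] := exists_non_eigenvalue (S *m Bi) c0.
have a_gt0 : 0 < a by exact: lt_trans a_gt1.
have [C1 C10 C1P] := unit_mx_lower_bound aU.
pose Qa := S - a *: B.
have qQa v w : dotp (v *m Qa) w = dotp (v *m S) w - a * dotp (v *m B) w.
  by rewrite /Qa mulmxBr -scalemxAr !dotpE_simp.
clearbody Qa.
have quQa : 0 < dotp (u *m Qa) u.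
  rewrite qQa qS//.
  move: a_lt; rewrite -ltrBlDl ltr_pdivlMr//; lra.
pose Kq := d%:R * (d%:R * `|Qa|); pose Cx := d%:R * `|S *m Bi|.
have Kq0 : 0 <= Kq by rewrite /Kq; nonneg.
have Cx0 : 0 <= Cx by rewrite /Cx; nonneg.
have KqP v w : `|dotp (v *m Qa) w| <= Kq * `|v| * `|w|.
  rewrite (le_trans (dotp_norm _ _))// ler_wpM2r// /Kq -mulrA ler_wpM2l//.
  by rewrite (le_trans (mulmx_norm _ _))// mulrAC.
pose Cr := 1 + d%:R * `|N|; pose CG := d%:R * `|Gm *m P|.
have Cr1 : 0 <= Cr by rewrite /Cr; nonneg.
have CG0 : 0 <= CG by rewrite /CG; nonneg.
pose Ce := d%:R * `|Bi| * (Cr + mu * CG).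
have Ce0 : 0 <= Ce by rewrite /Ce; nonneg.
pose c1 := a * s / C1 ^+ 2.
have c10 : 0 < c1 by rewrite /c1 divr_gt0 ?exprn_gt0// mulr_gt0.
pose C2 := 2 * Kq * Cx * Ce + Kq * Ce ^+ 2.
have C20 : 0 <= C2 by rewrite /C2; nonneg.
have [K [e [K0 e0 e1 marg]]] := quadratic_margin c10 C20 a0 (ler0n R d).
pose Q := P *m Qa *m P - K *: (1%:M - P).
have qQ v : dotp (v *m Q) v =
    dotp (v *m P *m Qa) (v *m P) - K * dotp (v - v *m P) (v - v *m P).
  rewrite /Q mulmxBr -scalemxAr mulmxBr mulmx1 !mulmxA.
  rewrite [LHS]dotpBl dotpZl; congr (_ - _ * _).
    by rewrite [LHS]dotp_mull PT.
  rewrite [RHS]dotpBr [X in _ = _ - X](_ : _ = 0) ?subr0//.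
  by rewrite -[X in dotp _ (_ *m X)]PT -dotp_mull mulmxBl -mulmxA PP subrr dotp0l.
exists Q, (a ^+ 2), e; split => //.
- by rewrite -(expr1n _ 2) ltrXn2r// ?nnegrE// ltW.
- by rewrite qQ uP subrr dotp0l mulr0 subr0.
move=> v w hw1 hw2.
set t := v *m P; set n := v - t; set p := w *m P.
have tP : t *m P = t by rewrite /t -mulmxA PP.
have pP : p *m P = p by rewrite /p -mulmxA PP.
have vE : v = t + n by rewrite /n subrKC.
pose r1 := (w *m N - (v *m P - mu *: (v *m Gm *m P))) - (w - p) *m N.
have nr1 : `|r1| <= Cr * (e * `|v|).
  rewrite /r1 (le_trans (ler_normB _ _))// /Cr mulrDl mul1r lerD//.
  by rewrite (le_trans (mulmx_norm _ _))// mulrAC ler_wpM2l// mulr_ge0.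
(* [N] agrees with [B] on tangent vectors. The term [n *m Gm *m P] feeds the normal part into the
   tangential one at first order; it is the coupling that the weight [K] must dominate. *)
have pB : p *m B = t *m B - mu *: (t *m H *m P) - mu *: (n *m Gm *m P) + r1.
  rewrite (tB _ pP) (tB _ tP) /r1 -/t {1}vE NE.
  rewrite !(mulmxDr, mulmxBr, mulmxDl, mulmxBl, =^~ scalemxAr, mulmxA, mulmxN, mulNmx) -/p ?pP ?tP.
  by rowring.
pose x := t *m S *m Bi.
have xB : x *m B = t *m S by rewrite /x mulmxKV.
have xP : x *m P = x.
  apply: (can_inj (mulmxK uB)); rewrite -mulmxA -BP mulmxA xB.
  have h1 : t *m B *m P = t *m B by rewrite -[LHS]mulmxA BP mulmxA tP.
  have h2 : t *m H *m P *m P = t *m H *m P by rewrite -[LHS]mulmxA PP.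
  by rewrite (tS _ tP) mulmxBl -scalemxAl h1 h2.
set v1 := (1 - alpha) *: v + alpha *: w.
have v1P : v1 *m P = (1 - alpha) *: t + alpha *: p.
  by rewrite /v1 mulmxDl -!scalemxAl.
pose er := v1 *m P - x.
have erE : er = (alpha *: (r1 - mu *: (n *m Gm *m P))) *m Bi.
  apply: (can_inj (mulmxK uB)); rewrite mulmxKV// /er mulmxBl xB v1P mulmxDl.
  by rewrite -!scalemxAl pB (tS _ tP); rowring.
have ner : `|er| <= Ce * (e * `|v| + `|n|).
  rewrite erE; apply: le_trans (mulmx_norm _ _) _.
  rewrite (_ : Ce * _ = d%:R * ((Cr + mu * CG) * (e * `|v| + `|n|)) * `|Bi|); last first.
    by rewrite /Ce; ring.
  rewrite ler_wpM2r// ler_wpM2l// normrZ (gtr0_norm a0).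
  apply: (@le_trans _ _ (Cr * (e * `|v|) + mu * (CG * `|n|))).
    rewrite -[leRHS]mul1r ler_pM ?(ltW a0) ?(ltW a1)// (le_trans (ler_normB _ _))// lerD//.
    rewrite normrZ (gtr0_norm m0) ler_pM2l// -mulmxA (le_trans (mulmx_norm _ _))//.
    by rewrite /CG mulrAC.
  have : 0 <= Cr * `|n| by nonneg.
  have : 0 <= mu * CG * (e * `|v|) by nonneg.
  lra.
have nx : `|x| <= Cx * `|t|.
  by rewrite /x -mulmxA (le_trans (mulmx_norm _ _))// /Cx mulrAC.
pose w' := x - a *: t.
have nt : `|t| <= C1 * `|w'|.
  rewrite (_ : w' = t *m (S *m Bi - a%:M)); first exact: C1P.
  by rewrite /w' /x mulmxBr mul_mx_scalar mulmxA.
have w'P : w' *m P = w' by rewrite /w' mulmxBl -scalemxAl xP tP.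
have qx : a ^+ 2 * dotp (t *m Qa) t + c1 * `|t| ^+ 2 <= dotp (x *m Qa) x.
  (* With [w' = x - a t], the operator identity becomes a sum of two forms at [w']: the [S] part is
     nonnegative on tangent vectors, and the [B] part controls [|t|^2] since [a] is not an
     eigenvalue. *)
  have h1 : dotp (x *m Qa) x = a ^+ 2 * dotp (t *m Qa) t +
      (dotp (w' *m S) w' + a * dotp (w' *m B) w').
    rewrite !qQa /w' !(mulmxBl, =^~ scalemxAl) !dotpE_simp.
    have -> : dotp (x *m S) t = dotp (x *m B) x by rewrite symS -xB.
    have -> : dotp (t *m S) x = dotp (x *m B) x by rewrite -xB.
    have -> : dotp (t *m S) t = dotp (x *m B) t by rewrite -xB.
    by rewrite (symB t x); ring.
  have h2 : 0 <= dotp (w' *m S) w' by rewrite qS//; exact: hS.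
  have h3 : a * (s * dotp w' w') <= a * dotp (w' *m B) w' by rewrite ler_pM2l.
  have h4 : c1 * `|t| ^+ 2 <= a * (s * dotp w' w').
    rewrite /c1 mulrAC ler_pdivrMr ?exprn_gt0// -!mulrA ler_pM2l// ler_pM2l//.
    apply: (@le_trans _ _ ((C1 * `|w'|) ^+ 2)); first by rewrite lerXn2r ?nnegrE// mulr_ge0// ltW.
    by rewrite exprMn mulrC ler_wpM2r ?norm_sqr_le_dotp// exprn_ge0// ltW.
  lra.
have q1E : dotp (v1 *m P *m Qa) (v1 *m P) =
    dotp (x *m Qa) x + 2 * dotp (x *m Qa) er + dotp (er *m Qa) er.
  have symQ : dotp (er *m Qa) x = dotp (x *m Qa) er by rewrite !qQa symS symB.
  rewrite (_ : v1 *m P = x + er); last by rewrite /er subrKC.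
  by clearbody er; rewrite mulmxDl !dotpE_simp symQ; ring.
have n1 : v1 - v1 *m P = (1 - alpha) *: n + alpha *: (w - p).
  by rewrite v1P /v1 /n; rowring.
(* Convexity of the square keeps the factor [1 - alpha] on the normal part; the lost share
   [alpha |n|^2], weighted by [K], is the gain used in [quadratic_margin]. *)
have nn1 : dotp (v1 - v1 *m P) (v1 - v1 *m P) <=
    (1 - alpha) * dotp n n + alpha * (d%:R * (e * `|v|) ^+ 2).
  have h1 : dotp (w - p) (w - p) <= d%:R * (e * `|v|) ^+ 2.
    rewrite (le_trans (dotp_le_norm_sqr _))// ler_wpM2l// lerXn2r ?nnegrE//.
    by rewrite mulr_ge0// ltW.
  have h2 : alpha * dotp (w - p) (w - p) <= alpha * (d%:R * (e * `|v|) ^+ 2).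
    by rewrite ler_pM2l.
  have h3 : 0 <= alpha * (1 - alpha) * dotp (n - (w - p)) (n - (w - p)).
    by rewrite mulr_ge0 ?dotp_ge0// mulr_ge0 ?subr_ge0 ?ltW.
  rewrite n1; move: (w - p) h2 h3 => z; clearbody n.
  rewrite !dotpE_simp (dotpC z n); lra.
rewrite !qQ q1E -/t -/n.
have X1 : `|dotp (x *m Qa) er| <= Kq * (Cx * `|t|) * (Ce * (e * `|v| + `|n|)).
  rewrite (le_trans (KqP _ _))//; apply: ler_pM => //; first by nonneg.
  by rewrite ler_wpM2l.
have X2 : `|dotp (er *m Qa) er| <= Kq * (Ce * (e * `|v| + `|n|)) * (Ce * (e * `|v| + `|n|)).
  rewrite (le_trans (KqP _ _))//; apply: ler_pM => //; first by nonneg.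
  by rewrite ler_wpM2l.
have vtn : `|v| <= `|t| + `|n| by rewrite {1}vE ler_normD.
have nn0 : `|n| ^+ 2 <= dotp n n by exact: norm_sqr_le_dotp.
have := marg `|t| `|n| (normr_ge0 _) (normr_ge0 _).
set tau := `|t| in qx X1 X2 vtn *; set V := `|v| in X1 X2 vtn nn1 *.
set M := `|n| in X1 X2 vtn nn0 *.
pose E := e * (tau + M) + M.
have tau0 : 0 <= tau by exact: normr_ge0.
have M0 : 0 <= M by exact: normr_ge0.
have V0 : 0 <= V by exact: normr_ge0.
have EV0 : 0 <= e * V + M by nonneg.
have EV : e * V + M <= E by rewrite /E lerD2r ler_pM2l.
have Y1 : Kq * (Cx * tau) * (Ce * (e * V + M)) <= Kq * Cx * Ce * (tau * E).
  rewrite (_ : Kq * (Cx * tau) * _ = Kq * Cx * Ce * (tau * (e * V + M))); last by ring.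
  rewrite ler_wpM2l//; first by nonneg.
  by rewrite ler_wpM2l.
have Y2 : Kq * (Ce * (e * V + M)) * (Ce * (e * V + M)) <= Kq * Ce ^+ 2 * E ^+ 2.
  rewrite (_ : Kq * _ * _ = Kq * Ce ^+ 2 * (e * V + M) ^+ 2); last by ring.
  rewrite ler_wpM2l//; first by nonneg.
  by rewrite lerXn2r ?nnegrE// (le_trans EV0).
have Y3 : (e * V) ^+ 2 <= e ^+ 2 * (tau + M) ^+ 2.
  by rewrite -exprMn lerXn2r ?nnegrE ?ler_pM2l//; nonneg.
have Y4 : K * alpha * d%:R * (e * V) ^+ 2 <= K * alpha * d%:R * (e ^+ 2 * (tau + M) ^+ 2).
  by rewrite ler_wpM2l//; nonneg.
have Z1 : 0 <= 2 * Kq * Cx * Ce * E ^+ 2 + Kq * Ce ^+ 2 * (tau * E).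
  by rewrite /E; nonneg.
have Z2 : K * dotp (v1 - v1 *m P) (v1 - v1 *m P) <=
    K * ((1 - alpha) * dotp n n + alpha * (d%:R * (e * V) ^+ 2)) by rewrite ler_pM2l.
have Z3 : K * alpha * M ^+ 2 <= K * alpha * dotp n n.
  by rewrite ler_pM2l// mulr_gt0.
have Z4 : 0 <= (a ^+ 2 - 1) * (K * dotp n n).
  rewrite mulr_ge0 ?mulr_ge0 ?dotp_ge0 ?(ltW K0)// subr_ge0 -(expr1n _ 2).
  by rewrite lerXn2r ?nnegrE// ltW.
move: X1 X2; rewrite !ler_norml => /andP[X1 _] /andP[X2 _].
rewrite -/E /C2.
move: (dotp (v1 - _) _) Z2 => nn Z2.
move: (dotp n n) Z2 Z3 Z4 nn0 nn1 => nn0' Z2 Z3 Z4 nn0 _.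
move: (dotp (x *m Qa) er) (dotp (er *m Qa) er) X1 X2 => A1 A2 X1 X2.
move: (dotp (x *m Qa) x) (dotp (t *m Qa) t) qx => A3 A4 qx.
lra.
Qed.

(** * Structure of the subdifferential at a strict saddle *)

Lemma gram_unitmx (R : realType) (d m : nat) (J : 'M[R]_(d, m)) :
  \rank J = m -> J^T *m J \in unitmx.
Proof.
move=> rJ; rewrite -row_free_unit -kermx_eq0; apply/rowV0P => w /sub_kermxP wJ.
have wJT : w *m J^T = 0.
  apply/eqP; rewrite -normr_le0.
  have : dotp (w *m J^T) (w *m J^T) = 0.
    have -> : dotp (w *m J^T) (w *m J^T) = dotp (w *m (J^T *m J)) w.
      by rewrite mulmxA [RHS]dotp_mull.
    by rewrite wJ dotp0l.
  move=> h; have := norm_sqr_le_dotp (w *m J^T); rewrite h.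
  by rewrite exprn_even_le0//= => /eqP->.
have : row_free J^T by rewrite /row_free mxrank_tr rJ.
by rewrite -kermx_eq0 => /rowV0P; apply; apply/sub_kermxP.
Qed.

(** [P] is the orthogonal projector onto the tangent space [u *m J = 0]; its symmetry comes from
    taking the pseudo-inverse [(J^T J)^-1 J^T] as left inverse. *)
Lemma tangent_projector (R : realType) (d m : nat) (J : 'M[R]_(d, m)) :
  \rank J = m -> exists (Kt : 'M[R]_(m, d)) (P : 'M[R]_d),
    [/\ Kt *m J = 1%:M, P = 1%:M - J *m Kt, P^T = P, P *m P = P & J^T *m P = 0].
Proof.
move=> /gram_unitmx uJ; pose Kt := invmx (J^T *m J) *m J^T.
have KJ : Kt *m J = 1%:M by rewrite /Kt -mulmxA mulVmx.
have PJ : (1%:M - J *m Kt) *m J = 0.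
  by rewrite mulmxBl mul1mx -mulmxA KJ mulmx1 subrr.
exists Kt, (1%:M - J *m Kt); split => //.
- rewrite linearB/= trmx1 trmx_mul /Kt trmx_mul trmxK trmx_inv trmx_mul trmxK.
  by rewrite -!mulmxA.
- by rewrite mulmxBr mulmx1 [X in _ - X]mulmxA PJ mul0mx subr0.
- rewrite mulmxBr mulmx1 /Kt mulmxA mulmxA mulmxV// mul1mx subrr//.
Qed.

(** As [c < c / 2], the lower limit yields, in every neighbourhood, a quotient below [c / 2]. Its
    being below [+oo] places the point on [M], and multiplying by [t^2 / 2] gives [c / 4]. *)
Lemma d2_negative_points (R : realType) (d : nat) (f : 'rV[R]_d -> \bar R)
    (M : set 'rV[R]_d) (x0 u : 'rV[R]_d) (c F0 : R) :
  M x0 -> f x0 = F0%:E -> is_d2 f M x0 u c -> c < 0 ->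
  exists w : 'rV[R]_d, forall tau, 0 < tau -> exists (t : R) (w' : 'rV[R]_d),
    [/\ 0 < t < tau, `|w' - w| < 1, M (x0 + t *: u + (2^-1 * t ^+ 2) *: w') &
     forall Fp : R, f (x0 + t *: u + (2^-1 * t ^+ 2) *: w') = Fp%:E ->
       Fp - F0 <= c / 4 * t ^+ 2].
Proof.
move=> Mx0 fx0 [w d2] c0; exists w => tau tau0.
pose V := [set z : R * 'rV[R]_d | 0 < z.1 < tau /\ `|z.2 - w| < 1].
have FV : filter_prod (0 : R)^'+ (nbhs w) V.
  exists ([set t | 0 < t < tau], [set w' | `|w' - w| < 1]) => //=.
  split; last by apply/nbhs_normE; exists 1.
  apply/nbhs_ballP; exists tau => //= t; rewrite /ball/= sub0r normrN => tt t0.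
  by rewrite t0 -[t]gtr0_norm.
move: d2; rewrite /parabolic_subderivative /limf_einf.
set phi := (X in limf_esup (\- X)%E) => /eqP; rewrite eqe_oppLR => /eqP d2.
have : ((- (c / 2))%:E < ereal_sup ((\- phi)%E @` V))%E.
  apply: (@lt_le_trans _ _ (- c%:E)%E); first by rewrite -EFinN lte_fin; lra.
  by rewrite -d2; apply: ereal_inf_lbound; exists V.
move=> /ereal_sup_gt[_ [[t w'] [/= t0 ww'] <-]].
rewrite EFinN lteNl oppeK /phi/= => h; exists t, w'.
have /andP[tp tt] := t0.
have q0 : 0 < (2^-1 * t ^+ 2)^-1 by rewrite invr_gt0 mulr_gt0 ?invr_gt0 ?exprn_gt0.
move: h; rewrite /restrict_to (mem_set Mx0) fx0; case: ifPn => [|_]; last first.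
  by rewrite addye// gt0_mulye// ?lte_fin// ltNge leey.
rewrite inE => Mp h; split => // Fp fp; move: h; rewrite fp -EFinD -EFinM lte_fin.
rewrite ltr_pdivrMr ?mulr_gt0 ?invr_gt0 ?exprn_gt0//; lra.
Qed.

(** On the level set [F] may be replaced by the Lagrangian [L], whose gradient vanishes at [x0]; the
    parabolic correction [w'] then drops out at order [t^2] and only [dotp (u *m H) u] survives. The
    constraint itself, divided by [t], gives tangency of [u]. *)
Lemma hessian_negative (R : realType) (d m : nat) (F : 'rV[R]_d -> R)
    (G : 'rV[R]_d -> 'rV[R]_m) (L : 'rV[R]_d -> R) (x0 u w : 'rV[R]_d)
    (J0 : 'M[R]_(d, m)) (H : 'M[R]_d) (c : R) :
  (forall e : R, 0 < e ->
    near2 x0 (fun x y => `|G x - G y - (x - y) *m J0| <= e * `|x - y|)) ->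
  (forall y, differentiable (L : 'rV[R]_d -> R^o) y) ->
  strict_hessian L x0 H -> grad L x0 = 0 -> G x0 = 0 ->
  (forall p, G p = 0 -> L p = F p) -> c < 0 ->
  (forall tau, 0 < tau -> exists (t : R) (w' : 'rV[R]_d),
    [/\ 0 < t < tau, `|w' - w| < 1, G (x0 + t *: u + (2^-1 * t ^+ 2) *: w') = 0 &
     F (x0 + t *: u + (2^-1 * t ^+ 2) *: w') - F x0 <= c / 4 * t ^+ 2]) ->
  u *m J0 = 0 /\ dotp (u *m H) u < 0.
Proof.
move=> sG dL sL gL0 Gx0 LF c0 pts.
pose W := `|u| + (`|w| + 1); have W0 : 0 < W by rewrite ltr_wpDl// ltr_wpDl.
have hW t w' : 0 < t <= 1 -> `|w' - w| < 1 ->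
    `|t *: u + (2^-1 * t ^+ 2) *: w'| <= t * W /\ `|w'| <= W.
  move=> /andP[t0 t1] ww'.
  have nw : `|w'| <= `|w| + 1.
    by rewrite -[w'](subrKC w) (le_trans (ler_normD _ _))// lerD2l ltW.
  split; last by rewrite (le_trans nw)// /W lerDr.
  rewrite (le_trans (ler_normD _ _))// (normrZ t) (normrZ (_ * _)) (gtr0_norm t0).
  rewrite /W mulrDr lerD2l.
  have t20 : 0 <= 2^-1 * t ^+ 2 by rewrite mulr_ge0 ?sqr_ge0.
  rewrite (ger0_norm t20) expr2.
  have h1 : t * `|w'| <= t * (`|w| + 1) by rewrite ler_pM2l.
  have h2 : t * (t * `|w'|) <= 1 * (t * `|w'|) by rewrite ler_wpM2r// mulr_ge0// ltW.
  have h3 : 0 <= t * (t * `|w'|) by rewrite !mulr_ge0// ltW.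
  lra.
split.
  apply/eqP; rewrite -normr_le0; apply/ler_addgt0Pr => e e0; rewrite add0r.
  have e1 : 0 < e / (2 * W) by rewrite divr_gt0// mulr_gt0.
  have [del del0 sGd] := sG _ e1.
  pose D := 1 + d%:R * W * `|J0|.
  have D0 : 0 < D by rewrite /D ltr_pwDl// !mulr_ge0// ltW.
  pose tau := Num.min 1 (Num.min (del / W) (e / 2 / D)).
  have tau0 : 0 < tau by rewrite !lt_min ltr01 !divr_gt0.
  have [t [w' [/andP[t0 tt] ww' Gp _]]] := pts _ tau0.
  move: tt; rewrite !lt_min => /andP[t1 /andP[td te]].
  have t01 : 0 < t <= 1 by rewrite t0 ltW.
  have [hh w'W] := hW t w' t01 ww'.
  set h := t *: u + _ in hh.
  have pE : x0 + t *: u + (2^-1 * t ^+ 2) *: w' = x0 + h by rewrite addrA.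
  rewrite pE in Gp.
  have px : `|x0 + h - x0| < del.
    by rewrite addrC addKr (le_lt_trans hh)// -ltr_pdivlMr.
  have xx : `|x0 - x0| < del by rewrite subrr normr0.
  have := sGd _ _ px xx; rewrite Gp Gx0 subrr sub0r normrN [x0 + h]addrC addrK => hJ.
  have uE : t *: (u *m J0) = h *m J0 - (2^-1 * t ^+ 2) *: (w' *m J0).
    by rewrite /h mulmxDl -!scalemxAl addrK.
  have b1 : `|h *m J0| <= e / 2 * t.
    apply: le_trans hJ _; apply: (@le_trans _ _ (e / (2 * W) * (t * W))).
      by rewrite ler_pM2l.
    by rewrite le_eqVlt; apply/orP; left; apply/eqP; field; rewrite gt_eqF.
  have b2 : `|(2^-1 * t ^+ 2) *: (w' *m J0)| <= t * (t * (d%:R * W * `|J0|)).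
    have t20 : 0 <= 2^-1 * t ^+ 2 by rewrite mulr_ge0 ?sqr_ge0.
    rewrite (normrZ (_ * _)) (ger0_norm t20) expr2.
    have n1 : `|w' *m J0| <= d%:R * W * `|J0|.
      by rewrite (le_trans (mulmx_norm _ _))// ler_wpM2r// ler_wpM2l.
    have n2 : t * (t * `|w' *m J0|) <= t * (t * (d%:R * W * `|J0|)).
      by rewrite !ler_pM2l.
    have n3 : 0 <= t * (t * `|w' *m J0|) by rewrite !mulr_ge0// ltW.
    lra.
  have b3 : t * (d%:R * W * `|J0|) <= e / 2.
    have : t * D <= e / 2 by rewrite -ler_pdivlMr// ltW.
    rewrite /D; lra.
  have : t * `|u *m J0| <= t * e.
    rewrite -{1}(gtr0_norm t0) -normrZ uE (le_trans (ler_normB _ _))//.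
    have : t * (t * (d%:R * W * `|J0|)) <= t * (e / 2) by rewrite ler_pM2l.
    lra.
  by rewrite ler_pM2l.
pose K := d%:R * (d%:R * `|H|) * W * W.
have K0 : 0 <= K by have W0' := ltW W0; rewrite /K; nonneg.
(* The Taylor remainder relative to [t^2] and the two terms involving [w'] each cost at most
   [- c / 16], which leaves [dotp (u *m H) u <= c / 4]. *)
pose e := - c / (16 * W ^+ 2).
have e0 : 0 < e by rewrite divr_gt0 ?oppr_gt0// mulr_gt0// exprn_gt0.
have eW : e * W ^+ 2 = - c / 16 by rewrite /e; field; rewrite gt_eqF.
have [del del0 tay] := taylor2 dL sL e0.
have c16 : 0 < - c / 16 by lra.
pose tau := Num.min 1 (Num.min (del / W) (- c / 16 / (1 + K))).
have tau0 : 0 < tau by rewrite !lt_min ltr01 !divr_gt0// ?ltr_pwDl//; lra.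
have [t [w' [/andP[t0 tt] ww' Gp Fp]]] := pts _ tau0.
move: tt; rewrite !lt_min => /andP[t1 /andP[td te]].
have t01 : 0 < t <= 1 by rewrite t0 ltW.
have [hh w'W] := hW t w' t01 ww'.
have uW : `|u| <= W by rewrite /W lerDl.
have Kt : K * t <= - c / 16 by apply: small_mul => //; exact: ltW.
move: hh Gp Fp; rewrite -addrA; set h := t *: u + _ => hh Gp Fp.
have hdel : `|h| < del by rewrite (le_lt_trans hh)// -ltr_pdivlMr.
have := tay h hdel; rewrite gL0 dotp0r subr0 (LF _ Gp) (LF _ Gx0).
rewrite ler_norml; set q := dotp _ h => /andP[tq _].
have qE : q = t ^+ 2 * (dotp (u *m H) u + 2^-1 * t * (dotp (u *m H) w' + dotp (w' *m H) u)
    + 4^-1 * t ^+ 2 * dotp (w' *m H) w').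
  by rewrite /q /h mulmxDl -!scalemxAl !dotpE_simp; field.
have bK a b : `|a| <= W -> `|b| <= W -> - K <= dotp (a *m H) b.
  move=> aW bW; have : `|dotp (a *m H) b| <= K.
    rewrite (le_trans (dotp_norm _ _))// /K.
    apply: ler_pM => //.
    rewrite -mulrA ler_wpM2l// (le_trans (mulmx_norm _ _))//.
    by rewrite mulrAC ler_wpM2l.
  by rewrite ler_norml => /andP[].
have k1 := bK _ _ uW w'W; have k2 := bK _ _ w'W uW; have k3 := bK _ _ w'W w'W.
have t2 : 0 < t ^+ 2 by rewrite exprn_gt0.
have h2 : `|h| ^+ 2 <= t ^+ 2 * W ^+ 2.
  by rewrite -exprMn lerXn2r ?nnegrE// mulr_ge0// ltW.
have eh : e * `|h| ^+ 2 <= t ^+ 2 * (- c / 16).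
  by rewrite -eW [leRHS]mulrCA ler_pM2l.
have qt : 2^-1 * q <= t ^+ 2 * (c / 4 - c / 16) by lra.
have {qt} : dotp (u *m H) u + 2^-1 * t * (dotp (u *m H) w' + dotp (w' *m H) u)
    + 4^-1 * t ^+ 2 * dotp (w' *m H) w' <= 2 * (c / 4 - c / 16).
  rewrite -(ler_pM2l t2) -qE; lra.
have m1 : - K * t <= 2^-1 * t * (dotp (u *m H) w' + dotp (w' *m H) u).
  have : t * (- K - K) <= t * (dotp (u *m H) w' + dotp (w' *m H) u).
    by rewrite ler_pM2l//; lra.
  lra.
have m2 : - K * t <= 4^-1 * t ^+ 2 * dotp (w' *m H) w'.
  have n1 : t ^+ 2 * - K <= t ^+ 2 * dotp (w' *m H) w' by rewrite ler_pM2l.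
  have n2 : K * t ^+ 2 <= K * t by rewrite ler_wpM2l// expr2 ler_piMl// ltW.
  have n3 : 0 <= K * t by rewrite mulr_ge0// ltW.
  lra.
lra.
Qed.

Lemma Cp_lagrangian (R : realType) (d m p : nat) (F : 'rV[R]_d -> R)
    (G : 'rV[R]_d -> 'rV[R]_m) (lam : 'rV[R]_m) :
  Cp p (F : 'rV[R]_d -> R^o) -> Cp p G ->
  Cp p (F + \sum_j (lam ord0 j \*: (fun x => G x ord0 j : R^o)) : 'rV[R]_d -> R^o).
Proof.
move=> cF cG; apply: Cp_add => //; apply: Cp_sum => j; apply: Cp_scale.
exact: Cp_coord.
Qed.

Lemma grad_lagrangian (R : realType) (d m : nat) (F : 'rV[R]_d -> R)
    (G : 'rV[R]_d -> 'rV[R]_m) (lam : 'rV[R]_m) (y : 'rV[R]_d) :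
  differentiable (F : 'rV[R]_d -> R^o) y -> differentiable G y ->
  (forall j, differentiable (fun x => G x ord0 j : R^o) y) ->
  grad (F + \sum_j (lam ord0 j \*: (fun x => G x ord0 j : R^o)) : 'rV[R]_d -> R^o) y =
    grad F y + lam *m ('J G y)^T.
Proof.
move=> dF dG dGj; apply/rowP => i.
have dZ j : derivable (lam ord0 j \*: (fun x => G x ord0 j : R^o)) y (delta_mx ord0 i).
  by apply: derivableZ; exact: diff_derivable.
rewrite mx_addE {1}/grad mxE deriveD; [|exact: diff_derivable|exact: derivable_sum].
congr (_ + _); first by rewrite /grad mxE.
rewrite derive_sum// mxE; apply: eq_bigr => j _.
rewrite deriveZ; last exact: diff_derivable.
rewrite [X in _ = _ * X]mxE; congr (_ * _).
by apply: etrans _ (esym (jacobianE i j dG)); rewrite /grad mxE.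
Qed.

(** Identification of the manifold: a small subgradient at a nearby point violates sharpness unless
    the point lies on [M]. There [f] is [F], and the subgradient inequality restricted to [G = 0] is
    the first-order condition of [normal_vector] for [grad F y - v]. *)
Lemma graph_at_saddle (R : realType) (d m : nat) (f : 'rV[R]_d -> \bar R)
    (M O : set 'rV[R]_d) (F : 'rV[R]_d -> R) (G : 'rV[R]_d -> 'rV[R]_m)
    (x0 : 'rV[R]_d) (e0 : R) :
  nbhs x0 O -> Cp 2 (F : 'rV[R]_d -> R^o) -> Cp 2 G -> \rank ('J G x0) = m ->
  M x0 -> (forall y, O y -> M y <-> G y = 0) ->
  (forall y, O y -> M y -> f y = (F y)%:E) -> 0 < e0 ->
  (forall y v, O y -> subdiff f y v -> enorm v < e0 -> M y) ->
  exists2 del : R, 0 < del & forall y v, `|y - x0| < del -> `|v| < del ->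
    subdiff f y v -> G y = 0 /\ exists lam, v = grad F y + lam *m ('J G y)^T.
Proof.
move=> nO cF cG rG Mx0 MG fF e00 sharp.
have [dO dO0 O_in] := (nbhs_normE _ _).1 nO.
have [Kt [P [KJ PE PT PP JP]]] := tangent_projector rG.
have sG z (e : R) : 0 < e ->
    near2 z (fun x y => `|G x - G y - (x - y) *m 'J G z| <= e * `|x - y|).
  by move=> ep; exact: strict_diff_mx (CpW cG) ep.
have [dN dN0 normal] := normal_vector (J := fun y => 'J G y) sG KJ.
(* [D] converts sup norms into the Euclidean norms of sharpness and of the subdifferential. *)
pose D : R := d.+1%:R; have D0 : 0 < D by rewrite /D ltr0n.
exists (Num.min (dO / 2) (Num.min dN (e0 / D))).
  by rewrite !lt_min dN0 !divr_gt0.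
move=> y v; rewrite !lt_min => /and3P[yO yN _] /and3P[_ _ vE] sv.
have dO2 : 0 < dO / 2 by rewrite divr_gt0.
have Oy : O y by apply: O_in; rewrite (lt_trans yO)// ltr_pdivrMr// ltr_pMr// ltr1n.
have My : M y.
  apply: (sharp y v Oy sv); apply: le_lt_trans (enorm_le_norm v) _.
  apply: (@le_lt_trans _ _ (D * `|v|)); first by rewrite ler_wpM2r// /D ler_nat.
  by rewrite mulrC -ltr_pdivlMr.
have Gy : G y = 0 by apply/MG.
split => //.
suff [lam lamE] : exists lam, grad F y - v = lam *m ('J G y)^T.
  by exists (- lam); rewrite mulNmx -lamE opprB subrKC.
apply: normal => // e ep.
have e2 : 0 < e / 2 by rewrite divr_gt0.
have [d1 d10 Fd] := strict_diff y (CpW cF) e2.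
have e3 : 0 < e / (2 * D) by rewrite divr_gt0// mulr_gt0.
have [d2 d20 sd] := (nbhs_normE _ _).1 (sv.2 _ e3).
exists (Num.min (dO / 2) (Num.min d1 d2)); first by rewrite !lt_min dO2 d10.
move=> x; rewrite !lt_min => /and3P[xO x1 x2] Gx.
have Ox : O x.
  apply: O_in; rewrite -[x](subrK y) -addrA (le_lt_trans (ler_normD _ _))//.
  rewrite (splitr dO) ltrD//.
have Mx : M x by apply/MG.
have := sd x x2; rewrite (fF y Oy My) (fF x Ox Mx) -EFinD lee_fin.
have yy : `|y - y| < d1 by rewrite subrr normr0.
have := Fd x y x1 yy; rewrite ler_norml => /andP[_ h1] h2.
have h3 : e / (2 * D) * enorm (x - y) <= e / 2 * `|x - y|.
  apply: (@le_trans _ _ (e / (2 * D) * (D * `|x - y|))).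
    rewrite ler_pM2l// (le_trans (enorm_le_norm _))// ler_wpM2r// /D ler_nat//.
  by rewrite le_eqVlt; apply/orP; left; apply/eqP; field; rewrite gt_eqF.
have -> : dotp (x - y) (grad F y - v) = dotp (x - y) (grad F y) - dotp v (x - y).
  by rewrite dotpBr (dotpC v).
move: h1 h2 h3; move: (dotp _ _) (dotp _ _) (_ * enorm _) (F x) (F y) => a1 a2 a3 a4 a5.
lra.
Qed.

(** Distils what the dynamics uses of a strict saddle: [H] is the strict derivative of the
    subdifferential modulo normal vectors, and chords of the manifold are tangent up to a small
    relative error. *)
Lemma saddle_structure (R : realType) (d : nat) (f : 'rV[R]_d -> \bar R)
    (x0 : 'rV[R]_d) : strict_saddle f x0 ->
  exists (P H : 'M[R]_d) (u : 'rV[R]_d),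
    [/\ P^T = P, P *m P = P, H^T = H, u *m P = u & dotp (u *m H) u < 0] /\
    forall e : R, 0 < e -> exists2 del : R, 0 < del & forall y1 y2 v1 v2,
      `|y1 - x0| < del -> `|y2 - x0| < del -> `|v1| < del -> `|v2| < del ->
      subdiff f y1 v1 -> subdiff f y2 v2 ->
      `|((v1 - v2) - (y1 - y2) *m H) *m P| <= e * (`|y1 - y2| + `|v1 - v2|) /\
      `|(y1 - y2) - (y1 - y2) *m P| <= e * `|y1 - y2|.
Proof.
move=> [crit [M [[Mx0 [U [nU smM smf sharp]]] [u [c [_ d2 c0]]]]]].
have Ux0 := nbhs_singleton nU.
have [k mfd] := smM; have [_ kd [U' [G [oU' cG rG MG]]]] := mfd x0 (conj Mx0 Ux0).
have [V [F [oV cF fF]]] := smf x0 (conj Mx0 Ux0).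
pose m := (d - k)%N; rewrite -/m in G cG rG MG.
have nU' : nbhs x0 U' by exact: open_nbhs_nbhs.
have nV : nbhs x0 V by exact: open_nbhs_nbhs.
pose O := U `&` (U' `&` V).
have nO : nbhs x0 O by apply: filterI => //; exact: filterI.
have MGO y : O y -> M y <-> G y = 0.
  move=> [Uy [U'y Vy]]; have := congr1 (fun A => A y) MG => /= E; split.
    move=> My; have : (M `&` U `&` U') y by [].
    by rewrite MG => -[].
  move=> Gy; have : [set y | U' y /\ G y = 0] y by [].
  by rewrite -MG => -[[]].
have fFO y : O y -> M y -> f y = (F y)%:E.
  by move=> [Uy [U'y Vy]] My; apply: fF.
have Ox0 : O x0 by exact: nbhs_singleton.
have Gx0 : G x0 = 0 by apply/MGO.
have fx0 : f x0 = (F x0)%:E by exact: fFO.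
have [e0 e00 sharpO] : exists2 e0 : R, 0 < e0 &
    forall y v, O y -> subdiff f y v -> enorm v < e0 -> M y.
  set I := ereal_inf _ in sharp.
  (* The infimum may be [+oo], when no subgradient exists off [M]; any threshold then serves, here
     1. *)
  have [e0 e00 e0I] : exists2 e0 : R, 0 < e0 & (e0%:E <= I)%E.
    by case: I sharp => [r|_|//]; [rewrite lte_fin; exists r|exists 1 => //; exact: leey].
  exists e0 => // y v [Uy _] sv vE; apply: contrapT => nMy.
  have : (I <= (enorm v)%:E)%E.
    by apply: ereal_inf_lbound; exists v => //; exists y.
  by move=> /(le_trans e0I); rewrite lee_fin leNgt vE.
have dG y : differentiable G y := cG.1 y.
have [dl dl0 graph] := graph_at_saddle nO cF cG rG Mx0 MGO fFO e00 sharpO.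
have [Kt [P [KJ PE PT PP JP]]] := tangent_projector rG.
have sG z (e : R) : 0 < e ->
    near2 z (fun x y => `|G x - G y - (x - y) *m 'J G z| <= e * `|x - y|).
  by move=> ep; exact: strict_diff_mx (CpW cG) ep.
have [lam0 critL] : exists lam0, grad F x0 + lam0 *m ('J G x0)^T = 0.
  have [||_ [lam0 lamE]] := graph x0 0 _ _ crit; rewrite ?subrr ?normr0//.
  by exists lam0; rewrite -lamE.
pose L : 'rV[R]_d -> R :=
  (F + \sum_j (lam0 ord0 j \*: (fun x => G x ord0 j : R^o)) : 'rV[R]_d -> R^o).
have cL : Cp 2 (L : 'rV[R]_d -> R^o).
  exact: Cp_lagrangian.
have gL y : grad L y = grad F y + lam0 *m ('J G y)^T.
  apply: grad_lagrangian => //; first exact: cF.1.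
  by move=> j; have [+ _] := Cp_coord j cG; apply.
have [H sH HT] := C2_strict_hessian x0 cL.
have LF p : G p = 0 -> L p = F p.
  move=> Gp; rewrite /L /= fctE fct_sumE big1 ?addr0// => j _.
  by rewrite /= Gp mx_zeroE scaler0.
have [w pts] := d2_negative_points Mx0 fx0 d2 c0.
have [uJ uH] : u *m 'J G x0 = 0 /\ dotp (u *m H) u < 0.
  apply: (hessian_negative (F := F) (L := L) (w := w) (sG x0) cL.1 sH _ Gx0 LF c0).
    by rewrite gL.
  move=> tau tau0.
  have [dO dO0 O_in] := (nbhs_normE _ _).1 nO.
  pose W : R := `|u| + (`|w| + 1).
  have W0 : 0 < W by rewrite ltr_wpDl// ltr_wpDl.
  have tau1 : 0 < Num.min tau (Num.min 1 (dO / W)) by rewrite !lt_min tau0 ltr01 divr_gt0.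
  have [t [w' [/andP[t0 tt] ww' Mp Fp]]] := pts _ tau1.
  move: tt; rewrite !lt_min => /and3P[tt t1 tdO].
  set p := x0 + _ + _ in Mp Fp *.
  have Op : O p.
    apply: O_in; rewrite (_ : p - x0 = t *: u + (2^-1 * t ^+ 2) *: w'); last first.
      by rewrite /p; rowring.
    have nw : `|w'| <= `|w| + 1.
      by rewrite -[w'](subrKC w) (le_trans (ler_normD _ _))// lerD2l ltW.
    have t20 : 0 <= 2^-1 * t ^+ 2 by rewrite mulr_ge0 ?sqr_ge0.
    rewrite (le_lt_trans (ler_normD _ _))// (normrZ t) (normrZ (_ * _)) (gtr0_norm t0).
    rewrite (ger0_norm t20) expr2.
    have h0 : t * W < dO by rewrite -ltr_pdivlMr.
    have h1 : t * `|w'| <= t * (`|w| + 1) by rewrite ler_pM2l.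
    have h2 : t * (t * `|w'|) <= 1 * (t * `|w'|).
      by rewrite ler_wpM2r ?(ltW t1)// mulr_ge0// ltW.
    have h3 : 0 <= t * (t * `|w'|) by rewrite !mulr_ge0// ltW.
    by move: h0; rewrite /W; lra.
  exists t, w'; split => //; first by rewrite t0.
    by apply/MGO.
  by apply: Fp; exact: fFO.
exists P, H, u; split; first by split => //; rewrite PE mulmxBr mulmx1 mulmxA uJ mul0mx subr0.
have [CJ CJ0 lipJ] := jacobian_lip x0 cG.
have [HF sHF _] := C2_strict_hessian x0 cF.
have lipF := strict_hessian_lip sHF.
pose C := CJ + (1 + d%:R * `|HF|).
have HF0 : 0 <= d%:R * `|HF| by rewrite mulr_ge0.
have C0 : 0 < C by rewrite /C; lra.
have lipJ' : near2 x0 (fun x y => `|'J G x - 'J G y| <= C * `|x - y|).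
  case: lipJ => dd dd0 h; exists dd => // x y xd yd.
  by rewrite (le_trans (h x y xd yd))// ler_wpM2r// /C; lra.
have lipF' : near2 x0 (fun x y => `|grad F x - grad F y| <= C * `|x - y|).
  case: lipF => dd dd0 h; exists dd => // x y xd yd.
  by rewrite (le_trans (h x y xd yd))// ler_wpM2r// /C; lra.
have sL (e : R) : 0 < e -> near2 x0 (fun x y =>
    `|(grad F x + lam0 *m ('J G x)^T) - (grad F y + lam0 *m ('J G y)^T) - (x - y) *m H|
      <= e * `|x - y|).
  move=> /sH[dd dd0 h]; exists dd => // x y xd yd.
  by rewrite -!gL; exact: h.
move=> e ep.
have [d1 d10 tp] := normal_two_point (J := fun y => 'J G y) C0 lipJ' lipF' sL KJ critL JP ep.
have e'0 : 0 < e / (1 + m%:R * `|Kt|) by rewrite divr_gt0// ltr_pwDl// mulr_ge0.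
have [d2' d20 sGe] := sG x0 _ e'0.
exists (Num.min dl (Num.min d1 d2')); first by rewrite !lt_min dl0 d10.
move=> y1 y2 v1 v2; rewrite !lt_min => /and3P[y1l y11 y12] /and3P[y2l y21 y22].
move=> /and3P[v1l v11 _] /and3P[v2l v21 _] s1 s2.
have [G1 [lam1 v1E]] := graph _ _ y1l v1l s1.
have [G2 [lam2 v2E]] := graph _ _ y2l v2l s2.
split; first exact: tp v1E v2E.
(* Both points satisfy [G = 0], so strict differentiability bounds [(y1 - y2) *m 'J G x0], and the
   normal part of the chord is its image under [Kt]. *)
have := sGe _ _ y12 y22; rewrite G1 G2 subrr sub0r normrN => hJ.
rewrite PE mulmxBr mulmx1 subKr mulmxA (le_trans (mulmx_norm _ _))//.
apply: (@le_trans _ _ (m%:R * (e / (1 + m%:R * `|Kt|) * `|y1 - y2|) * `|Kt|)).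
  by rewrite ler_wpM2r// ler_wpM2l.
have K0 : 0 < 1 + m%:R * `|Kt| by rewrite ltr_pwDl// mulr_ge0.
rewrite [leLHS](_ : _ = (m%:R * `|Kt|) * (e / (1 + m%:R * `|Kt|)) * `|y1 - y2|); last by ring.
by rewrite ler_wpM2r//; apply: small_mul => //; rewrite mulr_ge0.
Qed.

(** * Quadratic forms inherited from Lipschitz and monotone maps *)

Lemma hessian_le_lipschitz (R : realType) (d : nat) (g : 'rV[R]_d -> R)
    (x0 : 'rV[R]_d) (Gm : 'M[R]_d) (beta : R) :
  (forall x y, enorm (grad g x - grad g y) <= beta * enorm (x - y)) ->
  strict_hessian g x0 Gm -> forall t, dotp (t *m Gm) t <= beta * dotp t t.
Proof.
move=> lip sG t; apply/ler_addgt0Pr => eta eta0.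
pose D := 1 + d%:R * `|t| * `|t|.
have D0 : 0 < D by rewrite /D ltr_pwDl// !mulr_ge0.
have e0 : 0 < eta / D by rewrite divr_gt0.
have [del del0 h] := sG _ e0.
pose a := del / (2 * (1 + `|t|)).
have t1 : 0 < 1 + `|t| by rewrite ltr_pwDl.
have a0 : 0 < a by rewrite divr_gt0// mulr_gt0.
have at_lt : `|x0 + a *: t - x0| < del.
  rewrite addrC addKr normrZ (gtr0_norm a0) /a mulrAC.
  by rewrite ltr_pdivrMr ?mulr_gt0// ltr_pM2l//; have := normr_ge0 t; lra.
have xx : `|x0 - x0| < del by rewrite subrr normr0.
have := h _ _ at_lt xx; have := lip (x0 + a *: t) x0.
rewrite [x0 + _]addrC addrK; set v := grad g _ - _ => lv.
rewrite -scalemxAl normrZ enormZ (gtr0_norm a0) in lv * => hv.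
have b1 : dotp v t <= beta * (a * dotp t t).
  rewrite (le_trans (cauchy_schwarz _ _))// -enorm_sqr.
  rewrite (_ : beta * _ = beta * (a * enorm t) * enorm t); last by ring.
  by rewrite ler_wpM2r ?enorm_ge0.
have b2 : - (d%:R * (eta / D * (a * `|t|)) * `|t|) <= dotp (v - a *: (t *m Gm)) t.
  rewrite lerNl (le_trans (ler_norm _))// normrN (le_trans (dotp_norm _ _))//.
  by rewrite ler_wpM2r// ler_wpM2l.
have b3 : eta / D * (d%:R * `|t| * `|t|) <= eta.
  by rewrite mulrAC ler_pdivrMr// ler_pM2l// /D lerDr.
have b4 : a * (eta / D * (d%:R * `|t| * `|t|)) <= a * eta by rewrite ler_pM2l.
rewrite -(ler_pM2l a0); move: b2; rewrite dotpBl dotpZl; lra.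
Qed.

(* eta plays the role of (prox (z0 + h w) - prox z0) / h for small h. *)
Lemma posdef_of_tangent_prox (R : realType) (d : nat) (P B N : 'M[R]_d) (s : R) :
  P^T = P -> P *m P = P -> B^T = B -> B *m P = P *m B ->
  (forall n : 'rV[R]_d, n *m P = 0 -> n *m B = n) ->
  (forall t : 'rV[R]_d, t *m P = t -> t *m B = t *m N) ->
  0 < s <= 1 ->
  (forall (w : 'rV[R]_d) (e : R), w *m P = w -> 0 < e -> exists eta : 'rV[R]_d,
    [/\ `|eta *m N - w| <= e, `|eta - eta *m P| <= e &
        s * dotp eta eta <= dotp w eta]) ->
  forall v, s * dotp v v <= dotp (v *m B) v.
Proof.
move=> PT PP BT BP nB tB /andP[s0 s1] approx.
pose C1 := 1 + d%:R * `|N|; have C10 : 0 < C1 by rewrite ltr_pwDl// mulr_ge0.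
have apB (w : 'rV[R]_d) (e : R) : w *m P = w -> 0 < e -> exists eta p : 'rV[R]_d,
    [/\ `|p *m B - w| <= C1 * e, `|eta - p| <= e & s * dotp eta eta <= dotp w eta].
  move=> wP e0; have [eta [h1 h2 h3]] := approx w e wP e0.
  exists eta, (eta *m P); split => //.
  rewrite tB; last by rewrite -mulmxA PP.
  have -> : eta *m P *m N - w = (eta *m N - w) - (eta - eta *m P) *m N.
    by rewrite mulmxBl; rowring.
  rewrite (le_trans (ler_normB _ _))// /C1 mulrDl mul1r lerD//.
  by rewrite (le_trans (mulmx_norm _ _))// mulrAC ler_wpM2l// mulr_ge0.
(* A kernel vector [v] is tangent, since [B] fixes normal vectors, and orthogonal to the range of
   the symmetric [B]. As tangent vectors are limits of vectors [p *m B], [v] is orthogonal to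
   itself. *)
have uB : B \in unitmx.
  rewrite -row_free_unit -kermx_eq0; apply/rowV0P => v /sub_kermxP vB.
  have PB0 : v *m P *m B = 0 by rewrite -mulmxA -BP mulmxA vB mul0mx.
  have n0 : (v - v *m P) *m P = 0 by rewrite mulmxBl -mulmxA PP subrr.
  have vP : v *m P = v.
    have := nB _ n0; rewrite mulmxBl vB PB0 subrr => /esym/eqP.
    by rewrite subr_eq0 => /eqP.
  apply/eqP; rewrite -normr_le0.
  suff : dotp v v <= 0.
    move=> h; have := le_trans (norm_sqr_le_dotp v) h.
    by rewrite exprn_even_le0//= => /eqP->.
  apply/ler_addgt0Pr => e e0; rewrite add0r.
  pose D := d%:R * C1 * `|v|.
  have D0 : 0 <= D by have C1' := ltW C10; rewrite /D; nonneg.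
  have e1 : 0 < e / (1 + D) by rewrite divr_gt0// ltr_pwDl.
  have [eta [p [h1 _ _]]] := apB v _ vP e1.
  have -> : dotp v v = - dotp (p *m B - v) v.
    by rewrite dotpBl dotp_mull BT vB dotp0r sub0r opprK.
  rewrite (le_trans (ler_norm _))// normrN (le_trans (dotp_norm _ _))//.
  apply: (@le_trans _ _ (D * (e / (1 + D)))); last exact: small_mul.
  rewrite /D [leRHS](_ : _ = d%:R * (C1 * (e / (1 + d%:R * C1 * `|v|))) * `|v|); last by ring.
  by rewrite ler_wpM2r// ler_wpM2l.
have [C2 C20 C2P] := unit_mx_lower_bound uB.
(* For [w = t *m B] the approximate solutions [eta] tend to [t], and the inequality
   [s * dotp eta eta <= dotp w eta] passes to the limit. *)
have posT (t : 'rV[R]_d) : t *m P = t -> s * dotp t t <= dotp (t *m B) t.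
  move=> tP; apply/ler_addgt0Pr => e e0.
  set w := t *m B.
  have wP : w *m P = w by rewrite /w -mulmxA BP mulmxA tP.
  pose C3 := 1 + C2 * C1.
  have C30 : 0 <= C3 by rewrite /C3; nonneg.
  pose D := d%:R * `|w| * C3 + 2 * (s * (d%:R * `|t| * C3)).
  have D0 : 0 <= D by rewrite /D; nonneg.
  have e1 : 0 < e / (1 + D) by rewrite divr_gt0// ltr_pwDl.
  have [eta [p [h1 h2 h3]]] := apB w _ wP e1.
  have eD : D * (e / (1 + D)) <= e by exact: small_mul.
  move: (e / (1 + D)) e1 h1 h2 eD => e' e'0 h1 h2 eD.
  have pt : `|p - t| <= C2 * (C1 * e').
    by rewrite (le_trans (C2P _))// ler_pM2l// mulmxBl.
  pose z := eta - t.
  have nz : `|z| <= C3 * e'.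
    rewrite (_ : z = (eta - p) + (p - t)); last by rewrite /z; rowring.
    by rewrite (le_trans (ler_normD _ _))// /C3 mulrDl mul1r lerD// -mulrA.
  move: h3; rewrite (_ : eta = t + z); last by rewrite /z subrKC.
  clearbody z; rewrite !dotpE_simp (dotpC z t) => h3.
  have b1 : dotp w z <= d%:R * `|w| * C3 * e'.
    rewrite (le_trans (ler_norm _))// (le_trans (dotp_norm _ _))// -[leRHS]mulrA.
    by rewrite ler_wpM2l// mulr_ge0.
  have b2 : s * - dotp t z <= s * (d%:R * `|t| * C3 * e').
    rewrite ler_pM2l// (le_trans (ler_norm _))// normrN (le_trans (dotp_norm _ _))//.
    by rewrite -[leRHS]mulrA ler_wpM2l// mulr_ge0.
  have b3 : 0 <= s * dotp z z by rewrite mulr_ge0 ?dotp_ge0// ltW.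
  move: eD; rewrite /D; lra.
move=> v; set t := v *m P; pose n := v - t.
have tP : t *m P = t by rewrite /t -mulmxA PP.
have nP : n *m P = 0 by rewrite /n mulmxBl tP subrr.
have vE : v = t + n by rewrite /n subrKC.
have tn (a : 'rV[R]_d) : dotp n (a *m P) = 0.
  by rewrite dotpC dotp_mull PT nP dotp0r.
have tn0 : dotp n t = 0 by exact: tn.
have tBn : dotp (t *m B) n = 0.
  by rewrite dotpC -[t]tP -mulmxA -BP mulmxA tn.
rewrite vE mulmxDl (nB _ nP); clearbody n.
rewrite !dotpE_simp tBn (dotpC t n) tn0.
have := posT t tP; have : s * dotp n n <= 1 * dotp n n by rewrite ler_wpM2r ?dotp_ge0.
lra.
Qed.

(** * The proximal gradient step *)

Lemma damped_sub (R : realType) (d : nat) (a : R) (x y p q : 'rV[R]_d) :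
  ((1 - a) *: x + a *: p) - ((1 - a) *: y + a *: q) =
  (1 - a) *: (x - y) + a *: (p - q).
Proof. by rowring. Qed.

Lemma damped_split (R : realType) (d : nat) (a m : R) (x y p q b c : 'rV[R]_d) :
  x - y = ((1 - a) *: (x - y) + a *: (p - q)) +
    a *: (((x - m *: b - p) - (y - m *: c - q)) + m *: (b - c)).
Proof. by rowring. Qed.

Section prox_gradient.
Context (R : realType) (d : nat) (g : 'rV[R]_d -> R) (r : 'rV[R]_d -> \bar R)
  (beta rho mu alpha : R).
Hypothesis g_C2 : Cp 2 (g : 'rV[R]_d -> R^o).
Hypothesis beta_ge0 : 0 <= beta.
Hypothesis grad_lip : forall x y,
  enorm (grad g x - grad g y) <= beta * enorm (x - y).
Hypothesis r_gtNy : forall x, r x <> -oo%E.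
Hypothesis r_proper : exists x, r x <> +oo%E.
Hypothesis r_closed : closed_fun r.
Hypothesis rho_gt0 : 0 < rho.
Hypothesis r_wconvex : rho_weakly_convex rho r.
Hypothesis f_bounded_below : exists m : R, forall x, (m%:E <= composite g r x)%E.
Hypothesis mu_range : 0 < mu < rho^-1.
Hypothesis alpha_range : 0 < alpha < 1.
Hypothesis alpha_small : alpha * (mu * beta +
  (1 + mu * beta) * Num.max 1 (mu * rho / (1 - mu * rho))) < 1.

Let T := prox_gradient_step mu alpha g r.
Let f := composite g r.
Let zed (x : 'rV[R]_d) : 'rV[R]_d := x - mu *: grad g x.

Lemma step_sub x y : T x - T y =
  (1 - alpha) *: (x - y) + alpha *: (prox mu r (zed x) - prox mu r (zed y)).
Proof. exact: damped_sub. Qed.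

(** Supplies the local lower bound assumed for the proximal map: [r = f - g], where [f] is bounded
    below and [g] is bounded above on unit balls by the mean value theorem. *)
Lemma r_locally_bounded (x0 : 'rV[R]_d) : exists B : R,
  forall y, `|y - x0| <= 1 -> (B%:E <= r y)%E.
Proof.
have [m fm] := f_bounded_below.
pose Kg := d%:R * (`|grad g x0| + beta * d%:R).
exists (m - g x0 - Kg) => y yx.
have gy : g y <= g x0 + Kg.
  have [t /andP[t0 t1]] := mean_value x0 (y - x0) g_C2.1; rewrite subrKC => gE.
  rewrite -lerBlDl gE (le_trans (ler_norm _))// (le_trans (dotp_norm _ _))//.
  rewrite /Kg -mulrA ler_wpM2l// -[leRHS]mul1r ler_pM//.
  set p := x0 + _; rewrite -[grad g p](subrKC (grad g x0)).
  rewrite (le_trans (ler_normD _ _))// lerD2l (le_trans (norm_le_enorm _))//.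
  rewrite (le_trans (grad_lip _ _))// ler_wpM2l// (le_trans (enorm_le_norm _))//.
  rewrite -[leRHS]mulr1 ler_wpM2l// /p addrC addKr normrZ (ger0_norm t0).
  by rewrite -[leRHS]mulr1 ler_pM.
have := fm y; rewrite /composite; have := @r_gtNy y.
case: (r y) => [c _|_ _|//]; last by rewrite leey.
rewrite -EFinD !lee_fin; lra.
Qed.

Let B := r_locally_bounded.
Let m0 : 0 < mu := mu_gt0 mu_range.

Lemma zed_lipschitz x y : enorm (zed x - zed y) <= (1 + mu * beta) * enorm (x - y).
Proof.
rewrite (_ : zed x - zed y = (x - y) - mu *: (grad g x - grad g y)); last first.
  by rewrite /zed; rowring.
rewrite (le_trans (enormD _ _))// mulrDl mul1r lerD2l enormN enormZ (gtr0_norm m0).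
by rewrite -mulrA ler_pM2l.
Qed.

(* T - id is alpha * L-Lipschitz, with alpha * L < 1. *)
Lemma step_expansive : exists2 c : R, 0 < c &
  forall x y, c * enorm (x - y) <= enorm (T x - T y).
Proof.
move: alpha_small; set M := Num.max _ _ => aM.
have /andP[a0 a1] := alpha_range.
exists (1 - alpha * (mu * beta + (1 + mu * beta) * M)); first by rewrite subr_gt0.
move=> x y.
pose u := (zed x - prox mu r (zed x)) - (zed y - prox mu r (zed y)).
have uM : enorm u <= M * ((1 + mu * beta) * enorm (x - y)).
  rewrite (le_trans (sub_prox_lipschitz r_gtNy r_proper r_closed rho_gt0 r_wconvex mu_range
    B _ _))//.
  by rewrite ler_wpM2l ?zed_lipschitz// le_max ler01.
pose w := u + mu *: (grad g x - grad g y).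
have wM : enorm w <= (mu * beta + (1 + mu * beta) * M) * enorm (x - y).
  rewrite (le_trans (enormD _ _))// mulrDl addrC lerD//.
    by rewrite enormZ (gtr0_norm m0) -mulrA ler_pM2l.
  by rewrite (le_trans uM)// mulrA [M * _]mulrC.
have xyE : x - y = (T x - T y) + alpha *: w.
  by rewrite step_sub; exact: damped_split.
have : enorm (x - y) <= enorm (T x - T y) + alpha * enorm w.
  by rewrite {1}xyE (le_trans (enormD _ _))// enormZ (gtr0_norm a0).
have : alpha * enorm w <= alpha * ((mu * beta + (1 + mu * beta) * M) * enorm (x - y)).
  by rewrite ler_pM2l.
lra.
Qed.

Lemma prox_zed_lipschitz : exists2 C : R, 0 < C & forall x y,
  enorm (prox mu r (zed x) - prox mu r (zed y)) <= C * enorm (x - y).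
Proof.
have s0 : 0 < 1 - mu * rho by rewrite subr_gt0 (murho_lt1 rho_gt0).
exists ((1 - mu * rho)^-1 * (1 + mu * beta)).
  by rewrite mulr_gt0 ?invr_gt0// ltr_pwDl// mulr_ge0// ltW.
move=> x y; rewrite -mulrA ler_pdivlMl//.
have := prox_lipschitz r_gtNy r_proper r_closed rho_gt0 r_wconvex mu_range B (zed x) (zed y).
by move=> /le_trans; apply; exact: zed_lipschitz.
Qed.

Lemma step_lipschitz : exists2 C : R, 0 < C &
  forall x y, enorm (T x - T y) <= C * enorm (x - y).
Proof.
have [C C0 pC] := prox_zed_lipschitz.
have /andP[a0 a1] := alpha_range; have a1' : 0 < 1 - alpha by rewrite subr_gt0.
exists (1 - alpha + alpha * C) => [|x y]; first by rewrite addr_gt0// mulr_gt0.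
rewrite step_sub (le_trans (enormD _ _))// !enormZ (gtr0_norm a0) (gtr0_norm a1') [leRHS]mulrDl.
by rewrite lerD2l -mulrA ler_pM2l.
Qed.

Lemma limit_fixed x0 l : (fun k => iter k T x0) @ \oo --> l -> T l = l.
Proof.
move=> xl; have [C C0 TC] := step_lipschitz.
apply/eqP; rewrite -subr_eq0 -normr_le0; apply/ler_addgt0Pr => e e0; rewrite add0r.
pose D : R := 1 + C * d%:R; have D0 : 0 < D by rewrite ltr_pwDl// mulr_ge0// ltW.
have e'0 : 0 < e / D by rewrite divr_gt0.
have /cvgrPdist_lt/(_ _ e'0)[N _ NP] := xl.
have h1 := NP N (leqnn N); have h2 := NP N.+1 (leqnSn N); rewrite /= in h1 h2.
have -> : T l - l = (T l - T (iter N T x0)) - (l - T (iter N T x0)).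
  by rewrite opprB addrA subrK.
rewrite (le_trans (ler_normB _ _))//.
have h3 : `|T l - T (iter N T x0)| <= C * (d%:R * `|l - iter N T x0|).
  rewrite (le_trans (norm_le_enorm _))// (le_trans (TC _ _))// ler_pM2l//.
  exact: enorm_le_norm.
have h4 : C * (d%:R * `|l - iter N T x0|) <= C * (d%:R * (e / D)).
  by rewrite ler_pM2l// ler_wpM2l// ltW.
have -> : e = C * (d%:R * (e / D)) + e / D.
  by rewrite /D; field; rewrite gt_eqF.
by rewrite lerD// ?(le_trans h3)// ltW.
Qed.

Lemma fixed_prox l : T l = l -> prox mu r (zed l) = l.
Proof.
have /andP[a0 a1] := alpha_range.
move=> Tl; have : alpha *: prox mu r (zed l) = alpha *: l.
  move: Tl; rewrite /T /prox_gradient_step -/(zed l); move: (prox _ _ _) => p Tl.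
  by apply: (addrI ((1 - alpha) *: l)); rewrite Tl; rowring.
by move/(scalerI (negbT (gt_eqF a0))).
Qed.

(** Holds at every [z], not only at fixed points: this parametrizes the part of the graph of the
    subdifferential that the iteration visits. *)
Lemma prox_subdiff z :
  subdiff f (prox mu r z) (mu^-1 *: (z - prox mu r z) + grad g (prox mu r z)).
Proof.
set y := prox mu r z.
have [c yc] := prox_fin r_gtNy r_proper r_closed rho_gt0 r_wconvex mu_range B z.
rewrite -/y in yc; split; first by rewrite /f /composite yc.
move=> e e0; have e20 : 0 < e / 2 by rewrite divr_gt0.
have [d1 d10 gd] := strict_diff y (CpW g_C2) e20.
(* Within this radius the weak-convexity defect [rho / 2 |x - y|^2] is absorbed into
   [e / 2 |x - y|]. *)
pose d2 := e / (rho * d.+1%:R).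
have d20 : 0 < d2 by rewrite divr_gt0// mulr_gt0.
apply/nbhs_normE; exists (Num.min d1 d2); first by rewrite lt_min d10.
move=> x; rewrite lt_min => /andP[xd1 xd2].
rewrite /f /composite yc; have := @r_gtNy x.
case E: (r x) => [a|//|//] _; last by rewrite addey// leey.
rewrite -!EFinD lee_fin.
have := prox_subgradient r_gtNy r_proper r_closed rho_gt0 r_wconvex mu_range B yc E.
have := gd x y xd1; rewrite subrr normr0 => /(_ d10).
rewrite -/y [dotp (_ + grad g y) _]dotpDl dotpZl ler_norml => /andP[h1 _].
rewrite (dotpC (grad g y)).
have h2 : rho / 2 * dotp (x - y) (x - y) <= e / 2 * enorm (x - y).
  rewrite -enorm_sqr expr2 mulrA ler_wpM2r ?enorm_ge0// mulrAC ler_pM2r//.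
  rewrite -ler_pdivlMl// (le_trans (enorm_le_norm _))//.
  apply: (@le_trans _ _ (d.+1%:R * d2)).
    by rewrite ler_pM// ?ler_nat// ltW.
  rewrite le_eqVlt; apply/orP; left; apply/eqP; rewrite /d2.
  by move: (d.+1%:R) (ltr0Sn R d) => n n0; field; rewrite !gt_eqF.
have h3 : e / 2 * `|x - y| <= e / 2 * enorm (x - y) by rewrite ler_pM2l// norm_le_enorm.
lra.
Qed.

Lemma fixed_critical l : T l = l -> critical f l.
Proof.
move=> /fixed_prox pl; have := prox_subdiff (zed l); rewrite pl /critical.
suff -> : mu^-1 *: (zed l - l) + grad g l = 0 by [].
by apply/rowP => i; rewrite /zed !(mx_addE, mx_oppE, mx_scaleE, mx_zeroE); field; rewrite gt_eqF.
Qed.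

Lemma prox_lip_norm z1 z2 :
  `|prox mu r z1 - prox mu r z2| <= (1 - mu * rho)^-1 * d%:R * `|z1 - z2|.
Proof.
have s0 : 0 < 1 - mu * rho by rewrite subr_gt0 (murho_lt1 rho_gt0).
rewrite (le_trans (norm_le_enorm _))// -mulrA ler_pdivlMl//.
rewrite (le_trans (prox_lipschitz r_gtNy r_proper r_closed rho_gt0 r_wconvex mu_range
    B _ _))//.
exact: enorm_le_norm.
Qed.

Lemma grad_lip_norm x y : `|grad g x - grad g y| <= beta * d%:R * `|x - y|.
Proof.
rewrite (le_trans (norm_le_enorm _))// (le_trans (grad_lip _ _))// -mulrA.
by rewrite ler_wpM2l// enorm_le_norm.
Qed.

(** The two-point conclusion of [saddle_structure] at [l], abstracted so that what follows sees only
    [P] and [H]. *)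
Let tangential l (P H : 'M[R]_d) := forall e, 0 < e ->
  exists2 del, 0 < del & forall y1 y2 v1 v2,
    `|y1 - l| < del -> `|y2 - l| < del -> `|v1| < del -> `|v2| < del ->
    subdiff f y1 v1 -> subdiff f y2 v2 ->
    `|((v1 - v2) - (y1 - y2) *m H) *m P| <= e * (`|y1 - y2| + `|v1 - v2|) /\
    `|(y1 - y2) - (y1 - y2) *m P| <= e * `|y1 - y2|.

(** The subgradients [v z] satisfy [dz = dy + mu (dv - dg)]. Modulo normal vectors [dv] is nearly
    [dy H], and [dg] is nearly [dy Gm]; projecting by [P] gives the linearized prox equation. Errors
    in [dy] and [dv] become errors in [dz] since both are Lipschitz in [z]. *)
Lemma prox_two_point l (P H Gm : 'M[R]_d) : T l = l ->
  strict_hessian g l Gm -> tangential l P H ->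
  forall e, 0 < e -> exists2 del, 0 < del & forall z1 z2,
    `|z1 - zed l| < del -> `|z2 - zed l| < del ->
    let dy := prox mu r z1 - prox mu r z2 in
    `|dy *m (P + mu *: ((H - Gm) *m P)) - (z1 - z2) *m P| <= e * `|z1 - z2| /\
    `|dy - dy *m P| <= e * `|z1 - z2|.
Proof.
move=> Tl sG tang e e0.
have s0 : 0 < 1 - mu * rho by rewrite subr_gt0 (murho_lt1 rho_gt0).
pose Lp := (1 - mu * rho)^-1 * d%:R.
have Lp0 : 0 <= Lp by rewrite /Lp; have s0w := ltW s0; nonneg.
pose Cv := mu^-1 * (1 + Lp) + beta * d%:R * Lp.
have mi0 : 0 <= mu^-1 by rewrite invr_ge0 ltW.
have Cv0 : 0 <= Cv by rewrite /Cv; nonneg.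
pose K := mu * (Lp + Cv) + mu * (d%:R * `|P| * Lp) + Lp.
have mw : 0 <= mu by exact: ltW.
have K0 : 0 <= K by rewrite /K; nonneg.
have e'0 : 0 < e / (1 + K) by rewrite divr_gt0// ltr_pwDl.
have eK : K * (e / (1 + K)) <= e by exact: small_mul.
move: (e / (1 + K)) e'0 eK => e' e'0 eK; have e'w := ltW e'0.
have eK1 : Lp * e' <= e.
  by apply: le_trans eK; rewrite ler_wpM2r// lerDr; nonneg.
have eK2 : mu * (d%:R * `|P| * Lp) * e' + mu * (Lp + Cv) * e' <= e.
  by apply: le_trans eK; rewrite -mulrDl ler_wpM2r// [leLHS]addrC lerDl.
have [d1 d10 h1] := tang _ e'0; have [d2 d20 h2] := sG _ e'0.
have D0 : 0 < 1 + Lp + Cv by rewrite -addrA ltr_pwDl// addr_ge0.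
pose m := Num.min d1 d2; have m_gt0 : 0 < m by rewrite lt_min d10.
exists (m / (1 + Lp + Cv)); first by rewrite divr_gt0.
pose v z := mu^-1 *: (z - prox mu r z) + grad g (prox mu r z).
have vlip z1 z2 : `|v z1 - v z2| <= Cv * `|z1 - z2|.
  have -> : v z1 - v z2 = mu^-1 *: ((z1 - z2) - (prox mu r z1 - prox mu r z2)) +
      (grad g (prox mu r z1) - grad g (prox mu r z2)).
    by rewrite /v; move: (grad _ _) (grad _ _) => a b; rowring.
  rewrite (le_trans (ler_normD _ _))// /Cv mulrDl lerD//.
    rewrite normrZ (ger0_norm mi0) -mulrA ler_wpM2l// mulrDl mul1r.
    by rewrite (le_trans (ler_normB _ _))// lerD2l prox_lip_norm.
  by rewrite (le_trans (grad_lip_norm _ _))// -[leRHS]mulrA ler_wpM2l ?mulr_ge0// prox_lip_norm.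
have pl := fixed_prox Tl.
have vl : v (zed l) = 0.
  rewrite /v pl; apply/rowP => i.
  by rewrite /zed !(mx_addE, mx_oppE, mx_scaleE, mx_zeroE); field; rewrite gt_eqF.
have near z : `|z - zed l| < m / (1 + Lp + Cv) ->
    `|prox mu r z - l| < m /\ `|v z| < m.
  rewrite ltr_pdivlMr// => zl; have z0 := normr_ge0 (z - zed l).
  have Lz : 0 <= Lp * `|z - zed l| by nonneg.
  have Cz : 0 <= Cv * `|z - zed l| by nonneg.
  split.
    have := prox_lip_norm z (zed l); rewrite pl -/Lp; lra.
  by have := vlip z (zed l); rewrite vl subr0; lra.
move=> z1 z2 /near[y1m v1m] /near[y2m v2m] dy.
have sub a : a < m -> a < d1 /\ a < d2.
  by rewrite lt_min => /andP[].
have dyL : `|dy| <= Lp * `|z1 - z2| by exact: prox_lip_norm.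
have dvL := vlip z1 z2.
have [] := h1 (prox mu r z1) (prox mu r z2) (v z1) (v z2).
- by have [] := sub _ y1m.
- by have [] := sub _ y2m.
- by have [] := sub _ v1m.
- by have [] := sub _ v2m.
- exact: prox_subdiff.
- exact: prox_subdiff.
rewrite -/dy => t1 t2.
have t3 : `|grad g (prox mu r z1) - grad g (prox mu r z2) - dy *m Gm| <= e' * `|dy|.
  by apply: h2; [have [] := sub _ y1m | have [] := sub _ y2m].
have z0 := normr_ge0 (z1 - z2).
have eL : e' * `|dy| <= e' * (Lp * `|z1 - z2|) by rewrite ler_pM2l.
split; last first.
  by rewrite (le_trans t2)// (le_trans eL)// mulrCA mulrA ler_wpM2r.
have dvE : v z1 - v z2 = mu^-1 *: ((z1 - z2) - dy) +
    (grad g (prox mu r z1) - grad g (prox mu r z2)).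
  by rewrite /v /dy; move: (grad _ _) (grad _ _) => a b; rowring.
set dv := v z1 - v z2 in dvE t1 dvL *; set dz := z1 - z2 in dvE dvL dyL eL *.
set dg := grad g _ - _ in dvE t3.
have -> : dy *m (P + mu *: ((H - Gm) *m P)) - dz *m P =
    mu *: ((dg - dy *m Gm) *m P) - mu *: ((dv - dy *m H) *m P).
  have -> : dz = mu *: (dv - dg) + dy.
    rewrite dvE addrK scalerA divff ?scale1r ?subrK// gt_eqF//.
  clearbody dy dg dv.
  rewrite mulmxDr -scalemxAr mulmxA mulmxBr !mulmxBl mulmxDl -scalemxAl mulmxBl.
  by rowring.
have t4 : `|mu *: ((dg - dy *m Gm) *m P)| <= mu * (d%:R * `|P| * Lp) * e' * `|dz|.
  rewrite normrZ (ger0_norm mw).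
  rewrite [leRHS](_ : _ = mu * (d%:R * (e' * (Lp * `|dz|)) * `|P|)); last by ring.
  rewrite ler_wpM2l// (le_trans (mulmx_norm _ _))// ler_wpM2r// ler_wpM2l//.
  exact: le_trans t3 eL.
have t5 : `|mu *: ((dv - dy *m H) *m P)| <= mu * (Lp + Cv) * e' * `|dz|.
  rewrite normrZ (ger0_norm mw) -!mulrA ler_wpM2l// (le_trans t1)//.
  by rewrite mulrCA ler_pM2l// mulrDl lerD.
apply: le_trans (ler_normB _ _) _; apply: le_trans (lerD t4 t5) _.
by rewrite -mulrDl ler_wpM2r.
Qed.

(** Difference quotients of the prox at [zed l] in tangent directions approximately solve the linear
    equation of [B], and [prox_monotone] passes its constant [1 - mu rho] on to [B]. *)
Lemma tangential_posdef l (P H Gm : 'M[R]_d) : T l = l ->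
  strict_hessian g l Gm -> tangential l P H ->
  P^T = P -> P *m P = P -> H^T = H -> Gm^T = Gm ->
  forall v, (1 - mu * rho) * dotp v v <=
    dotp (v *m (1%:M + mu *: (P *m (H - Gm) *m P))) v.
Proof.
move=> Tl sG tang PT PP HT GT.
have s1 : 0 < 1 - mu * rho <= 1.
  by rewrite subr_gt0 (murho_lt1 rho_gt0)//= gerBl mulr_ge0 ?ltW.
apply: (@posdef_of_tangent_prox _ _ P _ (P + mu *: ((H - Gm) *m P))) => //.
- rewrite linearD/= linearZ/= !trmx_mul PT linearB/= HT GT trmx1; congr (_ + _ *: _).
  by rewrite mulmxA.
- rewrite mulmxDl mulmxDr mul1mx mulmx1 -scalemxAl -scalemxAr; congr (_ + _ *: _).
  by rewrite -!mulmxA PP !mulmxA PP.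
- by move=> n nP; rewrite mulmxDr mulmx1 -scalemxAr !mulmxA nP !mul0mx scaler0 addr0.
- by move=> t tP; move: (H - Gm) => A; rewrite !mulmxDr mulmx1 -!scalemxAr !mulmxA tP.
move=> w e wP e0.
have e'0 : 0 < e / (1 + `|w|) by rewrite divr_gt0// ltr_pwDl.
have [del del0 h] := prox_two_point Tl sG tang e'0.
pose a := del / (2 * (1 + `|w|)).
have w1 : 0 < 1 + `|w| by rewrite ltr_pwDl.
have a0 : 0 < a by rewrite divr_gt0// mulr_gt0.
have al : `|zed l + a *: w - zed l| < del.
  rewrite addrC addKr normrZ (gtr0_norm a0) /a mulrAC.
  by rewrite ltr_pdivrMr ?mulr_gt0// ltr_pM2l//; have := normr_ge0 w; lra.
have ll : `|zed l - zed l| < del by rewrite subrr normr0.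
have /= := h _ _ al ll.
have := prox_monotone r_gtNy r_proper r_closed rho_gt0 r_wconvex mu_range B
  (zed l + a *: w) (zed l).
rewrite [zed l + _]addrC addrK; set dy := prox _ _ _ - _ => mono.
rewrite normrZ (gtr0_norm a0) => -[h1 h2].
have ae : e / (1 + `|w|) * (a * `|w|) <= a * e.
  by rewrite mulrCA ler_pM2l// mulrC; apply: small_mul.
have aa : a * a^-1 = 1 by rewrite divff// gt_eqF.
have dyE : dy = a *: (a^-1 *: dy) by rewrite scalerA aa scale1r.
exists (a^-1 *: dy); move: dyE; move: (a^-1 *: dy) => eta dyE.
rewrite {}dyE in mono h1 h2; split.
- rewrite -(ler_pM2l a0) -[a in a * `|_|](gtr0_norm a0) -normrZ scalerBr.
  by apply: le_trans ae; apply: le_trans h1; rewrite -!scalemxAl wP.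
- rewrite -(ler_pM2l a0) -[a in a * `|_|](gtr0_norm a0) -normrZ scalerBr.
  by apply: le_trans ae; apply: le_trans h2; rewrite -!scalemxAl.
move: mono; rewrite !(dotpZl, dotpZr) => mono.
rewrite -(ler_pM2l a0) -(ler_pM2l a0); lra.
Qed.

(* alpha_small enters only through its consequence
   (1 - alpha) s + alpha - alpha mu beta >= 0 with s = 1 - mu rho, because
   max 1 (mu rho / s) >= (1 - s) / s. *)
Lemma damped_form_ge0 l (P H Gm : 'M[R]_d) : T l = l ->
  strict_hessian g l Gm -> tangential l P H ->
  P^T = P -> P *m P = P -> H^T = H -> Gm^T = Gm ->
  forall t : 'rV[R]_d, t *m P = t ->
    0 <= dotp (t *m (1%:M + mu *: (P *m (H - Gm) *m P))) t -
         alpha * mu * dotp (t *m H) t.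
Proof.
move=> Tl sG tang PT PP HT GT t tP.
have pd := tangential_posdef Tl sG tang PT PP HT GT t.
have lip := hessian_le_lipschitz grad_lip sG t.
have BE : dotp (t *m (1%:M + mu *: (P *m (H - Gm) *m P))) t =
    dotp t t + mu * (dotp (t *m H) t - dotp (t *m Gm) t).
  rewrite mulmxDr mulmx1 -scalemxAr !mulmxA tP dotpDl dotpZl.
  by rewrite [dotp (_ *m P) _]dotp_mull PT tP mulmxBr dotpBl.
rewrite BE in pd *.
have s0 : 0 < 1 - mu * rho by rewrite subr_gt0 (murho_lt1 rho_gt0).
have /andP[a0 a1] := alpha_range.
have mb : 0 <= mu * beta by rewrite mulr_ge0// ltW.
have mr : 0 < mu * rho by rewrite mulr_gt0.
have key : 0 <= (1 - alpha) * (1 - mu * rho) + alpha - alpha * mu * beta.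
  move: alpha_small; set M := Num.max _ _ => aM.
  have M1 : mu * rho / (1 - mu * rho) <= M by rewrite le_max lexx orbT.
  have M2 : mu * rho <= M * (1 - mu * rho) by rewrite -ler_pdivrMr.
  have M3 : 1 <= M by rewrite le_max lexx.
  set s := 1 - mu * rho in s0 M2 *.
  have e1 : alpha * (mu * beta + (1 + mu * beta) * M) * s <= 1 * s.
    by rewrite ler_pM2r// ltW.
  have e2 : alpha * (1 + mu * beta) * (mu * rho) <= alpha * (1 + mu * beta) * (M * s).
    by rewrite ler_wpM2l// mulr_ge0 ?ltW// ltr_pwDl.
  have sE : mu * rho = 1 - s by rewrite /s; ring.
  rewrite sE in e2 mr; clearbody s.
  have : 0 <= alpha * (1 - s) by rewrite mulr_ge0// ltW.
  lra.
(* The form equals [(1 - alpha)] times that of [B] plus [alpha (|t|^2 - mu <t Gm, t>)]; the first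
   part is bounded below by [pd], the second by [lip]. *)
have k1 : 0 <= dotp t t * ((1 - alpha) * (1 - mu * rho) + alpha - alpha * mu * beta).
  by rewrite mulr_ge0 ?dotp_ge0.
have k2 : (1 - alpha) * ((1 - mu * rho) * dotp t t) <= (1 - alpha) *
    (dotp t t + mu * (dotp (t *m H) t - dotp (t *m Gm) t)).
  by rewrite ler_wpM2l// subr_ge0 ltW.
have k3 : alpha * mu * dotp (t *m Gm) t <= alpha * mu * (beta * dotp t t).
  by rewrite ler_wpM2l// mulr_ge0// ltW.
lra.
Qed.

(** With [v = x - y] and [w] the difference of the prox values, the hypotheses of
    [quadratic_expansion] are [prox_two_point] read in the variable [x]: the increment of [zed] is
    [v - mu v Gm] up to a small multiple of [|v|]. *)
Lemma strict_saddle_trapped l : T l = l -> strict_saddle f l ->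
  exists2 del, 0 < del & cnull [set x | forall k, `|iter k T x - l| < del].
Proof.
move=> Tl /saddle_structure[P [H [u [[PT PP HT uP uH] tang]]]].
have [Gm sG GT] := C2_strict_hessian l g_C2.
have s0 : 0 < 1 - mu * rho by rewrite subr_gt0 (murho_lt1 rho_gt0).
pose D := (H - Gm) *m P.
have [Q [theta [e [th1 e0 qu expand]]]] :
  exists Q theta e, [/\ 1 < theta, 0 < e, 0 < dotp (u *m Q) u & forall v w : 'rV[R]_d,
    `|w *m (P + mu *: D) - (v *m P - mu *: (v *m Gm *m P))| <= e * `|v| ->
    `|w - w *m P| <= e * `|v| ->
    theta * dotp (v *m Q) v <=
      dotp (((1 - alpha) *: v + alpha *: w) *m Q) ((1 - alpha) *: v + alpha *: w)].
  apply: (@quadratic_expansion _ _ P (1%:M + mu *: (P *m (H - Gm) *m P)) H Gm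
    (P + mu *: D) alpha mu _ u PT PP _ _ HT s0) => //.
  - rewrite linearD/= linearZ/= !trmx_mul PT linearB/= HT GT trmx1; congr (_ + _ *: _).
    by rewrite mulmxA.
  - rewrite mulmxDl mulmxDr mul1mx mulmx1 -scalemxAl -scalemxAr; congr (_ + _ *: _).
    by rewrite -!mulmxA PP !mulmxA PP.
  - exact: (tangential_posdef Tl sG tang PT PP HT GT).
  - move=> t tP; rewrite /D; move: (H - Gm) => A.
    by rewrite !mulmxDr mulmx1 -!scalemxAr !mulmxA tP.
  - exact: (damped_form_ge0 Tl sG tang PT PP HT GT).
pose Lz := 1 + mu * (beta * d%:R).
have mw : 0 <= mu by exact: ltW.
have Lz0 : 0 <= Lz by rewrite /Lz; nonneg.
pose K := Lz + mu * (d%:R * `|P|).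
have K0 : 0 <= K by rewrite /K; nonneg.
have e'0 : 0 < e / (1 + K) by rewrite divr_gt0// ltr_pwDl.
have eK : K * (e / (1 + K)) <= e by exact: small_mul.
move: (e / (1 + K)) e'0 eK => e' e'0 eK; have e'w := ltW e'0.
have eK1 : Lz * e' <= e.
  by apply: le_trans eK; rewrite ler_wpM2r// lerDl; nonneg.
have [d1 d10 h1] := prox_two_point Tl sG tang e'0; have [d2 d20 h2] := sG _ e'0.
have zlip x y : `|zed x - zed y| <= Lz * `|x - y|.
  have -> : zed x - zed y = (x - y) - mu *: (grad g x - grad g y).
    by rewrite /zed; rowring.
  rewrite (le_trans (ler_normB _ _))// /Lz mulrDl mul1r lerD2l normrZ (ger0_norm mw).
  by rewrite -mulrA ler_wpM2l// grad_lip_norm.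
exists (Num.min d2 (d1 / (1 + Lz))).
  by rewrite lt_min d20 divr_gt0// ltr_pwDl.
apply: (trapped_null th1 qu) => x y.
have zn x' : `|x' - l| < d1 / (1 + Lz) -> `|zed x' - zed l| < d1.
  rewrite ltr_pdivlMr ?ltr_pwDl// => xl; apply: le_lt_trans (zlip _ _) _.
  by have := normr_ge0 (x' - l); lra.
rewrite !lt_min => /andP[x2 /zn x1] /andP[y2 /zn y1].
have [/=] := h1 _ _ x1 y1; set w := prox _ _ _ - _ => w1 w2.
have h3 := h2 _ _ x2 y2.
rewrite step_sub -/w.
have zz := zlip x y.
have n0 := normr_ge0 (x - y).
have ez : e' * `|zed x - zed y| <= e' * (Lz * `|x - y|) by rewrite ler_pM2l.
apply: (expand (x - y) w); last first.
  by rewrite (le_trans w2)// (le_trans ez)// mulrCA mulrA ler_wpM2r.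
move: w1; have -> : zed x - zed y = (x - y) - mu *: (grad g x - grad g y).
  by rewrite /zed; rowring.
set dg := grad g x - grad g y in h3 *; set v := x - y in h3 *.
move=> w1.
have -> : w *m (P + mu *: D) - (v *m P - mu *: (v *m Gm *m P)) =
   (w *m (P + mu *: D) - (v - mu *: dg) *m P) - mu *: ((dg - v *m Gm) *m P).
  by clearbody w dg v; rewrite !mulmxBl -scalemxAl; rowring.
have t4 : `|mu *: ((dg - v *m Gm) *m P)| <= mu * (d%:R * `|P|) * e' * `|v|.
  rewrite normrZ (ger0_norm mw) -!mulrA ler_wpM2l// (le_trans (mulmx_norm _ _))//.
  by rewrite -mulrA ler_wpM2l// mulrC ler_wpM2l.
apply: le_trans (ler_normB _ _) _.
have w1' : `|w *m (P + mu *: D) - (v - mu *: dg) *m P| <= e' * (Lz * `|v|).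
  apply: le_trans w1 _; apply: le_trans ez.
  by rewrite /dg /v /zed le_eqVlt; apply/orP; left; apply/eqP; congr (_ * `|_|); rowring.
apply: le_trans (lerD w1' t4) _; rewrite mulrCA mulrA -mulrDl.
by rewrite ler_wpM2r// -mulrDl.
Qed.

End prox_gradient.

(** * Initial points attracted to saddles *)

Lemma cnull_iter_preimage (R : realType) (d : nat) (T : 'rV[R]_d -> 'rV[R]_d)
    (C : R) (W : set 'rV[R]_d) (m : nat) :
  (forall x y, `|x - y| <= C * `|T x - T y|) -> cnull W ->
  cnull [set x | W (iter m T x)].
Proof.
move=> TC W0; elim: m => [//|m IH].
apply: (cnull_preimage (phi := T) IH) => [x|x y _ _]; last exact: TC.
by rewrite /= -iterSr.
Qed.

Lemma ratr_row_approx (R : realType) (d : nat) (l : 'rV[R]_d) (e : R) : 0 < e ->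
  exists c : 'rV[rat]_d, `|l - map_mx ratr c| <= e.
Proof.
move=> e0; have /choice[c cP] : forall i : 'I_d, exists q : rat,
    ratr q \in `]l ord0 i - e, l ord0 i + e[.
  by move=> i; apply: rat_in_itvoo; rewrite ltrD2l -subr_gt0 opprK addr_gt0.
exists (\row_i c i); apply: mx_norm_le; first exact: ltW.
move=> i j; rewrite (ord1 i) mx_addE mx_oppE !mxE; have := cP j.
by rewrite in_itv/= ler_norml => /andP[h1 h2]; apply/andP; split; lra.
Qed.

Lemma cnull_limits (R : realType) (d : nat) (T : 'rV[R]_d -> 'rV[R]_d)
    (C : R) (S : set 'rV[R]_d) :
  (forall x y, `|x - y| <= C * `|T x - T y|) ->
  (forall l, S l -> exists2 del, 0 < del &
    cnull [set x | forall k, `|iter k T x - l| < del]) ->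
  cnull [set x | exists2 l, S l & (fun k => iter k T x) @ \oo --> l].
Proof.
move=> TC trapped.
pose W (i : 'rV[rat]_d * nat) := [set x : 'rV[R]_d |
  forall k, `|iter k T x - map_mx ratr i.1| < i.2.+1%:R^-1].
(* Nullity of the trapped set is part of membership, so a rational ball whose trapped set is not
   null contributes nothing and no saddle has to be chosen for each ball. *)
pose A (i : 'rV[rat]_d * nat * nat) : set 'rV[R]_d :=
  [set x | cnull (W i.1) /\ W i.1 (iter i.2 T x)].
have A0 i : cnull (A i).
  have [Wi|Wi] := pselect (cnull (W i.1)).
    by apply: cnull_sub (cnull_iter_preimage i.2 TC Wi) => x [].
  by apply: cnull_sub (@cnull_set0 R d) => x [/Wi].
apply: cnull_sub (cnull_bigcup A0) => x [l Sl xl].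
have [del del0 tr] := trapped l Sl.
(* A rational ball of radius [a < del / 2] whose centre is within [a / 2] of [l] lies in the
   [del]-ball around [l], and contains the orbit once it is within [a / 2] of [l]. *)
have [n ndel] : exists n : nat, n.+1%:R^-1 < del / 2.
  exists (Num.bound (2 / del)); rewrite invf_plt ?posrE// ?divr_gt0// invf_div.
  apply: lt_trans (archi_boundP _) _; first by rewrite divr_ge0// ltW.
  by rewrite ltr_nat.
have n0 : 0 < n.+1%:R^-1 :> R by rewrite invr_gt0.
move: (n0) ndel; set a := n.+1%:R^-1 => a0 ndel.
have a20 : 0 < a / 2 by rewrite divr_gt0.
have [c lc] := ratr_row_approx l a20.
have /cvgrPdist_lt/(_ _ a20)[m _ ml] := xl.
exists (c, n, m); split => /=.
  apply: cnull_sub tr => y Wy k; have := Wy k; rewrite -/a /= => h.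
  rewrite (_ : iter k T y - l =
    (iter k T y - map_mx ratr c) - (l - map_mx ratr c)); last by rowring.
  by rewrite (le_lt_trans (ler_normB _ _))//; lra.
move=> k; rewrite -iterD -/a.
have := ml (k + m)%N (leq_addl _ _) => /= h.
rewrite (_ : iter _ T x - _ =
  (l - map_mx ratr c) - (l - iter (k + m) T x)); last by rowring.
by rewrite (le_lt_trans (ler_normB _ _))//; lra.
Qed.

Theorem theorem4p2 (R : realType) (d : nat)
    (g : 'rV[R]_d -> R) (r : 'rV[R]_d -> \bar R) (beta rho mu alpha : R)
    (g_C2 : Cp 2 (g : 'rV[R]_d -> R^o))
    (beta_ge0 : 0 <= beta)
    (grad_lip : forall x y,
       enorm (grad g x - grad g y) <= beta * enorm (x - y))
    (r_gtNy : forall x, r x <> -oo%E)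
    (r_proper : exists x, r x <> +oo%E)
    (r_closed : closed_fun r)
    (rho_gt0 : 0 < rho)
    (r_wconvex : rho_weakly_convex rho r)
    (f_bounded_below : exists m : R, forall x, (m%:E <= composite g r x)%E)
    (f_saddle : strict_saddle_property (composite g r))
    (mu_range : 0 < mu < rho^-1)
    (alpha_range : 0 < alpha < 1)
    (alpha_small :
       alpha * (mu * beta +
         (1 + mu * beta) * Num.max 1 (mu * rho / (1 - mu * rho))) < 1) :
  lebesgue_null
    (~` [set x0 : 'rV[R]_d |
      forall l : 'rV[R]_d,
        (fun k : nat => iter k (prox_gradient_step mu alpha g r) x0)
          @ \oo --> l ->
        local_minimizer (composite g r) l]).
Proof.
set T := prox_gradient_step mu alpha g r.
have [c c0 cT] := step_expansive g_C2 beta_ge0 grad_lip r_gtNy r_proper r_closed rho_gt0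
  r_wconvex f_bounded_below mu_range alpha_range alpha_small.
have TC x y : `|x - y| <= c^-1 * d%:R * `|T x - T y|.
  rewrite (le_trans (norm_le_enorm _))// -mulrA ler_pdivlMl//.
  by rewrite (le_trans (cT x y))// enorm_le_norm.
apply: cnull_lebesgue_null.
apply: (cnull_sub (B := [set x | exists2 l, T l = l /\ strict_saddle (composite g r) l &
    (fun k => iter k T x) @ \oo --> l])).
  move=> x /= /existsNP[l /not_implyP[xl nmin]].
  have Tl : T l = l.
    exact: (limit_fixed g_C2 beta_ge0 grad_lip r_gtNy r_proper r_closed rho_gt0
      r_wconvex f_bounded_below mu_range alpha_range xl).
  exists l => //; split=> //.
  by have [|//|//] := f_saddle l; exact: (fixed_critical g_C2 beta_ge0 grad_lip r_gtNy
    r_proper r_closed rho_gt0 r_wconvex f_bounded_below mu_range alpha_range Tl).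
apply: (cnull_limits TC) => l [Tl sl].
exact: (strict_saddle_trapped g_C2 beta_ge0 grad_lip r_gtNy r_proper r_closed rho_gt0
  r_wconvex f_bounded_below mu_range alpha_range alpha_small Tl sl).
Qed.
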